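(* A $2$-step nilpotent real Lie algebra $\mathfrak g$ of dimension $7$ admits a coclosed $\mathrm G_2$-structure such that the connection $\nabla^1$ it defines is a $\mathrm G_2$-instanton if and only if $\mathfrak g$ is isomorphic to one of $\mathbb R^2\oplus\mathfrak h_5$, $\mathfrak h_7$, $\mathfrak h_{\mathbb H}$, $\mathbb R\oplus\mathfrak n_{3,2}$.
   Context: Notation: $e^{ij\cdots}=e^i\wedge e^j\wedge\cdots$; $d$ is the Chevalley–Eilenberg differential, $d\xi(x,y)=-\xi([x,y])$. $2$-step nilpotent means $[\mathfrak g,\mathfrak g]\ne0$, $[\mathfrak g,[\mathfrak g,\mathfrak g]]=0$. Lie algebras: $\mathfrak h_{2m+1}$ is the Heisenberg Lie algebra of dimension $2m+1$, with a dual basis satisfying $de^i=0$ for $i=1,\dots,2m$ and $de^{2m+1}=e^{12}+e^{34}+\dots+e^{2m-1\,2m}$. The quaternionic Heisenberg algebra $\mathfrak h_{\mathbb H}$ has a dual basis $\{e^1,\dots,e^7\}$ with $de^i=0$ ($i\le4$), $de^5=e^{13}-e^{24}$, $de^6=-e^{14}-e^{23}$, $de^7=e^{12}+e^{34}$. $\mathbb R\oplus\mathfrak n_{3,2}$ (with $\mathfrak n_{3,2}$ the free $2$-step nilpotent Lie algebra on $3$ generators) has a dual basis with $de^i=0$ ($i\le4$), $de^5=e^{23}$, $de^6=e^{24}$, $de^7=e^{34}$. A $\mathrm G_2$-structure on $\mathfrak g$ is $\varphi\in\Lambda^3\mathfrak g^*$ that in some basis of $\mathfrak g^*$ equals $e^{127}+e^{347}+e^{567}+e^{135}-e^{146}-e^{236}-e^{245}$.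 It determines an inner product $g$ and volume form by $(x\lrcorner\varphi)\wedge(y\lrcorner\varphi)\wedge\varphi=6g(x,y)\mathrm{vol}$ (such a basis is orthonormal and positively oriented), hence a Hodge star $\star$; put $\psi=\star\varphi$. $\varphi$ is coclosed if $d\psi=0$. The metric connection $\nabla^1$ (the characteristic connection) is defined by $g(\nabla^1_xy,z)=g(\nabla^g_xy,z)+\frac12T(x,y,z)$, where $\nabla^g$ is the Levi-Civita connection of the left-invariant metric $g$ on a Lie group with Lie algebra $\mathfrak g$ and $T=\frac16\star(d\varphi\wedge\varphi)\varphi-\star d\varphi$. Its curvature is $R^1_{x,y}=[\nabla^1_x,\nabla^1_y]-\nabla^1_{[x,y]}$, and it is a $\mathrm G_2$-instanton if $R^1\wedge\psi=0$, i.e. for all $u,v$ the 2-form $(x,y)\mapsto g(R^1_{x,y}u,v)$ wedged with $\psi$ vanishes. *)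

(* Defs.v *)
From HB Require Import structures.
From mathcomp Require Import all_boot all_order all_fingroup all_algebra.
From mathcomp Require Import reals.

Set Implicit Arguments.
Unset Strict Implicit.
Unset Printing Implicit Defensive.

Import Order.TTheory GRing.Theory Num.Theory.
Local Open Scope ring_scope.

Definition bilinear_map (F : fieldType) (U V W : vectType F)
    (b : U -> V -> W) : Prop :=
  (forall a x y z, b (a *: x + y) z = a *: b x z + b y z) /\
  (forall a x y z, b x (a *: y + z) = a *: b x y + b x z).

Record lieAlgebra (F : fieldType) := LieAlgebra {
  lie_sort :> vectType F;
  lie_br : lie_sort -> lie_sort -> lie_sort;
  lie_bilinear : bilinear_map lie_br;
  lie_brxx : forall x, lie_br x x = 0;
  lie_jacobi : forall x y z,
    lie_br x (lie_br y z) + lie_br y (lie_br z x) + lie_br z (lie_br x y) = 0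
}.

Definition lie_isomorphic (F : fieldType) (g h : lieAlgebra F) : Prop :=
  exists f : {linear g -> h},
    bijective f /\ forall x y, f (lie_br x y) = lie_br (f x) (f y).

Definition two_step_nilpotent (F : fieldType) (g : lieAlgebra F) : Prop :=
  (exists x y : g, lie_br x y <> 0) /\
  (forall x y z : g, lie_br x (lie_br y z) = 0).

Section DirectSum.
Variables (F : fieldType) (g h : lieAlgebra F).

Definition dsum_br (x y : (g * h)%type) : (g * h)%type :=
  (lie_br x.1 y.1, lie_br x.2 y.2).

Lemma dsum_bilinear : bilinear_map dsum_br.
Proof.
have [gl gr] := lie_bilinear g; have [hl hr] := lie_bilinear h.
by split=> a x y z; rewrite /dsum_br /= ?gl ?gr ?hl ?hr.
Qed.

Lemma dsum_brxx x : dsum_br x x = 0.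
Proof. by rewrite /dsum_br !lie_brxx. Qed.

Lemma dsum_jacobi x y z :
  dsum_br x (dsum_br y z) + dsum_br y (dsum_br z x) + dsum_br z (dsum_br x y)
  = 0.
Proof.
by rewrite /dsum_br /=; congr (_, _); rewrite /= lie_jacobi.
Qed.

Definition lie_dsum : lieAlgebra F :=
  LieAlgebra dsum_bilinear dsum_brxx dsum_jacobi.

End DirectSum.

Section Abelian.
Variables (F : fieldType) (n : nat).

Definition abelian_br (x y : 'rV[F]_n) : 'rV[F]_n := 0.

Lemma abelian_bilinear : bilinear_map abelian_br.
Proof. by split=> a x y z; rewrite /abelian_br scaler0 addr0. Qed.

Lemma abelian_jacobi x y z :
  abelian_br x (abelian_br y z) + abelian_br y (abelian_br z x)
  + abelian_br z (abelian_br x y) = 0.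
Proof. by rewrite /abelian_br !addr0. Qed.

Definition lie_abelian : lieAlgebra F :=
  LieAlgebra abelian_bilinear (fun=> erefl) abelian_jacobi.

End Abelian.

(* The Lie algebra with dual basis e^1, ..., e^(p+q) such that de^i = 0 for   *)
(* i <= p and de^(p+k) = \sum_(i, j) (w k) i j e^{ij}, where                  *)
(* e^{ij}(x, y) = x_i y_j - x_j y_i and d xi (x, y) = - xi [x, y].            *)
Section StructureEquations.
Variables (F : fieldType) (p q : nat) (w : 'I_q -> 'M[F]_p).

Definition se_br (x y : ('rV[F]_p * 'rV[F]_q)%type) :
    ('rV[F]_p * 'rV[F]_q)%type :=
  (0, \row_k - \sum_i \sum_j
        w k i j * (x.1 0 i * y.1 0 j - x.1 0 j * y.1 0 i)).

Lemma se_bilinear : bilinear_map se_br.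
Proof.
split=> a x y z; rewrite /se_br; congr (_, _); rewrite /= ?scaler0 ?addr0 //.
  apply/rowP=> k; rewrite !mxE mulrN -opprD mulr_sumr -big_split /=.
  congr (- _); apply: eq_bigr => i _; rewrite mulr_sumr -big_split /=.
  apply: eq_bigr => j _; rewrite !mxE mulrCA -mulrDr; congr (_ * _).
  by rewrite !mulrDl mulrBr !mulrA opprD addrACA.
apply/rowP=> k; rewrite !mxE mulrN -opprD mulr_sumr -big_split /=.
congr (- _); apply: eq_bigr => i _; rewrite mulr_sumr -big_split /=.
apply: eq_bigr => j _; rewrite !mxE mulrCA -mulrDr; congr (_ * _).
by rewrite !mulrDr mulrN !(mulrCA a) opprD addrACA.
Qed.

Lemma se_brxx x : se_br x x = 0.
Proof.
congr (_, _); apply/rowP=> k; rewrite !mxE big1 ?oppr0 // => i _.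
by rewrite big1 // => j _; rewrite mulrC (mulrC (x.1 0 j)) subrr mul0r.
Qed.

Lemma se_br2 x y z : se_br x (se_br y z) = 0.
Proof.
congr (_, _); apply/rowP=> k; rewrite !mxE big1 ?oppr0 // => i _.
by rewrite big1 // => j _; rewrite !mxE !mulr0 subrr mulr0.
Qed.

Lemma se_jacobi x y z :
  se_br x (se_br y z) + se_br y (se_br z x) + se_br z (se_br x y) = 0.
Proof. by rewrite !se_br2 !addr0. Qed.

Definition lie_se : lieAlgebra F := LieAlgebra se_bilinear se_brxx se_jacobi.

End StructureEquations.

(* e^{ij}, with 1-based indices. *)
Definition se_e (F : fieldType) (p : nat) (i j : nat) : 'M[F]_p.+1 :=
  delta_mx (inord i.-1) (inord j.-1).

(* h_{2m+1}: de^{2m+1} = e^{12} + e^{34} + ... (indices in the code are       *)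
(* 0-based).                                                                  *)
Definition heisenberg (F : fieldType) (m : nat) : lieAlgebra F :=
  @lie_se F m.*2 1 (fun=>
    \matrix_(i, j) ((~~ odd i) && (j == i.+1 :> nat))%:R).

Definition quat_heisenberg (F : fieldType) : lieAlgebra F :=
  @lie_se F 4 3 (tnth [tuple se_e F 3 1 3 - se_e F 3 2 4;
                             - se_e F 3 1 4 - se_e F 3 2 3;
                             se_e F 3 1 2 + se_e F 3 3 4]).

(* The free 2-step nilpotent Lie algebra n_{3,2} on 3 generators:             *)
(* de^4 = e^{12}, de^5 = e^{13}, de^6 = e^{23}.                               *)
Definition n32 (F : fieldType) : lieAlgebra F :=
  @lie_se F 3 3 (tnth [tuple se_e F 2 1 2; se_e F 2 1 3; se_e F 2 2 3]).

Section Forms.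
Variables (R : realType) (g : lieAlgebra R).

Definition kform (k : nat) := k.-tuple g -> R.

Definition tset k (v : k.-tuple g) (i : 'I_k) (x : g) : k.-tuple g :=
  [tuple if j == i then x else tnth v j | j < k].

(* Membership of a function on k-tuples in Lambda^k g^*. *)
Definition is_form k (a : kform k) : Prop :=
  (forall v i c x y,
     a (tset v i (c *: x + y)) = c * a (tset v i x) + a (tset v i y)) /\
  (forall v i j, i != j -> tnth v i = tnth v j -> a v = 0).

(* Normalised so that (e^1 /\ ... /\ e^k)(e_1, ..., e_k) = 1. *)
Definition wedge k l (a : kform k) (b : kform l) : kform (k + l) := fun v =>
  ((k`! * l`!)%:R)^-1 *
  \sum_(s : 'S_(k + l)) (-1) ^+ s *
    a [tuple tnth v (s (lshift l i)) | i < k] *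
    b [tuple tnth v (s (rshift k j)) | j < l].

Definition contract k (x : g) (a : kform k.+1) : kform k :=
  fun v => a [tuple of x :: v].

(* (da)(v_0, ..., v_{k+1}) =                                                  *)
(*    \sum_(i < j) (-1)^(i+j) a([v_i, v_j], v_0, .. omit v_i, v_j ..).        *)
(* For i < j the index i, seen in 'I_k.+2, is lift j i, and m |->             *)
(* lift j (lift i m) enumerates increasingly the indices other than i and j.  *)
Definition ce_d k (a : kform k.+1) : kform k.+2 := fun v =>
  \sum_(j : 'I_k.+2) \sum_(i : 'I_k.+1 | (i < j)%N)
    (-1) ^+ (i + j) *
    a [tuple of lie_br (tnth v (lift j i)) (tnth v j)
             :: [tuple tnth v (lift j (lift i m)) | m < k]].

Definition covector (f : 'Hom(g, R^o)) : kform 1 := fun v => f (thead v).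

(* E i is e^i, with 1-based indices. *)
Definition standard_G2 (e : 7.-tuple 'Hom(g, R^o)) : kform 3 :=
  let E i := covector (tnth e (inord i.-1)) in
  let E3 i j k : kform 3 := wedge (wedge (E i) (E j)) (E k) in
  fun v => E3 1 2 7 v + E3 3 4 7 v + E3 5 6 7 v + E3 1 3 5 v
           - E3 1 4 6 v - E3 2 3 6 v - E3 2 4 5 v.

Definition G2_structure (phi : kform 3) : Prop :=
  exists e : 7.-tuple 'Hom(g, R^o), basis_of fullv e /\ phi =1 standard_G2 e.

Definition inner_product (met : g -> g -> R) : Prop :=
  [/\ bilinear_map (met : g -> g -> R^o),
      forall x y, met x y = met y x &
      forall x, x != 0 -> 0 < met x x].

Definition orthonormal_tuple (met : g -> g -> R) n (b : n.-tuple g) : Prop :=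
  forall i j, met (tnth b i) (tnth b j) = (i == j)%:R.

(* The last condition alone fixes (met, vol) only up to (c met, c^-1 vol);    *)
(* asking that vol be the volume form of met, for one of the two              *)
(* orientations, makes the pair unique.                                       *)
Definition G2_metric_volume (phi : kform 3) (met : g -> g -> R) (vol : kform 7) :
    Prop :=
  [/\ inner_product met,
      is_form vol,
      forall b : 7.-tuple g, orthonormal_tuple met b -> `|vol b| = 1 &
      forall x y, wedge (wedge (contract x phi) (contract y phi)) phi
                  =1 (fun v => 6 * met x y * vol v)].

(* The Hodge star of the metric with orthonormal basis b and volume form vol, *)
(* i.e. a /\ star c = <a, c> vol.  It does not depend on the choice of the    *)
(* orthonormal basis b.                                                       *)
Definition hodge k l (b : (k + l).-tuple g) (vol : kform (k + l)) (a : kform k) :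
    kform l := fun v =>
  (k`!%:R)^-1 *
  \sum_(I : k.-tuple 'I_(k + l))
    a (map_tuple (tnth b) I) * vol (cat_tuple (map_tuple (tnth b) I) v).

Definition psi_of (b : 7.-tuple g) (vol : kform 7) (phi : kform 3) : kform 4 :=
  @hodge 3 4 b vol phi.

Definition coclosed (b : 7.-tuple g) (vol : kform 7) (phi : kform 3) : Prop :=
  forall v, ce_d (psi_of b vol phi) v = 0.

Definition torsion (b : 7.-tuple g) (vol : kform 7) (phi : kform 3) : kform 3 :=
  fun v => 6^-1 * @hodge 7 0 b vol (wedge (ce_d phi) phi) [tuple] * phi v
           - @hodge 4 3 b vol (ce_d phi) v.

(* Left-invariant connections on a Lie group with Lie algebra g are bilinear  *)
(* maps (x, y) |-> nabla_x y on g; inner products of left-invariant fields    *)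
(* are constant, whence the form taken by metric compatibility.               *)
Definition levi_civita (met : g -> g -> R) (nabla : g -> g -> g) : Prop :=
  [/\ bilinear_map nabla,
      forall x y, nabla x y - nabla y x = lie_br x y &
      forall x y z, met (nabla x y) z + met y (nabla x z) = 0].

Definition connection_with_torsion (met : g -> g -> R) (nabla : g -> g -> g)
    (T : kform 3) (nabla1 : g -> g -> g) : Prop :=
  forall x y z,
    met (nabla1 x y) z = met (nabla x y) z + 2^-1 * T [tuple x; y; z].

Definition curvature (nabla : g -> g -> g) (x y u : g) : g :=
  nabla x (nabla y u) - nabla y (nabla x u) - nabla (lie_br x y) u.

Definition G2_instanton (met : g -> g -> R) (psi : kform 4)
    (nabla : g -> g -> g) : Prop :=
  forall u v w,
    @wedge 2 4 (fun xy => met (curvature nabla (tnth xy ord0) (tnth xy ord_max) u) v)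
      psi w = 0.

End Forms.

(* Main.v *)
(* A G2-frame is a basis in which phi has the standard components; it is      *)
(* automatically orthonormal and positively oriented, and in it coclosedness  *)
(* and the instanton condition are polynomial equations on the structure      *)
(* constants.  Any orthonormal x, y, w with w orthogonal to x, y and x * y    *)
(* (the G2 cross product) extend to such a frame, with x, y, x * y, w in the  *)
(* positions 5, 6, 7, 4.  Hence the derived algebra, which has dimension at   *)
(* most 3, may be assumed to be spanned by e_7; or e_5, e_6; or e_5, e_6,     *)
(* e_7; or e_5, e_6 and c e_7 + s e_4 with s <> 0.                            *)
(* In the first case the equations make de^7 a primitive (1,1)-form on        *)
(* e_1, ..., e_6; it cannot have rank 2 by the Pluecker relations, and        *)
(* Darboux's theorem gives R^2 + h_5 or h_7.  In the second and third cases   *)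
(* de^{5+a} = \sum_b M a b w+_b + N a b w-_b with w+_b self-dual and w-_b     *)
(* anti-self-dual; the equations give M = m Id and m N = - cof N.  Linear     *)
(* independence of de^5 and de^6 forces m <> 0, which excludes the second     *)
(* case, and N is zero (quaternionic Heisenberg algebra) or m times an        *)
(* orthogonal matrix, when the three forms de^{5+a} have a common kernel      *)
(* vector in <e_1, ..., e_4> (R + n_{3,2}).  In the last case the equations   *)
(* have only the zero solution.  Conversely each of the four algebras has a   *)
(* basis in which the standard G2-form solves the equations.                  *)

Require Import Defs.
From Stdlib Require Import BinInt.
From HB Require Import structures.
From mathcomp Require Import all_boot all_order all_fingroup all_algebra.
From mathcomp Require Import reals ssrZ ring lra.

Set Implicit Arguments.
Unset Strict Implicit.
Unset Printing Implicit Defensive.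

Import Order.TTheory GRing.Theory Num.Theory.
Local Open Scope ring_scope.

Local Delimit Scope Z_scope with BZ.

(** * Multilinear forms *)

(** The frame dual to the coframe of a G2-structure is orthonormal for the induced metric
    ([frame_orthonormal]). In it [d psi], the torsion, the characteristic connection and its
    curvature have components that are polynomials with rational coefficients in the structure
    constants. Wedging a two-form with [psi] amounts to contracting it with [phi], so coclosedness
    and the instanton condition become explicit polynomial equations, necessary by [frame_equations]
    and sufficient by [frame_solution]. They are computed by reflection, on polynomials with integer
    coefficients.

    For existence, each of the four algebras has a basis in which all these polynomials reduce to
    zero; declaring that basis a G2-frame gives the structure ([exists_solution],
    [model_instanton]).

    For the converse, the freedom to choose a G2-frame ([adapted_frame_rep]) is spent on the derived
    algebra ([adapted_cases]), which leaves few unknowns. The equations of [d psi] are linear and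
    fix the shape of the forms [de^k]; the quadratic instanton equations then act through
    positivity, since suitable combinations are sums of squares. In [line_case] this makes [de^7]
    primitive of type (1,1), and [rank_two_algebra] excludes rank 2. In [quat_case] the self-dual
    part is a nonzero scalar [m], and the anti-self-dual part is zero or [- m] times a rotation; the
    quaternion of that rotation spans the common kernel of the three forms ([quat_kernel]). The
    remaining positions contradict the choice of the derived algebra ([plane_case], [tilt_case]). *)

Section Multilinear.
Variables (R : realType) (g : lieAlgebra R).

Definition multilinear k (a : kform g k) : Prop := forall v i c x y,
  a (tset v i (c *: x + y)) = c * a (tset v i x) + a (tset v i y).

Definition alternating k (a : kform g k) : Prop := forall v i j,
  i != j -> tnth v i = tnth v j -> a v = 0.

Lemma tnth_tset k (v : k.-tuple g) i x j :
  tnth (tset v i x) j = if j == i then x else tnth v j.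
Proof. by rewrite tnth_mktuple. Qed.

Lemma tset_id k (v : k.-tuple g) i : tset v i (tnth v i) = v.
Proof. by apply: eq_from_tnth => j; rewrite tnth_tset; case: eqP => // ->. Qed.

Lemma multilinear0 k (a : kform g k) v i :
  multilinear a -> a (tset v i 0) = 0.
Proof.
move=> ml; have := ml v i (-1) 0 0; rewrite scaler0 addr0 mulN1r addNr.
by [].
Qed.

Lemma multilinear_sum k (a : kform g k) v i (I : finType) (c : I -> R)
    (x : I -> g) : multilinear a ->
  a (tset v i (\sum_j c j *: x j)) = \sum_j c j * a (tset v i (x j)).
Proof.
move=> ml; elim/big_rec2: _ => [|j s y _ <-]; first exact: multilinear0.
exact: ml.
Qed.

Lemma multilinearZ k (a : kform g k) v i c x :
  multilinear a -> a (tset v i (c *: x)) = c * a (tset v i x).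
Proof.
by move=> ml; rewrite -[c *: x]addr0 ml multilinear0 // addr0.
Qed.

Lemma multilinear_contract k (a : kform g k.+1) x :
  multilinear a -> multilinear (contract x a).
Proof.
move=> ml v i c y z; rewrite /contract.
have E w : [tuple of x :: tset v i w] = tset [tuple of x :: v] (lift ord0 i) w.
  apply: eq_from_tnth => j; rewrite tnth_tset.
  case: (unliftP ord0 j) => [j' ->|->]; last by rewrite !tnth0.
  by rewrite !tnthS tnth_tset (inj_eq lift_inj).
by rewrite !E ml.
Qed.

Lemma multilinear_slot0 k (a : kform g k.+1) (v : k.-tuple g) c (x y : g) :
  multilinear a ->
  a [tuple of (c *: x + y) :: v]
  = c * a [tuple of x :: v] + a [tuple of y :: v].
Proof.
move=> ml.
have E w : [tuple of w :: v] = tset [tuple of 0 :: v] ord0 w.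
  apply: eq_from_tnth => j; rewrite tnth_tset.
  case: (unliftP ord0 j) => [j' ->|->]; last by rewrite eqxx.
  by rewrite !tnthS eq_sym (negbTE (neq_lift _ _)).
by rewrite (E (c *: x + y)) (E x) (E y) ml.
Qed.

Section Spanning.
Variables (n : nat) (f : n.-tuple g).
Hypothesis span_f : forall x, exists c : 'I_n -> R, x = \sum_i c i *: tnth f i.

(* The slots are expanded one after the other.                                *)
Lemma multilinear_eq0 k (a : kform g k) : multilinear a ->
  (forall I : k.-tuple 'I_n, a (map_tuple (tnth f) I) = 0) -> forall v, a v = 0.
Proof.
move=> ml a0 v.
suff: forall m v, (m <= k)%N ->
    (forall i : 'I_k, (m <= i)%N -> exists j, tnth v i = tnth f j) -> a v = 0.
  by move=> /(_ k v (leqnn k)); apply=> i; rewrite leqNgt ltn_ord.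
elim=> [|m IHm] {}v lemk vf.
  have [I EI] := fin_all_exists (fun i => vf i isT).
  rewrite -(a0 [tuple I i | i < k]); congr (a _); apply: eq_from_tnth => i.
  by rewrite tnth_map tnth_mktuple EI.
pose i0 := Ordinal lemk; have [c Ec] := span_f (tnth v i0).
rewrite -(tset_id v i0) Ec multilinear_sum // big1 // => j _.
rewrite IHm ?mulr0 ?(ltnW lemk) // => i lemi; rewrite tnth_tset.
case: eqP => [_|/eqP nei]; first by exists j.
by apply: vf; rewrite ltn_neqAle lemi andbT eq_sym.
Qed.

Lemma multilinear_eq k (a b : kform g k) : multilinear a -> multilinear b ->
  (forall I : k.-tuple 'I_n,
     a (map_tuple (tnth f) I) = b (map_tuple (tnth f) I)) -> a =1 b.
Proof.
move=> mla mlb ab v; apply/eqP; rewrite -subr_eq0; apply/eqP.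
apply: (@multilinear_eq0 k (fun v => a v - b v)) => [{}v i c x y|I].
  by rewrite mla mlb mulrBr opprD addrACA.
by rewrite ab subrr.
Qed.

End Spanning.

(** Transpositions generate the symmetric group, so only the swap of two slots needs an argument. *)
Lemma alternating_perm k (a : kform g k) (s : 'S_k) v :
  multilinear a -> alternating a ->
  a [tuple tnth v (s i) | i < k] = (-1) ^+ s * a v.
Proof.
move=> ml alt.
suff swap i j w : i != j ->
    a [tuple tnth w (tperm i j l) | l < k] = - a w.
  have [ts -> _] := prod_tpermP s; elim: ts v => [|[i j] ts IHts] v.
    rewrite big_nil odd_perm1 mul1r; congr a.
    by apply: eq_from_tnth => i; rewrite tnth_mktuple perm1.
  rewrite big_cons /= odd_permM odd_tperm signr_addb -mulrA -IHts.
  set p := (\prod_(t <- ts) _)%g.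
  have -> : [tuple tnth v ((tperm i j * p)%g l) | l < k]
     = [tuple tnth [tuple tnth v (p l) | l < k] (tperm i j l) | l < k].
    by apply: eq_from_tnth => l; rewrite !tnth_mktuple permM.
  case: (eqVneq i j) => [->|nij] /=; last by rewrite swap // expr1 mulN1r.
  rewrite expr0 mul1r; congr a; apply: eq_from_tnth => l.
  by rewrite !tnth_mktuple tperm1 perm1.
move=> nij; set x := tnth w i; set y := tnth w j.
pose W u z := tset (tset w i u) j z.
have mlj u z z' : a (W u (z + z')) = a (W u z) + a (W u z').
  by have := ml (tset w i u) j 1 z z'; rewrite scale1r mul1r.
have W2 u z : W u z = tset (tset w j z) i u.
  apply: eq_from_tnth => l; rewrite !tnth_tset.
  by case: (eqVneq l i) => [->|//]; rewrite (negbTE nij).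
have mli u u' z : a (W (u + u') z) = a (W u z) + a (W u' z).
  by rewrite !W2; have := ml (tset w j z) i 1 u u'; rewrite scale1r mul1r.
have diag z : a (W z z) = 0.
  by apply: (alt _ _ _ nij); rewrite !tnth_tset eqxx (negbTE nij) eqxx.
have Wxy : W x y = w.
  apply: eq_from_tnth => l; rewrite !tnth_tset /x /y.
  by case: eqP => [->//|_]; case: eqP => [->|].
have Wyx : [tuple tnth w (tperm i j l) | l < k] = W y x.
  apply: eq_from_tnth => l; rewrite tnth_mktuple !tnth_tset /x /y.
  case: tpermP => [->|->|/eqP/negbTE-> /eqP/negbTE-> //]; last by rewrite eqxx.
  by rewrite (negbTE nij) eqxx.
(* Polarisation: with [x + y] in both slots the diagonal terms vanish and the two mixed terms must
   cancel. *)
have := diag (x + y); rewrite mlj !mli !diag add0r addr0 Wxy -Wyx.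
by move/eqP; rewrite addrC addr_eq0 => /eqP ->; rewrite opprK.
Qed.

End Multilinear.

(** * Wedge products *)

Section Wedge.
Variables (R : realType) (g : lieAlgebra R).

Lemma multilinear_wedge k l (a : kform g k) (b : kform g l) :
  multilinear a -> multilinear b -> multilinear (wedge a b).
Proof.
move=> mla mlb v i c x y; rewrite /wedge mulrCA -mulrDr; congr (_ * _).
rewrite mulr_sumr -big_split; apply: eq_bigr => s _ /=.
(* Slot [i] feeds one argument of one factor; the block that contains [s^-1 i] tells which. *)
case Ei: (split ((s^-1)%g i)) (splitK ((s^-1)%g i)) => [j|j] /= Ej.
  have Eb z : [tuple tnth (tset v i z) (s (rshift k j')) | j' < l]
      = [tuple tnth v (s (rshift k j')) | j' < l].
    apply: eq_from_tnth => j'; rewrite !tnth_mktuple.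
    by case: eqP => // E; move: Ej; rewrite -E permK => /eqP; rewrite eq_lrshift.
  have Ea z : [tuple tnth (tset v i z) (s (lshift l j')) | j' < k]
      = tset [tuple tnth v (s (lshift l j')) | j' < k] j z.
    apply: eq_from_tnth => j'; rewrite !tnth_mktuple.
    have -> // : (j' == j) = (s (lshift l j') == i).
    by rewrite (can2_eq (permK s) (permKV s)) -Ej (inj_eq (@lshift_inj k l)).
  rewrite !Eb !Ea mla mulrDr mulrDl; congr (_ + _).
  by rewrite !mulrA; congr (_ * _ * _); rewrite mulrC.
have Ea z : [tuple tnth (tset v i z) (s (lshift l j')) | j' < k]
    = [tuple tnth v (s (lshift l j')) | j' < k].
  apply: eq_from_tnth => j'; rewrite !tnth_mktuple.
  by case: eqP => // E; move: Ej; rewrite -E permK => /eqP; rewrite eq_rlshift.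
have Eb z : [tuple tnth (tset v i z) (s (rshift k j')) | j' < l]
    = tset [tuple tnth v (s (rshift k j')) | j' < l] j z.
  apply: eq_from_tnth => j'; rewrite !tnth_mktuple.
  have -> // : (j' == j) = (s (rshift k j') == i).
  by rewrite (can2_eq (permK s) (permKV s)) -Ej (inj_eq (@rshift_inj k l)).
by rewrite !Eb !Ea mlb mulrDr mulrCA.
Qed.

Lemma wedge_lin k l (a a1 a2 : kform g k) (b : kform g l) t v :
  (forall w, a w = t * a1 w + a2 w) ->
  wedge a b v = t * wedge a1 b v + wedge a2 b v.
Proof.
move=> aE; rewrite /wedge mulrCA -mulrDr; congr (_ * _).
rewrite mulr_sumr -big_split; apply: eq_bigr => s _ /=.
by rewrite aE mulrDr mulrDl; congr (_ + _); rewrite -!mulrA mulrCA.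
Qed.

Lemma wedge_linr k l (a : kform g k) (b b1 b2 : kform g l) t v :
  (forall w, b w = t * b1 w + b2 w) ->
  wedge a b v = t * wedge a b1 v + wedge a b2 v.
Proof.
move=> bE; rewrite /wedge mulrCA -mulrDr; congr (_ * _).
rewrite mulr_sumr -big_split; apply: eq_bigr => s _ /=.
by rewrite bE mulrDr mulrCA.
Qed.

Lemma wedge_perm k l (a : kform g k) (b : kform g l) v (s : 'S_(k + l)) :
  wedge a b [tuple tnth v (s i) | i < k + l] = (-1) ^+ s * wedge a b v.
Proof.
rewrite /wedge mulrCA; congr (_ * _).
rewrite mulr_sumr [RHS](reindex_inj (mulIg s)) /=; apply: eq_bigr => t _.
rewrite odd_permM addbC signr_addb -!mulrA signrMK.
congr (_ * (a _ * b _)); apply: eq_from_tnth => i;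
  by rewrite !tnth_mktuple permM.
Qed.

End Wedge.

(** * The Levi-Civita symbol *)

Section Levi.
Variable R : realType.

(** The Levi-Civita symbol as a determinant of Kronecker deltas: the sign of a permutation, and zero
    on a tuple with a repetition. *)
Definition levi n (I : n.-tuple 'I_n) : R :=
  \det (\matrix_(i, j) (tnth I i == j)%:R).

Lemma levi_perm n (s : 'S_n) : levi [tuple s i | i < n] = (-1) ^+ s.
Proof.
rewrite /levi -det_perm; congr (\det _).
by apply/matrixP=> i j; rewrite !mxE tnth_mktuple.
Qed.

Lemma levi_eq0 n (I : n.-tuple 'I_n) i j :
  i != j -> tnth I i = tnth I j -> levi I = 0.
Proof.
move=> nij Eij; apply: (determinant_alternate nij) => m.
by rewrite !mxE Eij.
Qed.

(** Leibniz formula for each symbol. Summing over arbitrary tuples instead of permutations lets the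
    sum split over the two blocks of a wedge product, as in [wedge_levi]. *)
Lemma levi_sum n (G : n.-tuple 'I_n -> R) :
  \sum_(s : 'S_n) (-1) ^+ s * G [tuple s i | i < n] = \sum_I levi I * G I.
Proof.
transitivity (\sum_(s : 'S_n) \sum_I
    (-1) ^+ s * (I == [tuple s i | i < n])%:R * G I).
  apply: eq_bigr => s _; rewrite (bigD1 [tuple s i | i < n]) //= eqxx mulr1.
  by rewrite big1 ?addr0 // => I /negbTE ->; rewrite mulr0 mul0r.
rewrite exchange_big; apply: eq_bigr => I _; rewrite -mulr_suml.
congr (_ * _); apply: eq_bigr => s _; congr (_ * _).
under eq_bigr do rewrite mxE.
case: eqP => [->|/eqP neI].
  by rewrite big1 // => i _; rewrite tnth_mktuple eqxx.
have /existsP[i nei] : [exists i, tnth I i != s i].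
  apply: contraR neI => /existsPn E; apply/eqP/eq_from_tnth => i.
  by rewrite tnth_mktuple; apply/eqP; rewrite -[_ == _]negbK E.
by rewrite (bigD1 i) //= (negbTE nei) mul0r.
Qed.

Variable g : lieAlgebra R.

Lemma inj_tuple_perm n (I : n.-tuple 'I_n) :
  (exists i j, i != j /\ tnth I i = tnth I j) \/
  exists s : 'S_n, I = [tuple s i | i < n].
Proof.
case: (altP (@injectiveP _ _ (tnth I))) => [injI|/injectivePn[i [j nij Eij]]].
  right; exists (perm injI); apply: eq_from_tnth => i.
  by rewrite tnth_mktuple permE.
by left; exists i, j.
Qed.

Lemma alternating_levi n (w : kform g n) (f : n.-tuple g) I :
  multilinear w -> alternating w ->
  w (map_tuple (tnth f) I) = levi I * w f.
Proof.
move=> ml alt; case: (inj_tuple_perm I) => [[i [j [nij Eij]]]|[s ->]].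
  rewrite (levi_eq0 nij Eij) mul0r; apply: (alt _ _ _ nij).
  by rewrite !tnth_map Eij.
rewrite levi_perm -(alternating_perm s f ml alt); congr w.
by apply: eq_from_tnth => i; rewrite tnth_map !tnth_mktuple.
Qed.

(** Swapping two equal arguments leaves the tuple unchanged, yet changes the sign by
    [wedge_perm]. *)
Lemma wedge_alternating k l (a : kform g k) (b : kform g l) :
  alternating (wedge a b).
Proof.
move=> v i j nij Eij; have := wedge_perm a b v (tperm i j).
have -> : [tuple tnth v (tperm i j l) | l < k + l] = v.
  apply: eq_from_tnth => m; rewrite tnth_mktuple.
  by case: tpermP => [->|->|] //.
rewrite odd_tperm nij expr1 mulN1r => /eqP.
by rewrite -addr_eq0 -mulr2n mulrn_eq0 /= => /eqP.
Qed.

Lemma big_cat_tuple k l (T : finType) (G : (k + l).-tuple T -> R) :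
  \sum_L G L = \sum_(I : k.-tuple T) \sum_(J : l.-tuple T) G (cat_tuple I J).
Proof.
rewrite pair_big /=.
rewrite (reindex (fun p : k.-tuple T * l.-tuple T => cat_tuple p.1 p.2)) //=.
exists (fun L => ([tuple tnth L (lshift l i) | i < k],
                  [tuple tnth L (rshift k i) | i < l])) => [[I J] _|L _] /=.
  by congr (_, _); apply: eq_from_tnth => i;
    rewrite tnth_mktuple ?tnth_lshift ?tnth_rshift.
apply: eq_from_tnth => i; rewrite -(splitK i).
by case: split => j /=; rewrite ?tnth_lshift ?tnth_rshift tnth_mktuple.
Qed.

Lemma wedge_levi k l (a : kform g k) (b : kform g l) v :
  wedge a b v = (k`! * l`!)%:R^-1 *
    \sum_(I : k.-tuple 'I_(k + l)) \sum_(J : l.-tuple 'I_(k + l))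
      levi (cat_tuple I J) *
        (a (map_tuple (tnth v) I) * b (map_tuple (tnth v) J)).
Proof.
rewrite /wedge; congr (_ * _).
pose G (L : (k + l).-tuple 'I_(k + l)) :=
  a [tuple tnth v (tnth L (lshift l i)) | i < k] *
  b [tuple tnth v (tnth L (rshift k j)) | j < l].
transitivity (\sum_L levi L * G L).
  rewrite -levi_sum; apply: eq_bigr => s _; rewrite mulrA.
  by congr (_ * a _ * b _); apply: eq_from_tnth => i; rewrite !tnth_mktuple.
rewrite big_cat_tuple; apply: eq_bigr => I _; apply: eq_bigr => J _.
congr (_ * (a _ * b _)); apply: eq_from_tnth => i;
  by rewrite tnth_mktuple tnth_map ?tnth_lshift ?tnth_rshift.
Qed.

End Levi.

(** * Inner products and orthonormal bases *)

Section Metric.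
Variables (R : realType) (g : lieAlgebra R) (met : g -> g -> R).
Hypothesis ip : inner_product met.

Lemma metDZl c x y z : met (c *: x + y) z = c * met x z + met y z.
Proof. by have [[ml _] _ _] := ip; exact: ml. Qed.

Lemma metDZr c x y z : met z (c *: x + y) = c * met z x + met z y.
Proof. by have [[_ mr] _ _] := ip; exact: mr. Qed.

Lemma metC x y : met x y = met y x.
Proof. by have [_ mC _] := ip. Qed.

Lemma met0l z : met 0 z = 0.
Proof. by have := metDZl (-1) 0 0 z; rewrite scaler0 addr0 mulN1r addNr. Qed.

Lemma met0r z : met z 0 = 0. Proof. by rewrite metC met0l. Qed.

Lemma metDl x y z : met (x + y) z = met x z + met y z.
Proof. by have := metDZl 1 x y z; rewrite scale1r mul1r. Qed.

Lemma metDr x y z : met z (x + y) = met z x + met z y.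
Proof. by rewrite metC metDl !(metC z). Qed.

Lemma metZl c x z : met (c *: x) z = c * met x z.
Proof. by rewrite -[c *: x]addr0 metDZl met0l addr0. Qed.

Lemma metZr c x z : met z (c *: x) = c * met z x.
Proof. by rewrite metC metZl metC. Qed.

Lemma metNl x z : met (- x) z = - met x z.
Proof. by rewrite -scaleN1r metZl mulN1r. Qed.

Lemma metNr x z : met z (- x) = - met z x.
Proof. by rewrite metC metNl metC. Qed.

Lemma met_suml (I : finType) (F : I -> g) z :
  met (\sum_i F i) z = \sum_i met (F i) z.
Proof. exact: (big_morph (met^~ z) (fun x y => metDl x y z) (met0l z)). Qed.

Lemma met_gt0 x : x != 0 -> 0 < met x x.
Proof. by have [_ _ pos] := ip; exact: pos. Qed.

Lemma met_eq0 x : met x x = 0 -> x = 0.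
Proof. by move=> m0; apply/eqP/contraT => /met_gt0; rewrite m0 ltxx. Qed.

Lemma met_inj x y : (forall z, met x z = met y z) -> x = y.
Proof.
move=> E; apply/eqP; rewrite -subr_eq0; apply/eqP/met_eq0.
by rewrite metDl metNl E subrr.
Qed.

Lemma orthogonal_free n (f : n.-tuple g) :
  (forall i j, i != j -> met (tnth f i) (tnth f j) = 0) ->
  (forall i, met (tnth f i) (tnth f i) != 0) -> free f.
Proof.
move=> orth nz; apply/freeP => k Ek i.
have: met (\sum_(j < n) k j *: f`_j) (tnth f i) = 0 by rewrite Ek met0l.
rewrite met_suml (bigD1 i) //= big1 => [|j neji].
  rewrite addr0 metZl -tnth_nth => /eqP.
  by rewrite mulf_eq0 (negbTE (nz i)) orbF => /eqP.
by rewrite metZl -tnth_nth orth ?mulr0.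
Qed.

Lemma basis_span n (f : n.-tuple g) : basis_of fullv f ->
  forall x, exists c : 'I_n -> R, x = \sum_i c i *: tnth f i.
Proof.
move=> bf x; exists (fun i => coord f i x).
rewrite {1}(coord_basis bf (memvf x)); apply: eq_bigr => i _.
by rewrite (tnth_nth 0).
Qed.

Lemma free_basis n (f : n.-tuple g) :
  \dim {:g} = n -> free f -> basis_of fullv f.
Proof. by move=> dn ff; rewrite basisEfree ff subvf size_tuple dn leqnn. Qed.

Section Orthonormal.
Variables (n : nat) (f : n.-tuple g).
Hypothesis dim_n : \dim {:g} = n.
Hypothesis onf : orthonormal_tuple met f.

Lemma orthonormal_basis : basis_of fullv f.
Proof.
apply: free_basis => //; apply: orthogonal_free => [i j /negbTE nij|i].
  by rewrite onf nij.
by rewrite onf eqxx oner_eq0.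
Qed.

Lemma orthonormal_expand x : x = \sum_i met x (tnth f i) *: tnth f i.
Proof.
have [c Ec] := basis_span orthonormal_basis x.
rewrite {1}Ec; apply: eq_bigr => i _; congr (_ *: _).
rewrite Ec met_suml (bigD1 i) //= big1 => [|j /negbTE nji].
  by rewrite metZl onf eqxx mulr1 addr0.
by rewrite metZl onf nji mulr0.
Qed.

Lemma parseval x y : met x y = \sum_i met x (tnth f i) * met y (tnth f i).
Proof.
rewrite {1}(orthonormal_expand x) met_suml; apply: eq_bigr => i _.
by rewrite metZl (metC y).
Qed.

End Orthonormal.

(** The matrix of inner products between two orthonormal bases is orthogonal, by [parseval]. *)
Lemma onb_trace n (b f : n.-tuple g) (p q : g -> R) :
    \dim {:g} = n -> orthonormal_tuple met b -> orthonormal_tuple met f ->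
    (forall c x y, p (c *: x + y) = c * p x + p y) ->
    (forall c x y, q (c *: x + y) = c * q x + q y) ->
  \sum_i p (tnth b i) * q (tnth b i) = \sum_i p (tnth f i) * q (tnth f i).
Proof.
move=> dn onb onf pl ql.
have lsum (r : g -> R) (c : 'I_n -> R) (F : 'I_n -> g) :
    (forall c x y, r (c *: x + y) = c * r x + r y) ->
    r (\sum_j c j *: F j) = \sum_j c j * r (F j).
  move=> rl; have r0 : r 0 = 0.
    by have := rl (-1) 0 0; rewrite scaler0 addr0 mulN1r addNr.
  by elim/big_rec2: _ => // j s y _ <-; rewrite rl.
have Er (r : g -> R) i : (forall c x y, r (c *: x + y) = c * r x + r y) ->
    r (tnth b i) = \sum_j met (tnth b i) (tnth f j) * r (tnth f j).
  by move=> rl; rewrite {1}(orthonormal_expand dn onf (tnth b i)) lsum.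
under eq_bigr => i _ do rewrite (Er p) // (Er q) // big_distrlr /=.
have Em j k : \sum_i (met (tnth b i) (tnth f j) * p (tnth f j)) *
      (met (tnth b i) (tnth f k) * q (tnth f k))
    = (j == k)%:R * (p (tnth f j) * q (tnth f k)).
  rewrite -onf (parseval dn onb) mulr_suml; apply: eq_bigr => i _.
  by rewrite mulrACA !(metC (tnth b i)).
rewrite exchange_big; apply: eq_bigr => j _ /=.
rewrite exchange_big (bigD1 j) //= Em eqxx mul1r big1 ?addr0 // => k nkj.
by rewrite Em eq_sym (negbTE nkj) mul0r.
Qed.

End Metric.

Lemma big_tuple_cons (A : Type) (z : A) (op : Monoid.com_law z) (T : finType) k
    (G : k.+1.-tuple T -> A) :
  \big[op/z]_I G I = \big[op/z]_i \big[op/z]_(J : k.-tuple T) G [tuple of i :: J].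
Proof.
rewrite pair_big /=.
rewrite (reindex (fun p : T * k.-tuple T => [tuple of p.1 :: p.2])) //=.
exists (fun I => (thead I, [tuple of behead I])) => [[i J] _|I _] /=.
  by congr (_, _); apply: val_inj.
by rewrite -tuple_eta.
Qed.

(** * The Hodge star and the differential *)

Section Hodge.
Variables (R : realType) (g : lieAlgebra R) (met : g -> g -> R).
Hypothesis ip : inner_product met.

(** The basis is changed one slot at a time, by [onb_trace]. This is the reason why the Hodge star
    does not depend on the orthonormal basis. *)
Lemma onb_contraction n (b f : n.-tuple g) k (a c : kform g k) :
    \dim {:g} = n -> orthonormal_tuple met b -> orthonormal_tuple met f ->
    multilinear a -> multilinear c ->
  \sum_(I : k.-tuple 'I_n) a (map_tuple (tnth b) I) * c (map_tuple (tnth b) I)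
  = \sum_(I : k.-tuple 'I_n)
      a (map_tuple (tnth f) I) * c (map_tuple (tnth f) I).
Proof.
move=> dn onb onf; elim: k a c => [|k IHk] a c mla mlc.
  by apply: eq_bigr => I _; rewrite !(tuple0 (map_tuple _ I)).
have Em (h : 'I_n -> g) i (J : k.-tuple 'I_n) :
    map_tuple h [tuple of i :: J] = [tuple of h i :: map_tuple h J].
  exact: val_inj.
rewrite !big_tuple_cons.
under eq_bigr => i _.
  under eq_bigr => J _ do rewrite !Em.
  rewrite (IHk (contract (tnth b i) a) (contract (tnth b i) c));
    [over|exact: multilinear_contract|exact: multilinear_contract].
rewrite exchange_big [RHS]exchange_big; apply: eq_bigr => J _ /=.
under [RHS]eq_bigr => i _ do rewrite !Em.
by apply: (onb_trace ip
  (p := fun x => a [tuple of x :: map_tuple (tnth f) J])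
  (q := fun x => c [tuple of x :: map_tuple (tnth f) J]) dn onb onf) => t x y;
  rewrite multilinear_slot0.
Qed.

Lemma multilinear_catl k l (w : kform g (k + l)) v :
  multilinear w -> multilinear (fun u : k.-tuple g => w (cat_tuple u v)).
Proof.
move=> ml u i c x y.
have E z : cat_tuple (tset u i z) v = tset (cat_tuple u v) (lshift l i) z.
  apply: eq_from_tnth => j; rewrite tnth_tset -(splitK j).
  case: split => j' /=; rewrite ?tnth_lshift ?tnth_rshift.
    by rewrite tnth_tset eq_lshift.
  by rewrite eq_rlshift.
by rewrite !E ml.
Qed.

Lemma multilinear_catr k l (w : kform g (k + l)) (u : k.-tuple g) :
  multilinear w -> multilinear (fun v : l.-tuple g => w (cat_tuple u v)).
Proof.
move=> ml v i c x y.
have E z : cat_tuple u (tset v i z) = tset (cat_tuple u v) (rshift k i) z.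
  apply: eq_from_tnth => j; rewrite tnth_tset -(splitK j).
  case: split => j' /=; rewrite ?tnth_lshift ?tnth_rshift.
    by rewrite eq_lrshift.
  by rewrite tnth_tset eq_rshift.
by rewrite !E ml.
Qed.

Lemma hodge_onb k l (b f : (k + l).-tuple g) vol (a : kform g k) :
    \dim {:g} = (k + l)%N -> orthonormal_tuple met b ->
    orthonormal_tuple met f -> multilinear a -> multilinear vol ->
  hodge b vol a =1 hodge f vol a.
Proof.
move=> dn onb onf mla mlv v; rewrite /hodge; congr (_ * _).
apply: (onb_contraction (c := fun u => vol (cat_tuple u v)) dn onb onf) => //.
exact: multilinear_catl.
Qed.

Lemma multilinear_hodge k l (b : (k + l).-tuple g) vol (a : kform g k) :
  multilinear vol -> multilinear (hodge b vol a).
Proof.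
move=> mlv v i c x y; rewrite /hodge mulrCA -mulrDr; congr (_ * _).
rewrite mulr_sumr -big_split; apply: eq_bigr => I _ /=.
rewrite (multilinear_catr (map_tuple (tnth b) I) mlv) mulrDr.
by congr (_ + _); rewrite mulrCA.
Qed.

Lemma lie_brDZl c (x y z : g) :
  lie_br (c *: x + y) z = c *: lie_br x z + lie_br y z.
Proof. by have [bl _] := lie_bilinear g; apply: bl. Qed.

Lemma lie_brDZr c (x y z : g) :
  lie_br z (c *: x + y) = c *: lie_br z x + lie_br z y.
Proof. by have [_ br] := lie_bilinear g; apply: br. Qed.

Lemma multilinear_ce_d k (a : kform g k.+1) :
  multilinear a -> multilinear (ce_d a).
Proof.
move=> ml v t c x y; rewrite /ce_d mulr_sumr -big_split.
apply: eq_bigr => j _; rewrite mulr_sumr -big_split.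
apply: eq_bigr => i _ /=; rewrite mulrCA -mulrDr; congr (_ * _).
pose G z := contract
  (lie_br (tnth (tset v t z) (lift j i)) (tnth (tset v t z) j)) a
  [tuple tnth (tset v t z) (lift j (lift i m)) | m < k].
change (G (c *: x + y) = c * G x + G y); rewrite /G {G}.
(* The varied slot is the second entry of the bracket, its first entry, or one of the remaining
   arguments. *)
case: (unliftP j t) => [t'|] Et; last first.
  have Er z : [tuple tnth (tset v t z) (lift j (lift i m)) | m < k]
      = [tuple tnth v (lift j (lift i m)) | m < k].
    apply: eq_from_tnth => m; rewrite !tnth_mktuple.
    by rewrite Et eq_sym (negbTE (neq_lift _ _)).
  rewrite !Er Et !tnth_tset eqxx eq_sym (negbTE (neq_lift _ _)) lie_brDZr.
  exact: multilinear_slot0.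
have nj : (j == t) = false by rewrite Et (negbTE (neq_lift _ _)).
case: (unliftP i t') => [m0|] Et'; last first.
  have Er z : [tuple tnth (tset v t z) (lift j (lift i m)) | m < k]
      = [tuple tnth v (lift j (lift i m)) | m < k].
    apply: eq_from_tnth => m; rewrite !tnth_mktuple.
    by rewrite Et Et' (inj_eq lift_inj) eq_sym (negbTE (neq_lift _ _)).
  rewrite !Er !tnth_tset nj Et Et' eqxx lie_brDZl.
  exact: multilinear_slot0.
have ni : (lift j i == t) = false.
  by rewrite Et Et' (inj_eq lift_inj) (negbTE (neq_lift _ _)).
have Er z : [tuple tnth (tset v t z) (lift j (lift i m)) | m < k]
    = tset [tuple tnth v (lift j (lift i m)) | m < k] m0 z.
  apply: eq_from_tnth => m; rewrite !tnth_mktuple.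
  by rewrite Et Et' !(inj_eq lift_inj).
rewrite !Er !tnth_tset nj ni.
by rewrite (multilinear_contract _ ml).
Qed.

End Hodge.

(** * Reflected polynomials with integer coefficients *)

(** A monomial is the list of its variables with multiplicity: [[:: 3; 3; 7]] stands for
    [x_3^2 x_7]. *)
Definition mono := seq nat.
Definition poly := seq (mono * Z).

Fixpoint mono_cmp (m m' : mono) : comparison :=
  match m, m' with
  | [::], [::] => Eq
  | [::], _ => Lt
  | _, [::] => Gt
  | i :: n, j :: n' => if Nat.compare i j is Eq then mono_cmp n n'
                       else Nat.compare i j
  end.

(** Terms are kept sorted by [mono_cmp] so that equal monomials meet and cancel; a polynomial that
    vanishes identically thus reduces to [[::]]. *)
Fixpoint padd1 (t : mono * Z) (p : poly) : poly :=
  match p with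
  | [::] => [:: t]
  | u :: q => match mono_cmp t.1 u.1 with
      | Lt => t :: p
      | Gt => u :: padd1 t q
      | Eq => let c := Z.add t.2 u.2 in
              if Z.eqb c 0 then q else (u.1, c) :: q
      end
  end.

Definition padd (p q : poly) : poly := foldr padd1 q p.

Definition pscale (c : Z) (p : poly) : poly :=
  if Z.eqb c 0 then [::] else [seq (t.1, Z.mul c t.2) | t <- p].

Definition pmul (p q : poly) : poly :=
  foldr (fun t r => foldr (fun u => padd1 (merge leq t.1 u.1, Z.mul t.2 u.2)) r q)
    [::] p.

Definition psum (s : seq poly) : poly := foldr padd [::] s.

(** Division by the content, to keep the printed equations small. *)
Definition pprim (p : poly) : poly :=
  let d := foldr (fun t => Z.gcd t.2) 0%BZ p in
  if Z.eqb d 0 then p else [seq (t.1, Z.div t.2 d) | t <- p].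

Definition pX (i : nat) : poly := [:: ([:: i], 1%BZ)].
Definition pC (z : Z) : poly := if Z.eqb z 0 then [::] else [:: ([::], z)].

Section Eval.
Variables (R : realType) (env : nat -> R).

Definition zr (z : Z) : R := (int_of_Z z)%:~R.

Definition mev (m : mono) : R := foldr (fun i => *%R (env i)) 1 m.
Definition ev (p : poly) : R := foldr (fun t => +%R (zr t.2 * mev t.1)) 0 p.

Lemma zrD x y : zr (Z.add x y) = zr x + zr y.
Proof. by rewrite /zr -rmorphD -(rmorphD int_of_Z). Qed.

Lemma zrM x y : zr (Z.mul x y) = zr x * zr y.
Proof. by rewrite /zr -rmorphM -(rmorphM int_of_Z). Qed.

Lemma zrN x : zr (Z.opp x) = - zr x.
Proof. by rewrite /zr -rmorphN -(rmorphN int_of_Z). Qed.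

Lemma zr0 : zr 0 = 0. Proof. by []. Qed.

Lemma zr1 : zr 1 = 1. Proof. by []. Qed.

Lemma zr_eq0 z : zr z = 0 -> z = 0%BZ.
Proof.
move=> /eqP; rewrite intr_eq0 => /eqP E.
by rewrite -[z]int_of_ZK E.
Qed.

Lemma mono_cmpP m m' : mono_cmp m m' = Eq -> m = m'.
Proof.
elim: m m' => [|i m IHm] [|j m'] //=.
case E: (Nat.compare i j) => // /IHm ->.
by rewrite (proj1 (PeanoNat.Nat.compare_eq_iff i j) E).
Qed.

Lemma ev_padd1 t p : ev (padd1 t p) = zr t.2 * mev t.1 + ev p.
Proof.
elim: p => [|u q IHq] //=.
case E: (mono_cmp t.1 u.1) => //=; last by rewrite IHq addrCA.
rewrite (mono_cmpP E) addrA -mulrDl -zrD.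
by case: Z.eqb_spec => [->|_] //=; rewrite zr0 mul0r add0r.
Qed.

Lemma ev_padd p q : ev (padd p q) = ev p + ev q.
Proof. by elim: p => [|t p IHp] /=; rewrite ?add0r // ev_padd1 IHp addrA. Qed.

Lemma ev_pscale c p : ev (pscale c p) = zr c * ev p.
Proof.
rewrite /pscale; case: Z.eqb_spec => [->|_] /=; first by rewrite zr0 mul0r.
by elim: p => [|t p IHp] /=; rewrite ?mulr0 // IHp mulrDr zrM mulrA.
Qed.

Lemma mevE m : mev m = \prod_(i <- m) env i.
Proof. by elim: m => [|i m IHm] /=; rewrite ?big_nil // big_cons IHm. Qed.

Lemma mev_merge m m' : mev (merge leq m m') = mev m * mev m'.
Proof.
rewrite !mevE -big_cat; apply: perm_big.
by rewrite perm_merge.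
Qed.

Lemma ev_pmul p q : ev (pmul p q) = ev p * ev q.
Proof.
elim: p => [|t p IHp] /=; first by rewrite mul0r.
rewrite mulrDl -IHp -/(pmul p q); move: (pmul p q) => r.
elim: q {IHp} => [|u q IHq] /=; first by rewrite mulr0 add0r.
by rewrite ev_padd1 /= IHq mulrDr addrA mev_merge zrM mulrACA.
Qed.

Lemma ev_psum s : ev (psum s) = \sum_(p <- s) ev p.
Proof.
by elim: s => [|p s IHs] /=; rewrite ?big_nil // big_cons ev_padd IHs.
Qed.

Lemma ev_pX i : ev (pX i) = env i.
Proof. by rewrite /ev /= mul1r mulr1 addr0. Qed.

Lemma ev_pC z : ev (pC z) = zr z.
Proof.
rewrite /pC; case: Z.eqb_spec => [->//|_] /=.
by rewrite mulr1 addr0.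
Qed.

Lemma ev_pprim p : ev p = 0 -> ev (pprim p) = 0.
Proof.
rewrite /pprim; set d := foldr _ _ _; case: Z.eqb_spec => // nzd.
(* When [Z.div] is exact on all coefficients, [ev] is the nonzero [d] times the value of the
   quotient; exactness follows because [d] is their gcd. *)
have E q : all (fun t : mono * Z => Z.eqb (Z.mul d (Z.div t.2 d)) t.2) q ->
    ev q = zr d * ev [seq (t.1, Z.div t.2 d) | t <- q].
  elim: q => [|t q IHq] /=; first by rewrite mulr0.
  case/andP=> /Z.eqb_spec Et /IHq ->.
  by rewrite mulrDr mulrA -zrM Et.
rewrite E => [/eqP|]; first by rewrite mulf_eq0 => /orP[/eqP/zr_eq0|/eqP].
have dvd: all (fun t : mono * Z => Z.eqb (Z.modulo t.2 d) 0) p.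
  have: Z.divide d d by exists 1%BZ; rewrite Z.mul_1_l.
  rewrite {2}/d; elim: (p) => [|t q IHq] //= dd; apply/andP; split.
    apply/Z.eqb_spec/Z.mod_divide => //.
    exact: (Z.divide_trans _ _ _ dd (Z.gcd_divide_l _ _)).
  exact: IHq (Z.divide_trans _ _ _ dd (Z.gcd_divide_r _ _)).
apply: sub_all dvd => t /Z.eqb_spec E0; apply/Z.eqb_spec.
by rewrite [RHS](Z.div_mod t.2 d nzd) E0 Z.add_0_r.
Qed.

End Eval.

(** * Computable sums over indices *)

Section IndexSums.

Fixpoint tuples (n k : nat) : seq (seq nat) :=
  if k is k'.+1 then [seq i :: l | i <- iota 0 n, l <- tuples n k']
  else [:: [::]].

(** Lists without repetition that avoid [s]: only on these can a term carrying a Levi-Civita symbol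
    be nonzero. They replace the [n ^ k] tuples in the heavy computations. *)
Fixpoint arrangements (n k : nat) (s : seq nat) : seq (seq nat) :=
  if k is k'.+1 then
    flatten [seq [seq i :: l | l <- arrangements n k' (i :: s)]
            | i <- iota 0 n & i \notin s]
  else [:: [::]].

Lemma big_iota_ord (A : Type) (z : A) (op : Monoid.com_law z) n (F : nat -> A) :
  \big[op/z]_(i <- iota 0 n) F i = \big[op/z]_(i < n) F i.
Proof. by rewrite -[in LHS](subn0 n); apply: big_mkord. Qed.

Lemma big_tuples (A : Type) (z : A) (op : Monoid.com_law z) n k
    (F : seq nat -> A) :
  \big[op/z]_(l <- tuples n k) F l
  = \big[op/z]_(I : k.-tuple 'I_n) F (map val I).
Proof.
elim: k F => [|k IHk] F.
  rewrite big_seq1 (big_pred1 [tuple]) // => I.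
  by apply/esym/eqP; rewrite [I]tuple0.
rewrite big_tuple_cons /= big_allpairs_dep /= big_iota_ord.
by apply: eq_bigr => i _; rewrite (IHk (fun l => F (val i :: l))).
Qed.

Lemma size_tuples n k l : l \in tuples n k -> size l = k.
Proof.
elim: k l => [|k IHk] l; first by rewrite inE => /eqP ->.
by case/allpairsPdep => i [m [_ /IHk sm ->]] /=; rewrite sm.
Qed.

Lemma big_arrangements (R : nmodType) n k s (F : seq nat -> R) :
  (forall l, size l = k -> ~~ (uniq l && all (fun i => i \notin s) l) ->
     F l = 0) ->
  \sum_(l <- tuples n k) F l = \sum_(l <- arrangements n k s) F l.
Proof.
elim: k s F => [|k IHk] s F F0; first by rewrite !big_seq1.
rewrite /= big_allpairs_dep big_flatten big_map big_filter.
rewrite [RHS]big_mkcond; apply: eq_bigr => i _; rewrite big_map.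
case: ifPn => is_s; last first.
  rewrite big_seq big1 // => l lk; apply: F0.
    by rewrite /= (size_tuples lk).
  by rewrite /= (negbTE is_s) andbF.
rewrite (IHk (i :: s)) // => l szl ul; apply: F0; first by rewrite /= szl.
apply: contra ul => /= /andP[/andP[il ->]] /andP[_ /allP sl] /=.
apply/allP => j jl; rewrite inE negb_or sl // andbT.
by apply: contraNneq il => <-.
Qed.

End IndexSums.

Section LeviCode.

(* First-row expansion of the determinant which defines the symbol. *)
Fixpoint leviZ (n : nat) (l : seq nat) : Z :=
  match n, l with
  | n'.+1, i :: l' =>
      if i \in l' then 0%BZ
      else let r := leviZ n' (map (unbump i) l') in
           if odd i then Z.opp r else r
  | _, _ => 1%BZ
  end.

Lemma leviZ_eq0 n l : size l = n -> ~~ uniq l -> leviZ n l = 0%BZ.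
Proof.
elim: n l => [|n IHn] [|i l] //= [sl]; rewrite negb_and negbK.
case: ifP => //= il nu; rewrite IHn ?size_map //; first by case: ifP.
rewrite map_inj_in_uniq // => j m jl ml; apply: (can_in_inj (@unbumpK i));
  by rewrite inE; apply: contraFneq il => <-.
Qed.

Variable R : realType.

Lemma levi_code n (I : n.-tuple 'I_n) : levi R I = zr R (leviZ n (map val I)).
Proof.
elim: n I => [|n IHn] I; first by rewrite /levi det_mx00.
case/tupleP: I => i I /=.
case: ifPn => [/mapP[_ /tnthP[j ->] /val_inj Ei]|].
  apply: (@levi_eq0 _ _ _ ord0 (lift ord0 j)); first exact: neq_lift.
  by rewrite tnth0 tnthS.
move=> nI; have neq j : tnth I j != i.
  apply: contra nI => /eqP <-; exact/map_f/mem_tnth.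
rewrite /levi (expand_det_row _ ord0) (bigD1 i) //= big1 => [|j nji]; last first.
  by rewrite mxE tnth0 eq_sym (negbTE nji) mul0r.
rewrite mxE tnth0 eqxx mul1r addr0 /cofactor /= add0n.
(* The remaining indices avoid [i], so deleting column [i] relabels them by [unbump i]. *)
have [J EJ] : exists J : n.-tuple 'I_n, forall j, tnth I j = lift i (tnth J j).
  have /fin_all_exists[h Eh] j : exists h, tnth I j = lift i h.
    by case: (unliftP i (tnth I j)) (neq j) => [h ->|->]; [exists h|rewrite eqxx].
  by exists [tuple h j | j < n] => j; rewrite tnth_mktuple.
have -> : map (unbump i) (map val I) = map val J.
  rewrite -[map _ _]/(val (map_tuple (unbump i) (map_tuple val I))).
  rewrite -[RHS]/(val (map_tuple val J)); congr val; apply: eq_from_tnth => j.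
  by rewrite !tnth_map EJ /= bumpK.
have -> : \det (row' ord0 (col' i (\matrix_(a, b)
      (tnth [tuple of i :: I] a == b)%:R))) = levi R J.
  rewrite /levi; congr (\det _); apply/matrixP=> a b.
  by rewrite !mxE tnthS EJ (inj_eq lift_inj).
rewrite IHn -signr_odd; case: (odd i) => /=; last by rewrite mul1r.
by rewrite mulN1r zrN.
Qed.

End LeviCode.

(** * Structure tensors of the standard G2-form *)

Definition zsum (s : seq Z) : Z := foldr Z.add 0%BZ s.

(** Indices start at 0 here: [[:: 0; 1; 6]] is [e^{127}]. *)
Definition phi_terms : seq (seq nat * Z) :=
  [:: ([:: 0; 1; 6], 1%BZ); ([:: 2; 3; 6], 1%BZ); ([:: 4; 5; 6], 1%BZ);
      ([:: 0; 2; 4], 1%BZ); ([:: 0; 3; 5], (-1)%BZ); ([:: 1; 2; 5], (-1)%BZ);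
      ([:: 1; 3; 4], (-1)%BZ)]%N.

(* [alt_coef t l] is the value on (e_{l_1}, ..., e_{l_k}) of                  *)
(* e^{t_1} /\ ... /\ e^{t_k}, for pairwise distinct t_1, ..., t_k.            *)
Definition alt_coef (t l : seq nat) : Z :=
  if all (mem t) l then leviZ (size t) [seq index x t | x <- l] else 0%BZ.

Definition phi_table : seq (seq (seq Z)) := Eval vm_compute in
  [seq [seq [seq zsum [seq Z.mul t.2 (alt_coef t.1 [:: i; j; k]) | t <- phi_terms]
            | k <- iota 0 7] | j <- iota 0 7] | i <- iota 0 7].

Definition phiZ (l : seq nat) : Z :=
  if l is [:: i; j; k] then
    nth 0%BZ (nth [::] (nth [::] phi_table i) j) k else 0%BZ.

(** The Hodge dual, [psi(l) = 1/6 sum_J phi(J) eps(J, l)]; that the integer division by 6 is exact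
    is part of [hodge_phi_check]. *)
Definition psi_table : seq (seq (seq (seq Z))) := Eval vm_compute in
  [seq [seq [seq [seq
      Z.div (zsum [seq Z.mul (phiZ J) (leviZ 7 (J ++ [:: i; j; k; l]))
                  | J <- arrangements 7 3 [:: i; j; k; l]]) 6
    | l <- iota 0 7] | k <- iota 0 7] | j <- iota 0 7] | i <- iota 0 7].

Definition psiZ (l : seq nat) : Z :=
  if l is [:: i; j; k; m] then
    nth 0%BZ (nth [::] (nth [::] (nth [::] psi_table i) j) k) m else 0%BZ.

Arguments phiZ : simpl never.
Arguments psiZ : simpl never.

Definition psi_support : seq (seq nat) := Eval vm_compute in
  [seq l <- tuples 7 4 | ~~ Z.eqb (psiZ l) 0].

Lemma psi_supportE : psi_support = [seq l <- tuples 7 4 | ~~ Z.eqb (psiZ l) 0].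
Proof. by vm_compute. Qed.

Lemma hodge_phi_check : all (fun l => Z.eqb
  (zsum [seq Z.mul (phiZ J) (leviZ 7 (J ++ l)) | J <- arrangements 7 3 l])
  (Z.mul 6 (psiZ l))) (tuples 7 4).
Proof. by vm_compute. Qed.

(** Moving three indices past four is an even permutation, so the dual is the same with the blocks
    exchanged; this order is the one met in a wedge with [phi] on the right. *)
Lemma hodge_phi_check' : all (fun l => Z.eqb
  (zsum [seq Z.mul (phiZ J) (leviZ 7 (l ++ J)) | J <- arrangements 7 3 l])
  (Z.mul 6 (psiZ l))) (tuples 7 4).
Proof. by vm_compute. Qed.

(** The factor [1 / (k! l!)] of [wedge] is left out so that the values are integers. *)
Definition wedgeZ k l (z z' : seq nat -> Z) (L : seq nat) : Z :=
  zsum [seq Z.mul (Z.mul (z [seq nth 0%N L i | i <- take k J])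
                         (z' [seq nth 0%N L i | i <- drop k J])) (leviZ (k + l) J)
       | J <- arrangements (k + l) (k + l) [::]].

Definition orders4 : seq (seq nat) := Eval vm_compute in arrangements 4 4 [::].

(* The metric identity: with a = e_p _| phi and b = e_q _| phi, the           *)
(* contraction of psi with a /\ b is a multiple of g(e_p, e_q).               *)
Lemma metric_check : all (fun p => all (fun q => Z.eqb
  (zsum [seq Z.mul (psiZ l)
      (wedgeZ 2 2 (fun J => phiZ (p :: J)) (fun J => phiZ (q :: J)) l)
    | l <- psi_support])
  (if p == q then 576 else 0)%BZ) (iota 0 7)) (iota 0 7).
Proof.
rewrite /wedgeZ (_ : arrangements (2 + 2) (2 + 2) [::] = orders4); last by [].
by vm_compute.
Qed.

(* Wedging with psi is, up to a sign, contracting with phi.                   *)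
Lemma wedge_psi_check : all (fun m => all (fun l => Z.eqb
  (zsum [seq Z.mul (psiZ [seq bump m i | i <- J]) (leviZ 6 (l ++ J))
        | J <- arrangements 6 4 l])
  (Z.mul (if odd m then -24 else 24) (phiZ (m :: [seq bump m i | i <- l]))))
  (tuples 6 2)) (iota 0 7).
Proof. by vm_compute. Qed.

Lemma phi_antisym_check : all (fun l =>
  if l is [:: i; j; k] then Z.eqb (phiZ [:: i; j; k]) (Z.opp (phiZ [:: i; k; j]))
  else true) (tuples 7 3).
Proof. by vm_compute. Qed.

Lemma phi_antisym12_check : all (fun l =>
  if l is [:: i; j; k] then Z.eqb (phiZ [:: i; j; k]) (Z.opp (phiZ [:: j; i; k]))
  else true) (tuples 7 3).
Proof. by vm_compute. Qed.

(* x (y z) + y (x z) = - 2 <x, y> z + <x, z> y + <y, z> x *)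
Lemma cross_check : all (fun l =>
  if l is [:: i; j; k; m] then Z.eqb
    (Z.add (zsum [seq Z.mul (phiZ [:: j; k; n]) (phiZ [:: i; n; m]) | n <- iota 0 7])
           (zsum [seq Z.mul (phiZ [:: i; k; n]) (phiZ [:: j; n; m]) | n <- iota 0 7]))
    (Z.add (if (i == j) && (k == m) then -2 else 0)
      (Z.add (if (i == k) && (j == m) then 1 else 0)
             (if (j == k) && (i == m) then 1 else 0)))
  else true) (tuples 7 4).
Proof. by vm_compute. Qed.

(** * Reflected curvature of the characteristic connection *)

(** The table is built before the index list is supplied, so under [vm_compute] each of the [7 ^ k]
    values is computed once. *)
Fixpoint memo (A : Type) (d : A) (k : nat) (p : seq nat -> A) : seq nat -> A :=
  if k is k'.+1 then
    let t := [seq memo d k' (fun l => p (i :: l)) | i <- iota 0 7] in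
    fun l => if l is i :: l' then nth (fun=> d) t i l' else d
  else let r := p [::] in fun=> r.

Lemma memoE (A : Type) (d : A) k p (J : k.-tuple 'I_7) :
  memo d k p (map val J) = p (map val J).
Proof.
elim: k p J => [|k IHk] p J; first by rewrite (tuple0 J).
case/tupleP: J => i J /=.
by case: i => [] [|[|[|[|[|[|[|m]]]]]]] //= ?; rewrite IHk.
Qed.

Section ConnectionCode.
Variable c : nat -> nat -> nat -> poly.

Definition bracketP : seq nat -> seq (nat * poly) :=
  memo [::] 2 (fun l => if l is [:: i; j] then
    [seq t <- [seq (m, c i j m) | m <- iota 0 7] | ~~ nilp t.2] else [::]).

Definition ce_dP (br : seq nat -> seq (nat * poly)) k (z : seq nat -> Z)
    (l : seq nat) : poly :=
  psum [seq psum [seq psum [seq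
      let w := z (t.1 :: [seq nth 0%N l (bump j (bump i n)) | n <- iota 0 k]) in
      pscale (if odd (i + j) then Z.opp w else w) t.2
    | t <- br [:: nth 0%N l i; nth 0%N l j]] | i <- iota 0 j] | j <- iota 0 k.+2].

(** By [wedge_phi], 24 times the value of the seven-form [d phi /\ phi] on the frame. *)
Definition sum_dphi_psiP (dphi : seq nat -> poly) : poly :=
  psum [seq pscale (psiZ J) (dphi J) | J <- psi_support].

(* 144 times the torsion. *)
Definition torsionP (S : poly) (dphi : seq nat -> poly) (l : seq nat) : poly :=
  padd (pscale (phiZ l) S)
    (pscale (-6) (psum [seq pscale (leviZ 7 (J ++ l)) (dphi J)
                       | J <- arrangements 7 4 l])).

(* 288 times the characteristic connection (Koszul formula). *)
Definition connP (T : seq nat -> poly) (l : seq nat) : poly :=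
  if l is [:: x; y; z] then
    padd (pscale 144 (padd (c x y z) (padd (pscale (-1) (c y z x)) (c z x y))))
         (T l)
  else [::].

Definition conn_tableP : seq nat -> poly :=
  let dphi := memo [::] 4 (ce_dP bracketP 2 phiZ) in
  let S := sum_dphi_psiP dphi in
  memo [::] 3 (connP (torsionP S dphi)).

(** [A] holds 288 times the connection, so the result is [288 ^ 2] times the curvature; the bracket
    term is linear in [A] and takes the missing factor 288. *)
Definition curvP (A : seq nat -> poly) (x y u v : nat) : poly :=
  psum [seq padd (padd (pmul (A [:: y; u; k]) (A [:: x; k; v]))
                       (pscale (-1) (pmul (A [:: x; u; k]) (A [:: y; k; v]))))
                 (pscale (-288) (pmul (c x y k) (A [:: k; u; v])))
       | k <- iota 0 7].

(** The curvature contracted with [e_m _| phi]. By [wedge_psi_check] this is, up to a nonzero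
    factor, the value of [R /\ psi] on the six frame vectors other than [e_m], which [bump m]
    enumerates. *)
Definition instP (A : seq nat -> poly) (m u v : nat) : poly :=
  psum [seq psum [seq
      let w := phiZ [:: m; bump m i; bump m j] in
      if Z.eqb w 0 then [::] else pscale w (curvP A (bump m i) (bump m j) u v)
    | i <- iota 0 j] | j <- iota 0 6].

End ConnectionCode.

(** * G2-frames *)

Lemma zr_sum (R : realType) (s : seq Z) : zr R (zsum s) = \sum_(z <- s) zr R z.
Proof. by elim: s => [|z s IHs]; rewrite ?big_nil // big_cons /= zrD IHs. Qed.

Lemma all_tuples n k (P : pred (seq nat)) :
  all P (tuples n k) -> forall J : k.-tuple 'I_n, P (map val J).
Proof.
move=> /allP Pt J; apply: Pt; elim: k J => [|k IHk] J.
  by rewrite (tuple0 J).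
case/tupleP: J => i J /=; apply/allpairsPdep; exists (val i), (map val J).
by rewrite mem_iota ltn_ord; split; rewrite ?IHk.
Qed.

(** * Components of forms in a frame *)

Section Representation.
Variables (R : realType) (g : lieAlgebra R) (n : nat) (f : n.-tuple g).

Definition repZ k (a : kform g k) (z : seq nat -> Z) : Prop :=
  forall J : k.-tuple 'I_n, a (map_tuple (tnth f) J) = zr R (z (map val J)).

Lemma map_tuple_map k l (J : k.-tuple 'I_n) (K : l.-tuple 'I_k) :
  map_tuple (tnth (map_tuple (tnth f) J)) K
  = map_tuple (tnth f) (map_tuple (tnth J) K).
Proof. by apply: eq_from_tnth => i; rewrite !tnth_map. Qed.

Lemma map_val_tnth k l (J : k.-tuple 'I_n) (K : l.-tuple 'I_k) :
  map val (map_tuple (tnth J) K) = [seq nth 0%N (map val J) i | i <- map val K].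
Proof.
rewrite /= -!map_comp; apply: eq_map => i /=.
by rewrite (nth_map (tnth J i)) ?size_tuple // -tnth_nth.
Qed.

Lemma repZ_wedge k l (a : kform g k) (b : kform g l) z z' L :
  repZ a z -> repZ b z' ->
  wedge a b (map_tuple (tnth f) L)
  = (k`! * l`!)%:R^-1 * zr R (wedgeZ k l z z' (map val L)).
Proof.
move=> ra rb; rewrite wedge_levi; congr (_ * _).
rewrite /wedgeZ zr_sum big_map -big_arrangements => [|J sJ]; last first.
  rewrite (introT allP) // andbT => nJ.
  by rewrite leviZ_eq0 // Z.mul_0_r.
rewrite big_tuples big_cat_tuple; apply: eq_bigr => J _; apply: eq_bigr => K _.
rewrite !map_tuple_map ra rb levi_code !map_val_tnth !zrM mulrC /=.
by rewrite map_cat take_size_cat ?drop_size_cat // size_map size_tuple.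
Qed.

End Representation.

Lemma alternatingD (R : realType) (g : lieAlgebra R) k (a b : kform g k) :
  alternating a -> alternating b -> alternating (fun v => a v + b v).
Proof. by move=> aa ab v i j ne E; rewrite (aa _ _ _ ne E) (ab _ _ _ ne E) addr0. Qed.

Lemma alternatingB (R : realType) (g : lieAlgebra R) k (a b : kform g k) :
  alternating a -> alternating b -> alternating (fun v => a v - b v).
Proof. by move=> aa ab v i j ne E; rewrite (aa _ _ _ ne E) (ab _ _ _ ne E) subr0. Qed.

Lemma multilinearD (R : realType) (g : lieAlgebra R) k (a b : kform g k) :
  multilinear a -> multilinear b -> multilinear (fun v => a v + b v).
Proof. by move=> ma mb v i c x y; rewrite ma mb mulrDr addrACA. Qed.

Lemma multilinearB (R : realType) (g : lieAlgebra R) k (a b : kform g k) :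
  multilinear a -> multilinear b -> multilinear (fun v => a v - b v).
Proof. by move=> ma mb v i c x y; rewrite ma mb mulrBr opprD addrACA. Qed.

Definition standard_phiZ (l : seq nat) : Z :=
  let E3 i j k := wedgeZ 2 1
    (wedgeZ 1 1 (fun l => if l == [:: i] then 1%BZ else 0%BZ)
                (fun l => if l == [:: j] then 1%BZ else 0%BZ))
    (fun l => if l == [:: k] then 1%BZ else 0%BZ) l in
  zsum [:: E3 0 1 6; E3 2 3 6; E3 4 5 6; E3 0 2 4; Z.opp (E3 0 3 5);
           Z.opp (E3 1 2 5); Z.opp (E3 1 3 4)]%N.

Lemma standard_phi_check :
  all (fun l => Z.eqb (standard_phiZ l) (Z.mul 2 (phiZ l))) (tuples 7 3).
Proof. by vm_compute. Qed.

Section StandardForm.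
Variables (R : realType) (g : lieAlgebra R).

Lemma multilinear_covector (h : 'Hom(g, R^o)) : multilinear (covector h).
Proof.
move=> v i c x y; rewrite /covector /thead !tnth_tset (ord1 i) /=.
by rewrite linearP.
Qed.

Lemma standard_G2_multilinear (e : 7.-tuple 'Hom(g, R^o)) :
  multilinear (standard_G2 e).
Proof.
have m3 i j k : multilinear
    (wedge (wedge (covector (tnth e i)) (covector (tnth e j))) (covector (tnth e k))).
  by apply: multilinear_wedge; first apply: multilinear_wedge;
    apply: multilinear_covector.
do ?apply: multilinearB; do ?apply: multilinearD; exact: m3.
Qed.

Lemma standard_G2_alternating (e : 7.-tuple 'Hom(g, R^o)) :
  alternating (standard_G2 e).
Proof.
have a3 i j k : alternating
    (wedge (wedge (covector (tnth e i)) (covector (tnth e j))) (covector (tnth e k))).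
  exact: wedge_alternating.
do ?apply: alternatingB; do ?apply: alternatingD; exact: a3.
Qed.

Lemma standard_G2_rep (e : 7.-tuple 'Hom(g, R^o)) (f : 7.-tuple g) :
  (forall i j, tnth e i (tnth f j) = (i == j)%:R) -> repZ f (standard_G2 e) phiZ.
Proof.
(* The 2 is the [2! 1!] of the outer wedge product, which [wedgeZ] omits. *)
move=> dual L; apply: (@mulfI _ 2%:R); first by rewrite pnatr_eq0.
have /Z.eqb_spec E := all_tuples standard_phi_check L.
rewrite -[X in _ = X * _]/(zr R 2) -zrM -E {E}.
have r1 i : (i < 7)%N -> repZ f (covector (tnth e (inord i)))
    (fun l => if l == [:: i] then 1%BZ else 0%BZ).
  move=> lti J; rewrite /covector /thead tnth_map dual.
  case/tupleP: J => j J; rewrite (tuple0 J) /= eqseq_cons andbT tnth0.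
  by rewrite -val_eqE /= inordK // eq_sym; case: eqP.
have r2 i j : (i < 7)%N -> (j < 7)%N ->
    repZ f (wedge (covector (tnth e (inord i))) (covector (tnth e (inord j))))
      (wedgeZ 1 1 (fun l => if l == [:: i] then 1%BZ else 0%BZ)
                  (fun l => if l == [:: j] then 1%BZ else 0%BZ)).
  by move=> ? ? J; rewrite (repZ_wedge _ (r1 i _) (r1 j _)) // invr1 mul1r.
have r3 i j k : (i < 7)%N -> (j < 7)%N -> (k < 7)%N ->
    2%:R * wedge (wedge (covector (tnth e (inord i))) (covector (tnth e (inord j))))
      (covector (tnth e (inord k))) (map_tuple (tnth f) L) =
    zr R (wedgeZ 2 1 (wedgeZ 1 1 (fun l => if l == [:: i] then 1%BZ else 0%BZ)
                  (fun l => if l == [:: j] then 1%BZ else 0%BZ))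
                  (fun l => if l == [:: k] then 1%BZ else 0%BZ) (map val L)).
  move=> ? ? ?; rewrite (repZ_wedge _ (r2 i j _ _) (r1 k _)) // mulVKf //.
  by rewrite pnatr_eq0.
rewrite /standard_phiZ /standard_G2 zr_sum !big_cons big_nil addr0 !zrN.
by rewrite !mulrBr !mulrDr !r3 // !addrA.
Qed.

(** A vector killed by all [e_i] is killed by every functional, hence by its own coordinates. So
    evaluation on the coframe is injective, and bijective by dimension. *)
Lemma dual_frame (e : 7.-tuple 'Hom(g, R^o)) :
  \dim {:g} = 7%N -> basis_of fullv e ->
  exists f : 7.-tuple g, forall i j, tnth e i (tnth f j) = (i == j)%:R.
Proof.
move=> dim7 be.
pose L (x : g) : 'rV[R]_7 := \row_i tnth e i x.
have Llin : linear L by move=> c x y; apply/rowP=> i; rewrite !mxE linearP.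
pose LL := GRing.isLinear.Build _ _ _ _ L Llin.
pose Lf : {linear g -> 'rV[R]_7} := HB.pack L LL.
have ker0 : lker (linfun Lf) == 0%VS.
  apply/eqP/vspaceP => x; rewrite memv0 memv_ker lfunE /=.
  apply/eqP/eqP => [L0|->]; last by apply/rowP=> i; rewrite !mxE linear0.
  have h0 (h : 'Hom(g, R^o)) : h x = 0.
    rewrite (coord_basis be (memvf h)) sum_lfunE big1 // => i _.
    rewrite scale_lfunE -tnth_nth.
    by have /rowP/(_ i) := L0; rewrite !mxE => ->; rewrite scaler0.
  rewrite (coord_vbasis (memvf x)) big1 // => i _.
  have := h0 (linfun (coord (vbasis {:g}) i : g -> R^o)).
  by rewrite lfunE /= => ->; rewrite scale0r.
have full : limg (linfun Lf) = fullv.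
  apply/eqP; rewrite eqEdim subvf /= limg_dim_eq ?dim7 ?dimvf ?dim_matrix //.
  by rewrite (eqP ker0) capv0.
exists [tuple (linfun Lf)^-1%VF (delta_mx 0 j) | j < 7] => i j.
rewrite tnth_mktuple.
have: linfun Lf ((linfun Lf)^-1%VF (delta_mx 0 j)) = delta_mx 0 j.
  by rewrite limg_lfunVK // full memvf.
by rewrite lfunE /= => /rowP/(_ i); rewrite !mxE eqxx /= => ->.
Qed.

End StandardForm.

Section Frame.
Variables (R : realType) (g : lieAlgebra R) (phi : kform g 3).
Hypotheses (dim7 : \dim {:g} = 7%N) (mphi : multilinear phi).

Lemma multilinear_scale k (a : kform g k) c v : multilinear a ->
  a [tuple c *: tnth v i | i < k] = c ^+ k * a v.
Proof.
move=> ml.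
suff H m : (m <= k)%N ->
    a [tuple if (i < m)%N then c *: tnth v i else tnth v i | i < k] = c ^+ m * a v.
  rewrite -(H k (leqnn k)); congr a; apply: eq_from_tnth => i.
  by rewrite !tnth_mktuple ltn_ord.
elim: m => [|m IHm] lemk.
  by rewrite mul1r; congr a; apply: eq_from_tnth => i; rewrite tnth_mktuple ltn0.
rewrite exprS -mulrA -(IHm (ltnW lemk)); pose i0 := Ordinal lemk.
set w := [tuple _ | i < k].
have -> : w = tset [tuple if (i < m)%N then c *: tnth v i else tnth v i | i < k]
                   i0 (c *: tnth v i0).
  apply: eq_from_tnth => i; rewrite tnth_tset !tnth_mktuple ltnS leq_eqVlt.
  rewrite -val_eqE /=; case: eqP => [E|//] /=.
  by rewrite (_ : i = i0) //; apply: val_inj.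
rewrite multilinearZ //; congr (_ * a _); apply: eq_from_tnth => i.
rewrite tnth_tset !tnth_mktuple -val_eqE /=; case: eqP => [E|//].
by rewrite E ltnn (_ : i = i0) //; apply: val_inj.
Qed.

Section G2Table.
Variable f : 7.-tuple g.
Hypothesis rphi : repZ f phi phiZ.

Lemma repZ_contract p :
  repZ f (contract (tnth f p) phi) (fun l => phiZ (val p :: l)).
Proof.
move=> J; rewrite /contract -[RHS](rphi [tuple of p :: J]); congr phi.
exact: val_inj.
Qed.

(** Summing over the arguments of [phi] first turns the Levi-Civita symbol into [6 psi]; of the
    normalisation [1 / (4! 3!)] there remains [1 / 24]. *)
Lemma wedge_phi (a : kform g 4) :
  wedge a phi f = 24%:R^-1 *
    \sum_(J : 4.-tuple 'I_7) a (map_tuple (tnth f) J) * zr R (psiZ (map val J)).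
Proof.
have n6 : (6%:R : R) != 0 by rewrite pnatr_eq0.
rewrite wedge_levi natrM invfM -mulrA; congr (_ * _).
rewrite -[RHS](mulKf n6); congr (_ * _); rewrite mulr_sumr.
apply: eq_bigr => J _; rewrite mulrCA -[6%:R]/(zr R 6) -zrM.
have /Z.eqb_spec <- := all_tuples hodge_phi_check' J.
rewrite zr_sum big_map -big_arrangements => [|l sl nl].
  rewrite big_tuples mulr_sumr; apply: eq_bigr => K _.
  rewrite rphi levi_code zrM mulrCA [X in _ = _ * X]mulrC.
  by rewrite map_cat.
rewrite leviZ_eq0 ?Z.mul_0_r // ?size_cat ?size_map ?size_tuple ?sl //.
apply: contra nl; rewrite cat_uniq => /and3P[_ /hasPn h ->] /=.
by apply/allP=> i /h.
Qed.

Lemma wedge_contract_phi p q :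
  wedge (wedge (contract (tnth f p) phi) (contract (tnth f q) phi)) phi f
  = 6%:R * (p == q)%:R.
Proof.
rewrite wedge_phi.
have /allP/(_ (val p)) := metric_check; rewrite mem_iota ltn_ord => /(_ isT).
move=> /allP/(_ (val q)); rewrite mem_iota ltn_ord => /(_ isT)/Z.eqb_spec.
move/(congr1 (zr R)); rewrite zr_sum big_map psi_supportE big_filter => E.
transitivity (24%:R^-1 * (4%:R^-1 * zr R (if val p == val q then 576 else 0)%BZ)).
  congr (_ * _); rewrite -E mulr_sumr [RHS]big_mkcond big_tuples.
  apply: eq_bigr => J _.
  rewrite (repZ_wedge _ (repZ_contract p) (repZ_contract q)).
  set w := wedgeZ _ _ _ _ _.
  case: Z.eqb_spec => [->|_]; first by rewrite zr0 mulr0.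
  by rewrite zrM -mulrA (mulrC (zr R w)).
rewrite -val_eqE; case: eqP => _; last by rewrite zr0 !mulr0.
(* 4 is the [2! 2!] of the inner wedge, 24 comes from [wedge_phi], and 6 is the constant in the
   definition of the metric. *)
rewrite mulr1 (_ : zr R 576 = 4%:R * (24%:R * 6%:R)).
  by rewrite !mulKf // pnatr_eq0.
by rewrite -(natrM _ 24 6) -(natrM _ 4).
Qed.

End G2Table.

Variables (met : g -> g -> R) (vol : kform g 7).
Hypothesis gmv : G2_metric_volume phi met vol.

(** The defining identity on the frame gives [met] times [vol f] as the identity matrix, so a
    positive scale [lam] is left; the normalisation of [vol] forces it to be 1. *)
Lemma frame_orthonormal (f : 7.-tuple g) : repZ f phi phiZ ->
  orthonormal_tuple met f /\ vol f = 1.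
Proof.
move=> rphi; have [ip [mvol avol] unit_vol wedgeE] := gmv.
have E p q : met (tnth f p) (tnth f q) * vol f = (p == q)%:R.
  have := wedgeE (tnth f p) (tnth f q) f.
  rewrite (wedge_contract_phi rphi) -mulrA => /mulfI -> //.
  by rewrite pnatr_eq0.
have volnz : vol f != 0.
  by apply: contra_eqN (E ord0 ord0) => /eqP ->; rewrite mulr0 eq_sym oner_eq0.
pose lam := (vol f)^-1.
have metf p q : met (tnth f p) (tnth f q) = lam * (p == q)%:R.
  by rewrite -E mulrCA mulVf // mulr1.
have lam_gt0 : 0 < lam.
  have nz : met (tnth f ord0) (tnth f ord0) != 0.
    by rewrite metf eqxx mulr1 invr_eq0.
  have := metf ord0 ord0; rewrite eqxx mulr1 => <-; apply: (met_gt0 ip).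
  by apply: contra_neq nz => ->; rewrite (met0l ip).
pose mu := Num.sqrt lam.
have mu_gt0 : 0 < mu by rewrite sqrtr_gt0.
have mu2 : mu ^+ 2 = lam by rewrite sqr_sqrtr // ltW.
pose b := [tuple mu^-1 *: tnth f i | i < 7].
have onb : orthonormal_tuple met b.
  move=> i j; rewrite !tnth_mktuple (metZl ip) (metZr ip) metf -mu2.
  have nz : mu != 0 by rewrite gt_eqF.
  by rewrite !mulrA divfK ?mulVf ?mul1r.
(* Rescaling seven vectors by [mu^-1] and using [vol f = mu^-2] gives [mu^-9 = 1], with [mu]
   positive. *)
have := unit_vol _ onb; rewrite multilinear_scale //.
have -> : vol f = mu ^- 2 by rewrite mu2 invrK.
rewrite -exprVn -exprD ger0_norm ?exprn_ge0 ?invr_ge0 ?ltW // => /eqP.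
rewrite pexpr_eq1 ?invr_ge0 ?(ltW mu_gt0) //= => /eqP muV.
have mu1 : mu = 1 by rewrite -[mu]invrK muV invr1.
split; last by rewrite muV expr1n.
by move=> i j; rewrite metf -mu2 mu1 expr1n mul1r.
Qed.

End Frame.

Lemma map_val_cat k l n (J : k.-tuple 'I_n) (K : l.-tuple 'I_n) :
  map val (cat_tuple J K) = map val J ++ map val K.
Proof. by rewrite /= map_cat. Qed.

Lemma map_tuple_cat (T T' : Type) (h : T -> T') k l (J : k.-tuple T)
    (K : l.-tuple T) :
  cat_tuple (map_tuple h J) (map_tuple h K) = map_tuple h (cat_tuple J K).
Proof. by apply: val_inj; rewrite /= map_cat. Qed.

Lemma multilinear_sum0 (R : realType) (g : lieAlgebra R) k (a : kform g k.+1)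
    (v : k.-tuple g) n (c : 'I_n -> R) (x : 'I_n -> g) : multilinear a ->
  a [tuple of \sum_j c j *: x j :: v] = \sum_j c j * a [tuple of x j :: v].
Proof.
move=> ml; elim/big_rec2: _ => [|j s y _ <-]; last exact: multilinear_slot0.
have := multilinear_slot0 v (-1) 0 0 ml.
by rewrite scaler0 addr0 mulN1r addNr.
Qed.

Lemma bracketP_sum (R : realType) (env : nat -> R) (c : nat -> nat -> nat -> poly)
    (i j : 'I_7) (F : nat -> R) :
  \sum_(t <- bracketP c [:: val i; val j]) F t.1 * ev env t.2
  = \sum_(m < 7) F m * ev env (c i j m).
Proof.
rewrite /bracketP (memoE _ _ [tuple i; j]) big_filter big_mkcond big_map.
rewrite big_iota_ord; apply: eq_bigr => m _.
by case: ifPn => /= [//|/negPn/nilP ->]; rewrite mulr0.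
Qed.

Lemma sum_symm (R : nmodType) n (G : nat -> nat -> R) :
  (forall i j, G i j = G j i) -> (forall i, G i i = 0) ->
  \sum_(i < n) \sum_(j < n) G i j
  = (\sum_(j < n) \sum_(i <- iota 0 j) G i j) *+ 2.
Proof.
move=> Gs G0; elim: n => [|n IHn]; first by rewrite !big_ord0 mul0rn.
rewrite big_ord_recr [in RHS]big_ord_recr /= mulrnDl -IHn big_ord_recr /= G0 addr0.
under eq_bigr do rewrite big_ord_recr /=.
rewrite big_split /= -addrA; congr (_ + _).
rewrite mulr2n big_iota_ord; congr (_ + _).
by apply: eq_bigr => i _; rewrite Gs.
Qed.

(** * Components of psi, of differentials and of the torsion *)

Section Curvature.
Variables (R : realType) (g : lieAlgebra R) (phi : kform g 3).
Variables (met : g -> g -> R) (vol : kform g 7) (b f : 7.-tuple g).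
Hypotheses (dim7 : \dim {:g} = 7%N) (ip : inner_product met).
Hypotheses (mphi : multilinear phi) (mvol : multilinear vol).
Hypotheses (avol : alternating vol) (onb : orthonormal_tuple met b).
Hypotheses (onf : orthonormal_tuple met f) (volf : vol f = 1).
Hypothesis rphi : repZ f phi phiZ.

Lemma vol_rep (J : 7.-tuple 'I_7) :
  vol (map_tuple (tnth f) J) = zr R (leviZ 7 (map val J)).
Proof. by rewrite alternating_levi // volf mulr1 levi_code. Qed.

Lemma psi_rep : repZ f (psi_of b vol phi) psiZ.
Proof.
move=> J; rewrite /psi_of.
rewrite (@hodge_onb _ _ _ ip 3 4 b f _ _ dim7 onb onf mphi mvol) /hodge.
have n6 : (6%:R : R) != 0 by rewrite pnatr_eq0.
rewrite -[RHS](mulKf n6); congr (_ * _).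
rewrite -[6%:R]/(zr R 6) -zrM.
have /Z.eqb_spec <- := all_tuples hodge_phi_check J.
rewrite zr_sum big_map -big_arrangements => [|l sl nl].
  rewrite big_tuples; apply: eq_bigr => K _.
  by rewrite rphi map_tuple_cat vol_rep zrM map_val_cat.
rewrite leviZ_eq0 ?Z.mul_0_r // ?size_cat ?size_map ?size_tuple ?sl //.
apply: contra nl; rewrite cat_uniq => /and3P[-> /hasPn h _] /=.
by apply/allP=> i il; apply/negP=> /h; rewrite /= il.
Qed.

Lemma multilinear_psi : multilinear (psi_of b vol phi).
Proof. exact: (@multilinear_hodge _ _ 3 4). Qed.

Lemma multilinear_dphi : multilinear (ce_d phi).
Proof. exact: multilinear_ce_d. Qed.

Variables (env : nat -> R) (c : nat -> nat -> nat -> poly).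
Hypothesis hc : forall i j k : 'I_7,
  ev env (c i j k) = met (lie_br (tnth f i) (tnth f j)) (tnth f k).

Lemma ce_d_rep k (a : kform g k.+1) z : multilinear a -> repZ f a z ->
  forall J : k.+2.-tuple 'I_7,
  ce_d a (map_tuple (tnth f) J) = ev env (ce_dP (bracketP c) k z (map val J)).
Proof.
move=> ml ra J; rewrite /ce_d /ce_dP ev_psum big_map big_iota_ord.
apply: eq_bigr => j _; rewrite ev_psum big_map.
rewrite (_ : iota 0 j = index_iota 0 j); last by rewrite /index_iota subn0.
rewrite (big_nat_widen _ _ k.+1) -1?ltnS ?ltn_ord // big_mkord.
apply: eq_bigr => i ltij; rewrite ev_psum big_map.
have vij : val (lift j i) = i by rewrite /= /bump leqNgt ltij.
have nthJ (m : 'I_k.+2) : nth 0%N (map val J) m = tnth J m.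
  by rewrite (nth_map ord0) ?size_tuple // -tnth_nth.
rewrite -{2}vij !nthJ !tnth_map.
under eq_bigr do rewrite ev_pscale.
rewrite (@bracketP_sum _ _ _ _ _ (fun m => zr R
  (if odd (i + j) then Z.opp (z (m :: [seq nth 0%N (map val J) (bump j (bump i n))
      | n <- iota 0 k]))
   else z (m :: [seq nth 0%N (map val J) (bump j (bump i n)) | n <- iota 0 k])))).
(* The coefficients of the bracket in the orthonormal frame are the structure constants [c]. *)
rewrite (orthonormal_expand ip dim7 onf (lie_br _ _)) multilinear_sum0 //.
rewrite mulr_sumr; apply: eq_bigr => m _; rewrite hc mulrCA mulrC; congr (_ * _).
have -> : [seq nth 0%N (map val J) (bump j (bump i n)) | n <- iota 0 k]
    = map val [tuple tnth J (lift j (lift i n)) | n < k].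
  rewrite -[RHS]map_comp /= -val_enum_ord -map_comp; apply: eq_map => n /=.
  by rewrite -[bump i n]/(val (lift i n)) -[bump j _]/(val (lift j (lift i n))) nthJ.
rewrite -[map val _]/(map val (val _)).
rewrite -[val m :: _]/(map val [tuple of m :: [tuple tnth J (lift j (lift i n)) | n < k]]).
have -> : a [tuple of tnth f m
      :: [tuple tnth (map_tuple (tnth f) J) (lift j (lift i n)) | n < k]]
    = zr R (z (map val [tuple of m :: [tuple tnth J (lift j (lift i n)) | n < k]])).
  rewrite -ra; congr a; apply: eq_from_tnth => n.
  case: (unliftP ord0 n) => [n' ->|->]; last by rewrite tnth_map !tnth0.
  by rewrite tnth_map !tnthS !tnth_mktuple tnth_map.
rewrite -signr_odd; case: odd; last by rewrite mul1r.
by rewrite expr1 mulN1r zrN.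
Qed.

(** Both [W] and [vol] contribute a Levi-Civita symbol; their product is 1 on each of the [7!]
    permutations. *)
Lemma hodge_top (W : kform g 7) : multilinear W -> alternating W ->
  @hodge _ g 7 0 b vol W [tuple] = W f.
Proof.
move=> mW aW.
rewrite (@hodge_onb _ _ _ ip 7 0 b f _ _ dim7 onb onf mW mvol) /hodge.
transitivity ((7`!)%:R^-1 * \sum_(I : 7.-tuple 'I_7) levi R I * (levi R I * W f)).
  congr (_ * _); apply: eq_bigr => I _; rewrite [RHS]mulrCA mulrC.
  rewrite -alternating_levi //; congr (_ * _).
  transitivity (vol (map_tuple (tnth f) I)).
    by congr vol; apply: val_inj; rewrite /= cats0.
  by rewrite alternating_levi // volf mulr1.
rewrite -levi_sum; under eq_bigr do rewrite levi_perm signrMK.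
rewrite sumr_const card_Sn -[X in _ * X]mulr_natl mulKf //.
by rewrite pnatr_eq0 -lt0n fact_gt0.
Qed.

Lemma torsion_rep (p : seq nat -> poly) :
  (forall J : 4.-tuple 'I_7, ce_d phi (map_tuple (tnth f) J) = ev env (p (map val J))) ->
  forall J : 3.-tuple 'I_7,
  144%:R * torsion b vol phi (map_tuple (tnth f) J)
  = ev env (torsionP (sum_dphi_psiP p) p (map val J)).
Proof.
move=> rp J; rewrite /torsion hodge_top; first last.
- exact: (@wedge_alternating _ _ 4 3).
- by apply: (@multilinear_wedge _ _ 4 3) => //; apply: multilinear_dphi.
rewrite (@wedge_phi _ _ _ _ rphi (ce_d phi)).
rewrite (@hodge_onb _ _ _ ip 4 3 b f _ _ dim7 onb onf multilinear_dphi mvol) /hodge.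
rewrite /torsionP ev_padd !ev_pscale /sum_dphi_psiP !ev_psum !big_map.
rewrite psi_supportE big_filter [in RHS]big_mkcond big_tuples rphi.
rewrite -big_arrangements => [|l sl nl]; last first.
  rewrite leviZ_eq0 ?size_cat ?size_map ?size_tuple ?sl //.
  apply: contra nl; rewrite cat_uniq => /and3P[-> /hasPn h _] /=.
  by apply/allP=> i il; apply/negP=> /h; rewrite /= il.
rewrite big_tuples.
have -> : \sum_(I : 4.-tuple 'I_7) ce_d phi (map_tuple (tnth f) I) *
      zr R (psiZ (map val I)) = \sum_(I : 4.-tuple 'I_7)
    (if ~~ Z.eqb (psiZ (map val I)) 0 then
       ev env (pscale (psiZ (map val I)) (p (map val I))) else 0).
  apply: eq_bigr => I _; rewrite rp; case: Z.eqb_spec => [->|_].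
    by rewrite zr0 mulr0.
  by rewrite ev_pscale mulrC.
have -> : \sum_(I : 4.-tuple 'I_7) ce_d phi (map_tuple (tnth f) I) *
      vol (cat_tuple (map_tuple (tnth f) I) (map_tuple (tnth f) J))
    = \sum_(I : 4.-tuple 'I_7)
       ev env (pscale (leviZ 7 (map val I ++ map val J)) (p (map val I))).
  apply: eq_bigr => I _; rewrite rp map_tuple_cat vol_rep map_val_cat.
  by rewrite ev_pscale mulrC.
set S1 := \sum_(I : _) _; set S2 := \sum_(I : _) _.
rewrite (_ : zr R (-6) = - 6%:R) // (_ : 4`! = 24)%N //.
by field.
Qed.

End Curvature.

(** * The characteristic connection and its curvature *)

Section Connection.
Variables (R : realType) (g : lieAlgebra R) (met : g -> g -> R).
Hypotheses (dim7 : \dim {:g} = 7%N) (ip : inner_product met).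

(** The Koszul formula; inner products of left-invariant fields are constant, so only the bracket
    terms survive. *)
Lemma koszul (nabla : g -> g -> g) x y z : levi_civita met nabla ->
  2%:R * met (nabla x y) z
  = met (lie_br x y) z - met (lie_br y z) x + met (lie_br z x) y.
Proof.
case=> _ tf mc; rewrite -!tf !(metDl ip) !(metNl ip).
have A u v w : met (nabla u w) v = - met (nabla u v) w.
  by apply/eqP; rewrite -addr_eq0 (metC ip (nabla u v)) mc.
rewrite (A y x z) (A x z y) (A z y x); ring.
Qed.

Variables (nabla nabla1 : g -> g -> g) (T : kform g 3).
Hypotheses (lc : levi_civita met nabla) (mT : multilinear T).
Hypothesis conn : connection_with_torsion met nabla T nabla1.

Lemma torsionDl c x y u v :
  T [tuple c *: x + y; u; v] = c * T [tuple x; u; v] + T [tuple y; u; v].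
Proof.
have E z : [tuple z; u; v] = tset [tuple 0; u; v] ord0 z.
  by apply: eq_from_tnth => i; rewrite tnth_tset; case: i => [] [|[|[|]]].
by rewrite (E (c *: x + y)) (E x) (E y) mT.
Qed.

Lemma torsionDm c x y u v :
  T [tuple u; c *: x + y; v] = c * T [tuple u; x; v] + T [tuple u; y; v].
Proof.
have E z : [tuple u; z; v] = tset [tuple u; 0; v] (Ordinal (isT : (1 < 3)%N)) z.
  by apply: eq_from_tnth => i; rewrite tnth_tset; case: i => [] [|[|[|]]].
by rewrite (E (c *: x + y)) (E x) (E y) mT.
Qed.

Lemma torsionDr c x y u v :
  T [tuple u; v; c *: x + y] = c * T [tuple u; v; x] + T [tuple u; v; y].
Proof.
have E z : [tuple u; v; z] = tset [tuple u; v; 0] (Ordinal (isT : (2 < 3)%N)) z.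
  by apply: eq_from_tnth => i; rewrite tnth_tset; case: i => [] [|[|[|]]].
by rewrite (E (c *: x + y)) (E x) (E y) mT.
Qed.

Lemma nabla1_bilinear :
  (forall c x y z, nabla1 (c *: x + y) z = c *: nabla1 x z + nabla1 y z) /\
  (forall c x y z, nabla1 z (c *: x + y) = c *: nabla1 z x + nabla1 z y).
Proof.
have [[nl nr] _ _] := lc.
split=> c x y z; apply: (met_inj ip) => w; rewrite (metDZl ip) !conn.
  by rewrite nl torsionDl (metDZl ip); ring.
by rewrite nr torsionDm (metDZl ip); ring.
Qed.

Variable f : 7.-tuple g.
Hypothesis onf : orthonormal_tuple met f.

Lemma nabla1_suml n (a : 'I_n -> R) (x : 'I_n -> g) z :
  nabla1 (\sum_i a i *: x i) z = \sum_i a i *: nabla1 (x i) z.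
Proof.
elim/big_rec2: _ => [|i s y _ <-]; last exact: nabla1_bilinear.1.
by have := nabla1_bilinear.1 (-1) 0 0 z; rewrite scaler0 addr0 scaleN1r addNr.
Qed.

Lemma nabla1_sumr n (a : 'I_n -> R) (x : 'I_n -> g) z :
  nabla1 z (\sum_i a i *: x i) = \sum_i a i *: nabla1 z (x i).
Proof.
elim/big_rec2: _ => [|i s y _ <-]; last exact: nabla1_bilinear.2.
by have := nabla1_bilinear.2 (-1) 0 0 z; rewrite scaler0 addr0 scaleN1r addNr.
Qed.

Variables (env : nat -> R) (c : nat -> nat -> nat -> poly).
Hypothesis hc : forall i j k : 'I_7,
  ev env (c i j k) = met (lie_br (tnth f i) (tnth f j)) (tnth f k).

Lemma conn_rep (p : seq nat -> poly) :
  (forall J : 3.-tuple 'I_7,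
     144%:R * T (map_tuple (tnth f) J) = ev env (p (map val J))) ->
  forall x y z : 'I_7,
    288%:R * met (nabla1 (tnth f x) (tnth f y)) (tnth f z)
    = ev env (connP c p [:: val x; val y; val z]).
Proof.
move=> rp x y z; rewrite /connP !(ev_padd, ev_pscale) !hc.
rewrite -[ev env (p _)](rp [tuple x; y; z]) conn.
have -> : map_tuple (tnth f) [tuple x; y; z]
    = [tuple tnth f x; tnth f y; tnth f z] by apply: val_inj.
have := koszul (tnth f x) (tnth f y) (tnth f z) lc.
rewrite (_ : zr R (-1) = -1) // (_ : zr R 144 = 144%:R) //.
by lra.
Qed.

Variable A : seq nat -> poly.
Hypothesis hA : forall x y z : 'I_7,
  288%:R * met (nabla1 (tnth f x) (tnth f y)) (tnth f z)
  = ev env (A [:: val x; val y; val z]).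

Lemma curv_rep (x y u v : 'I_7) :
  (288%:R * 288%:R) *
    met (curvature nabla1 (tnth f x) (tnth f y) (tnth f u)) (tnth f v)
  = ev env (curvP c A x y u v).
Proof.
rewrite /curvature (orthonormal_expand ip dim7 onf (nabla1 (tnth f y) _)).
rewrite (orthonormal_expand ip dim7 onf (nabla1 (tnth f x) (tnth f u))).
rewrite (orthonormal_expand ip dim7 onf (lie_br _ _)).
rewrite nabla1_suml !nabla1_sumr !(metDl ip) !(metNl ip) !(met_suml ip).
rewrite /curvP ev_psum big_map big_iota_ord -!sumrN -!big_split mulr_sumr.
apply: eq_bigr => k _ /=; rewrite !(ev_padd, ev_pscale, ev_pmul) hc -!hA.
rewrite !(metZl ip) (_ : zr R (-1) = -1) // (_ : zr R (-288) = - 288%:R) //.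
by ring.
Qed.

Lemma curvature_antisym x y u : curvature nabla1 y x u = - curvature nabla1 x y u.
Proof.
have [_ tf _] := lc.
rewrite /curvature -(tf y x) -(opprB (nabla x y)) (tf x y).
have -> : nabla1 (- lie_br x y) u = - nabla1 (lie_br x y) u.
  have := nabla1_bilinear.1 (-1) (lie_br x y) 0 u.
  have := nabla1_bilinear.1 (-1) 0 0 u.
  by rewrite !scaleN1r !addr0 oppr0 addNr => -> ->; rewrite addr0.
by rewrite opprK opprB addrC opprB.
Qed.

Definition curvature_form (u v : g) : kform g 2 := fun xy =>
  met (curvature nabla1 (tnth xy ord0) (tnth xy ord_max) u) v.

Lemma inst_rep (psi : kform g 4) (m u v : 'I_7) : repZ f psi psiZ ->
  wedge (curvature_form (tnth f u) (tnth f v)) psi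
    (map_tuple (tnth f) [tuple lift m i | i < 6])
  = (if odd m then -1 else 1) / (288%:R * 288%:R) * ev env (instP c A m u v).
Proof.
move=> rpsi; pose L := [tuple lift m i | i < 6].
have EL k (J : k.-tuple 'I_6) :
    map val (map_tuple (tnth L) J) = [seq bump m i | i <- map val J].
  rewrite /= -!map_comp; apply: eq_map => i /=.
  by rewrite tnth_mktuple.
pose K i j := ev env (curvP c A (bump m i) (bump m j) u v).
pose w (i j : nat) := zr R (phiZ [:: val m; bump m i; bump m j]).
pose s : R := if odd m then -1 else 1.
rewrite wedge_levi.
have term (I : 2.-tuple 'I_6) :
    \sum_(J : 4.-tuple 'I_6) levi R (cat_tuple I J) *
       (curvature_form (tnth f u) (tnth f v)
          (map_tuple (tnth (map_tuple (tnth f) L)) I) *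
        psi (map_tuple (tnth (map_tuple (tnth f) L)) J))
    = 24%:R * s / (288%:R * 288%:R) *
      (w (tnth I ord0) (tnth I ord_max) * K (tnth I ord0) (tnth I ord_max)).
  have -> : K (tnth I ord0) (tnth I ord_max) = (288%:R * 288%:R) *
      curvature_form (tnth f u) (tnth f v)
          (map_tuple (tnth (map_tuple (tnth f) L)) I).
    rewrite /curvature_form /L !tnth_map !tnth_ord_tuple.
    by rewrite curv_rep.
  set kk := curvature_form _ _ _.
  have /allP/(_ (val m)) := wedge_psi_check.
  rewrite mem_iota ltn_ord => /(_ isT) chk.
  have /Z.eqb_spec := all_tuples chk I.
  have -> : (val m :: [seq bump (val m) i | i <- map val I])
      = [:: val m; bump m (tnth I ord0); bump m (tnth I ord_max)].
    case/tupleP: I {kk} => i I; case/tupleP: I => j I.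
    by rewrite (tuple0 I) /= tnth0; congr [:: _; _; bump _ (val _)].
  move/(congr1 (zr R)); rewrite zr_sum big_map -big_arrangements => [|l sl nl].
    rewrite big_tuples zrM -/(w _ _) => E.
    have -> : 24%:R * s = zr R (if odd m then -24 else 24)%BZ.
      by rewrite /s; case: (odd m); rewrite ?mulrN1 ?mulr1.
    transitivity (zr R (if odd m then -24 else 24)%BZ *
        w (tnth I ord0) (tnth I ord_max) * kk); last first.
      by field.
    rewrite -E mulr_suml; apply: eq_bigr => J _.
    rewrite map_tuple_map rpsi EL levi_code map_val_cat zrM.
    by rewrite mulrA mulrAC (mulrC (zr R (leviZ _ _))).
  rewrite leviZ_eq0 ?Z.mul_0_r // ?size_cat ?size_map ?size_tuple ?sl //.
  apply: contra nl; rewrite cat_uniq => /and3P[_ /hasPn h ->] /=.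
  by apply/allP=> i /h.
under eq_bigr do rewrite term.
rewrite -mulr_sumr big_tuple_cons.
have -> : \sum_(i < 6) \sum_(I : 1.-tuple 'I_6)
      (w (tnth [tuple of i :: I] ord0) (tnth [tuple of i :: I] ord_max) *
       K (tnth [tuple of i :: I] ord0) (tnth [tuple of i :: I] ord_max))
    = \sum_(i < 6) \sum_(j < 6) w i j * K i j.
  apply: eq_bigr => i _; rewrite big_tuple_cons; apply: eq_bigr => j _.
  rewrite (big_pred1 [tuple]) => [|I]; last by apply/esym/eqP/tuple0.
  by rewrite tnth0 (tnth_nth i).
pose G i j := if (i < 6)%N && (j < 6)%N then w i j * K i j else 0.
have GE (i j : 'I_6) : w i j * K i j = G i j by rewrite /G !ltn_ord.
have wN (i j : 'I_6) : w j i = - w i j.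
  have /Z.eqb_spec E := all_tuples phi_antisym_check [tuple m; lift m j; lift m i].
  by rewrite /w -zrN; congr zr; apply: E.
have KN (i j : 'I_6) : K j i = - K i j.
  have := curv_rep (lift m i) (lift m j) u v.
  have := curv_rep (lift m j) (lift m i) u v.
  by rewrite /K => <- <-; rewrite curvature_antisym (metNl ip) mulrN.
under eq_bigr => i _ do under eq_bigr => j _ do rewrite GE.
(* [w] and [K] are both antisymmetric, so ordered pairs count each pair [i < j] twice; this cancels
   the [2!] in [wedge]. *)
rewrite sum_symm; first last.
- move=> i; rewrite /G; case: ifP => // /andP[lti _].
  have := wN (Ordinal lti) (Ordinal lti) => /= /eqP.
  by rewrite -addr_eq0 -mulr2n mulrn_eq0 /= => /eqP ->; rewrite mul0r.
- move=> i j; rewrite /G andbC; case: ifP => // /andP[ltj lti].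
  have := wN (Ordinal lti) (Ordinal ltj); have := KN (Ordinal lti) (Ordinal ltj).
  by move=> /= -> ->; rewrite mulrNN.
rewrite /instP ev_psum big_map big_iota_ord.
have -> : \sum_(j < 6) \sum_(i <- iota 0 j) G i j
  = \sum_(j < 6) ev env (psum [seq
      let w := phiZ [:: val m; bump m i; bump m j] in
      if Z.eqb w 0 then [::] else pscale w (curvP c A (bump m i) (bump m j) u v)
    | i <- iota 0 j]).
  apply: eq_bigr => j _; rewrite ev_psum big_map [LHS]big_seq [RHS]big_seq.
  apply: eq_bigr => i; rewrite mem_iota add0n => /= ltij.
  rewrite /G ltn_ord (ltn_trans ltij) //= /w /K.
  by case: Z.eqb_spec => [->|_]; rewrite ?zr0 ?mul0r // ev_pscale.
set S := \sum_(j < 6) _; rewrite -/s -[2`!]/2%N (_ : 4`! = 24)%N // natrM mulrnAr.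
by rewrite -mulr_natr; field.
Qed.

End Connection.

(** * The instanton condition as polynomial equations *)

Section Equations.
Variables (R : realType) (g : lieAlgebra R) (phi : kform g 3).
Variables (met : g -> g -> R) (vol : kform g 7) (b : 7.-tuple g).
Variables (nabla nabla1 : g -> g -> g).
Hypotheses (dim7 : \dim {:g} = 7%N) (mphi : multilinear phi).
Hypothesis gmv : G2_metric_volume phi met vol.
Hypothesis onb : orthonormal_tuple met b.
Hypothesis lc : levi_civita met nabla.
Hypothesis conn : connection_with_torsion met nabla (torsion b vol phi) nabla1.
Variables (f : 7.-tuple g) (env : nat -> R) (c : nat -> nat -> nat -> poly).
Hypothesis rphi : repZ f phi phiZ.
Hypothesis hc : forall i j k : 'I_7,
  ev env (c i j k) = met (lie_br (tnth f i) (tnth f j)) (tnth f k).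

Lemma multilinear_torsion : multilinear (torsion b vol phi).
Proof.
have [_ [mvol _] _ _] := gmv.
apply: multilinearB; last exact: (@multilinear_hodge _ _ 4 3).
by move=> v i t x y; rewrite mphi; ring.
Qed.

Lemma frame_dpsi (J : 5.-tuple 'I_7) :
  ce_d (psi_of b vol phi) (map_tuple (tnth f) J)
  = ev env (ce_dP (bracketP c) 3 psiZ (map val J)).
Proof.
have [ip [mvol avol] _ _] := gmv; have [onf volf] := frame_orthonormal gmv rphi.
apply: (ce_d_rep dim7 ip onf hc); first exact: multilinear_psi.
exact: (psi_rep dim7 ip mphi mvol avol onb onf volf rphi).
Qed.

Lemma frame_inst (m u v : 'I_7) :
  wedge (curvature_form met nabla1 (tnth f u) (tnth f v)) (psi_of b vol phi)
    (map_tuple (tnth f) [tuple lift m i | i < 6])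
  = (if odd m then -1 else 1) / (288%:R * 288%:R) *
    ev env (instP c (conn_tableP c) m u v).
Proof.
have [ip [mvol avol] _ _] := gmv; have [onf volf] := frame_orthonormal gmv rphi.
apply: (inst_rep dim7 ip lc multilinear_torsion conn onf hc);
  last exact: (psi_rep dim7 ip mphi mvol avol onb onf volf rphi).
move=> x y z; rewrite /conn_tableP (memoE _ _ [tuple x; y; z]).
apply: (conn_rep ip lc conn hc).
apply: (torsion_rep dim7 ip mphi mvol avol onb onf volf rphi) => J; rewrite memoE.
exact: (@ce_d_rep _ _ _ _ dim7 ip onf _ _ hc 2).
Qed.

Lemma frame_equations :
  coclosed b vol phi -> G2_instanton met (psi_of b vol phi) nabla1 ->
  (forall J : 5.-tuple 'I_7, ev env (ce_dP (bracketP c) 3 psiZ (map val J)) = 0) /\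
  (forall m u v : 'I_7, ev env (instP c (conn_tableP c) m u v) = 0).
Proof.
move=> cc inst; split=> [J|m u v]; first by rewrite -frame_dpsi cc.
have := frame_inst m u v; rewrite /curvature_form inst => /esym/eqP.
rewrite mulf_eq0 => /orP[|/eqP //]; rewrite mulf_eq0 invr_eq0 mulf_eq0.
by rewrite pnatr_eq0 orbb /=; case: odd; rewrite ?oppr_eq0 oner_eq0.
Qed.

Lemma frame_solution :
  (forall J : 5.-tuple 'I_7, ev env (ce_dP (bracketP c) 3 psiZ (map val J)) = 0) ->
  (forall m u v : 'I_7, ev env (instP c (conn_tableP c) m u v) = 0) ->
  coclosed b vol phi /\ G2_instanton met (psi_of b vol phi) nabla1.
Proof.
move=> dpsi0 inst0; have [ip [mvol avol] _ _] := gmv.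
have [onf volf] := frame_orthonormal gmv rphi.
have span := basis_span (orthonormal_basis ip dim7 onf).
have mpsi : multilinear (psi_of b vol phi) by exact: multilinear_psi.
have [n1l n1r] := nabla1_bilinear ip lc multilinear_torsion conn.
split.
  move=> v; apply: (multilinear_eq0 span (multilinear_ce_d mpsi)) => J.
  by rewrite frame_dpsi dpsi0.
have add3 (a a' b1 b' d d' : g) :
    a + a' - (b1 + b') - (d + d') = (a - b1 - d) + (a' - b' - d').
  by rewrite !opprD (addrACA a) (addrACA (a - b1)).
have curvl t x x' y u : curvature nabla1 (t *: x + x') y u
    = t *: curvature nabla1 x y u + curvature nabla1 x' y u.
  by rewrite /curvature lie_brDZl !n1l n1r add3 !scalerBr.
have curvu t x y u u' : curvature nabla1 x y (t *: u + u')
    = t *: curvature nabla1 x y u + curvature nabla1 x y u'.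
  by rewrite /curvature !n1r add3 !scalerBr.
have curvN := curvature_antisym ip lc multilinear_torsion conn.
have curvr t x y y' u : curvature nabla1 x (t *: y + y') u
    = t *: curvature nabla1 x y u + curvature nabla1 x y' u.
  by rewrite curvN curvl opprD -scalerN -!curvN.
have mK u v : multilinear (curvature_form met nabla1 u v).
  move=> w i t x y; rewrite /curvature_form !tnth_tset.
  case: i => [] [|[|//]] ?.
    by rewrite -!val_eqE /= curvl (metDZl ip).
  by rewrite -!val_eqE /= curvr (metDZl ip).
have lin0 (h : g -> R) : (forall t x y, h (t *: x + y) = t * h x + h y) ->
    (forall i, h (tnth f i) = 0) -> forall x, h x = 0.
  move=> hl h0 x; have [k ->] := span x.
  have z0 : h 0 = 0 by have := hl (-1) 0 0; rewrite scaler0 addr0 mulN1r addNr.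
  elim/big_rec: _ => // i y _ hy.
  by rewrite hl h0 hy mulr0 addr0.
move=> u v w.
change (wedge (curvature_form met nabla1 u v) (psi_of b vol phi) w = 0).
apply: (multilinear_eq0 span) w => [|I]; first exact: (@multilinear_wedge _ _ 2 4).
(* The curvature form is linear in [u] and in [v], so frame vectors suffice there too. *)
have lins w : (forall i j,
      wedge (curvature_form met nabla1 (tnth f i) (tnth f j)) (psi_of b vol phi) w = 0) ->
    wedge (curvature_form met nabla1 u v) (psi_of b vol phi) w = 0.
  move=> w0.
  apply: (lin0 (fun z => wedge (curvature_form met nabla1 z v)
                               (psi_of b vol phi) w)) => [t x y|i].
    by apply: wedge_lin => xy; rewrite /curvature_form curvu (metDZl ip).
  apply: (lin0 (fun z => wedge (curvature_form met nabla1 (tnth f i) z)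
                               (psi_of b vol phi) w)) => [t x y|j];
    last exact: w0.
  by apply: wedge_lin => xy; rewrite /curvature_form (metDZr ip).
case: (altP (@injectiveP _ _ (tnth I))) => [injI|/injectivePn[i [j nij Eij]]];
  last first.
  by apply: (@wedge_alternating _ _ 2 4 _ _ _ _ _ nij); rewrite !tnth_map Eij.
(* Six distinct indices out of seven omit one [m]; their order only matters up to a sign. *)
have [m mI] : exists m, m \notin I.
  apply/existsP/contraT => /existsPn mI.
  suff: (#|'I_7| <= size I)%N by rewrite card_ord size_tuple.
  apply: leq_trans (card_size I); apply: subset_leq_card.
  by apply/subsetP => m _; have := mI m; rewrite negbK.
have /fin_all_exists[s Es] i : exists j, tnth I i = lift m j.
  case: (unliftP m (tnth I i)) => [j ->|E]; first by exists j.
  by rewrite -E mem_tnth in mI.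
have injs : injective s by move=> i j E; apply: injI; rewrite !Es E.
have -> : map_tuple (tnth f) I
    = [tuple tnth (map_tuple (tnth f) [tuple lift m i | i < 6]) (perm injs i)
      | i < 6].
  by apply: eq_from_tnth => i;
    rewrite tnth_map tnth_mktuple tnth_map tnth_mktuple permE Es.
apply: lins => i j.
rewrite (@wedge_perm _ _ 2 4) frame_inst inst0.
by rewrite !mulr0.
Qed.

End Equations.

Definition has_instanton (R : realType) (g : lieAlgebra R) : Prop :=
  exists (phi : kform g 3) (met : g -> g -> R) (vol : kform g 7)
         (b : 7.-tuple g) (nabla nabla1 : g -> g -> g),
    [/\ G2_structure phi,
        G2_metric_volume phi met vol /\ orthonormal_tuple met b,
        coclosed b vol phi,
        levi_civita met nabla /\
          connection_with_torsion met nabla (torsion b vol phi) nabla1 &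
        G2_instanton met (psi_of b vol phi) nabla1].

(** * The G2-structure for which a given basis is a G2-frame *)

Section Existence.
Variables (R : realType) (g : lieAlgebra R) (f : 7.-tuple g).
Hypotheses (dim7 : \dim {:g} = 7%N) (bf : basis_of fullv f).

Definition frame_met (x y : g) : R := \sum_i coord f i x * coord f i y.

Definition frame_vol : kform g 7 := fun v =>
  \det (\matrix_(i, j) coord f j (tnth v i)).

Definition frame_dual : 7.-tuple 'Hom(g, R^o) :=
  [tuple linfun (coord f i : g -> R^o) | i < 7].

Definition frame_phi : kform g 3 := standard_G2 frame_dual.

Lemma coord_frame i j : coord f i (tnth f j) = (i == j)%:R.
Proof. by rewrite (tnth_nth 0) coord_free ?(basis_free bf) // eq_sym. Qed.

Lemma frame_dualE i x : tnth frame_dual i x = coord f i x.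
Proof. by rewrite tnth_mktuple lfunE. Qed.

Lemma frame_expand x : x = \sum_i coord f i x *: tnth f i.
Proof.
rewrite {1}(coord_basis bf (memvf x)); apply: eq_bigr => i _.
by rewrite (tnth_nth 0).
Qed.

Lemma frame_ip : inner_product frame_met.
Proof.
split=> [|x y|x nzx].
- split=> t x y z; rewrite /frame_met scaler_sumr -big_split;
    apply: eq_bigr => i _; rewrite linearP.
    by rewrite mulrDl -mulrA.
  by rewrite mulrDr mulrCA.
- by apply: eq_bigr => i _; rewrite mulrC.
rewrite lt0r sumr_ge0 ?andbT => [|i _]; last by rewrite -expr2 sqr_ge0.
apply: contraNneq nzx => /psumr_eq0P E.
rewrite (frame_expand x) big1 // => i _.
have /eqP := E (fun i _ => sqr_ge0 (coord f i x)) i isT.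
by rewrite mulf_eq0 orbb => /eqP ->; rewrite scale0r.
Qed.

Lemma frame_metE x i : frame_met x (tnth f i) = coord f i x.
Proof.
rewrite /frame_met (bigD1 i) //= coord_frame eqxx mulr1 big1 ?addr0 // => j nji.
by rewrite coord_frame (negbTE nji) mulr0.
Qed.

Lemma frame_onf : orthonormal_tuple frame_met f.
Proof. by move=> i j; rewrite frame_metE coord_frame eq_sym. Qed.

Lemma frame_vol_multilinear : multilinear frame_vol.
Proof.
move=> v i t x y; rewrite /frame_vol.
rewrite (determinant_multilinear
  (B := \matrix_(k, j) coord f j (tnth (tset v i x) k))
  (C := \matrix_(k, j) coord f j (tnth (tset v i y) k)) (i0 := i) (b := t) (c := 1));
  first by rewrite mul1r.
- by apply/rowP=> j; rewrite !mxE !tnth_tset eqxx linearP mul1r.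
- by apply/matrixP=> k j; rewrite !mxE !tnth_tset eq_sym (negbTE (neq_lift _ _)).
by apply/matrixP=> k j; rewrite !mxE !tnth_tset eq_sym (negbTE (neq_lift _ _)).
Qed.

Lemma frame_vol_alternating : alternating frame_vol.
Proof.
move=> v i j nij E; apply: (determinant_alternate nij) => k.
by rewrite !mxE E.
Qed.

Lemma frame_vol1 : frame_vol f = 1.
Proof.
rewrite /frame_vol -[RHS](det1 R 7); congr (\det _).
by apply/matrixP=> i j; rewrite !mxE coord_frame eq_sym.
Qed.

Lemma frame_phi_rep : repZ f frame_phi phiZ.
Proof. by apply: standard_G2_rep => i j; rewrite frame_dualE coord_frame. Qed.

Lemma frame_dual_basis : basis_of fullv frame_dual.
Proof.
rewrite basisEfree subvf size_tuple dimvf.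
have -> : dim 'Hom(g, R^o) = 7%N.
  by rewrite -[LHS]/(dim g * 1)%N muln1 -dimvf.
rewrite andbT; apply/freeP => k k0 j.
have: (\sum_(i < 7) k i *: frame_dual`_i) (tnth f j) = 0 by rewrite k0 zero_lfunE.
rewrite sum_lfunE (bigD1 j) // big1 => [|i ni].
  rewrite Monoid.mulm1 scale_lfunE -tnth_nth frame_dualE coord_frame eqxx.
  by rewrite /GRing.scale /= mulr1.
have nij : (i == j) = false by apply: negbTE.
rewrite scale_lfunE -tnth_nth frame_dualE coord_frame nij.
by rewrite scaler0.
Qed.

(** Both sides of the defining identity are seven-forms, hence determined by their value on [f];
    that value is bilinear in [x] and [y], and [wedge_contract_phi] computes it on the frame. *)
Lemma frame_gmv : G2_metric_volume frame_phi frame_met frame_vol.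
Proof.
have ip := frame_ip; have mphi : multilinear frame_phi.
  exact: standard_G2_multilinear.
split=> //.
- by split; [exact: frame_vol_multilinear|exact: frame_vol_alternating].
(* The coordinates of another orthonormal basis form an orthogonal matrix, of determinant 1 or
   -1. *)
- move=> b onb; rewrite /frame_vol; set M := \matrix_(i, j) _.
  have MM : M *m M^T = 1%:M.
    apply/matrixP=> i j; rewrite !mxE -onb /frame_met; apply: eq_bigr => k _.
    by rewrite !mxE.
  have := congr1 determinant MM; rewrite det_mulmx det_tr det1 -expr2 => /eqP.
  by rewrite sqrf_eq1 => /orP[] /eqP ->; rewrite ?normrN normr1.
move=> x y.
have mW : multilinear (wedge (wedge (contract x frame_phi) (contract y frame_phi))
                             frame_phi).
  by do 2?[apply: multilinear_wedge] => //; apply: multilinear_contract.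
apply: (multilinear_eq (basis_span bf)) => [||I]; first exact: mW.
  by move=> v i t z z'; rewrite frame_vol_multilinear; ring.
have W0 : wedge (wedge (contract x frame_phi) (contract y frame_phi)) frame_phi f
    = 6 * frame_met x y.
  have lin_eq (h h' : g -> R) :
      (forall t x y, h (t *: x + y) = t * h x + h y) ->
      (forall t x y, h' (t *: x + y) = t * h' x + h' y) ->
      (forall i, h (tnth f i) = h' (tnth f i)) -> h =1 h'.
    move=> hl hl' E z.
    have s (k : g -> R) : (forall t x y, k (t *: x + y) = t * k x + k y) ->
        k z = \sum_i coord f i z * k (tnth f i).
      move=> kl; rewrite {1}(frame_expand z).
      have k0 : k 0 = 0 by have := kl (-1) 0 0; rewrite scaler0 addr0 mulN1r addNr.
      by elim/big_rec2: _ => // i a c _ <-; rewrite kl.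
    by rewrite (s h) // (s h') //; apply: eq_bigr => i _; rewrite E.
  apply: (lin_eq (fun x => wedge (wedge (contract x frame_phi) (contract y frame_phi))
                                 frame_phi f)
                 (fun x => 6 * frame_met x y)) => [t z z'|t z z'|i].
  - apply: wedge_lin => w; apply: wedge_lin => w'.
    by rewrite /contract multilinear_slot0.
  - by rewrite (metDZl ip); ring.
  apply: (lin_eq (fun y => wedge (wedge (contract (tnth f i) frame_phi)
                                        (contract y frame_phi)) frame_phi f)
                 (fun y => 6 * frame_met (tnth f i) y)) => [t z z'|t z z'|j].
  - apply: wedge_lin => w; apply: wedge_linr => w'.
    by rewrite /contract multilinear_slot0.
  - by rewrite (metDZr ip); ring.
  by rewrite (wedge_contract_phi frame_phi_rep) frame_onf.
rewrite (alternating_levi (w := frame_vol)); first last.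
- exact: frame_vol_alternating.
- exact: frame_vol_multilinear.
rewrite frame_vol1 mulr1 mulrC -W0.
by apply: (@alternating_levi R g 7); last exact: (@wedge_alternating _ _ 4 3).
Qed.

Lemma exists_solution (env : nat -> R) (c : nat -> nat -> nat -> poly) :
  (forall i j k : 'I_7,
     ev env (c i j k) = coord f k (lie_br (tnth f i) (tnth f j))) ->
  (forall J : 5.-tuple 'I_7, ev env (ce_dP (bracketP c) 3 psiZ (map val J)) = 0) ->
  (forall m u v : 'I_7, ev env (instP c (conn_tableP c) m u v) = 0) ->
  has_instanton g.
Proof.
move=> hc dpsi0 inst0; have ip := frame_ip; have onf := frame_onf.
pose T := torsion f frame_vol frame_phi.
(* The Levi-Civita connection is defined through the right-hand side of the Koszul formula. *)
pose kz x y z := 2^-1 *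
  (frame_met (lie_br x y) z - frame_met (lie_br y z) x + frame_met (lie_br z x) y).
pose nabla x y := \sum_k kz x y (tnth f k) *: tnth f k.
pose nabla1 x y := nabla x y +
  \sum_k (2^-1 * T [tuple x; y; tnth f k]) *: tnth f k.
have mT : multilinear T.
  exact: (multilinear_torsion _ (standard_G2_multilinear _) frame_gmv).
have met_sum (h : g -> R) : (forall t x y, h (t *: x + y) = t * h x + h y) ->
    forall z, frame_met (\sum_k h (tnth f k) *: tnth f k) z = h z.
  move=> hl z; rewrite (met_suml ip).
  have h0 : h 0 = 0 by have := hl (-1) 0 0; rewrite scaler0 addr0 mulN1r addNr.
  rewrite [in RHS](frame_expand z).
  transitivity (\sum_i coord f i z * h (tnth f i)); last first.
    by elim/big_rec2: _ => // i a c' _ ->; rewrite hl.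
  apply: eq_bigr => k _; rewrite (metZl ip) (metC ip) frame_metE.
  by rewrite mulrC.
have nablaE x y z : frame_met (nabla x y) z = kz x y z.
  apply: (met_sum (kz x y)) => t u v; rewrite /kz lie_brDZl lie_brDZr.
  by rewrite !(metDZl ip, metDZr ip); ring.
have conn : connection_with_torsion frame_met nabla T nabla1.
  move=> x y z; rewrite (metDl ip); congr (_ + _).
  apply: (met_sum (fun z => 2^-1 * T [tuple x; y; z])) => t u v.
  by rewrite (torsionDr mT); ring.
have brN (x y : g) : lie_br y x = - lie_br x y.
  have := lie_brxx (x + y).
  have := lie_brDZl 1 x y (x + y); rewrite !scale1r => ->.
  have := lie_brDZr 1 x y x; have := lie_brDZr 1 x y y.
  rewrite !scale1r => -> ->; rewrite !lie_brxx add0r addr0.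
  by move/eqP; rewrite addrC addr_eq0 => /eqP.
have lc : levi_civita frame_met nabla.
  split=> [|x y|x y z].
  - split=> t x y z; apply: (met_inj ip) => w; rewrite (metDZl ip) !nablaE /kz;
    by rewrite !(lie_brDZl, lie_brDZr) !(metDZl ip, metDZr ip); ring.
  - apply: (met_inj ip) => w; rewrite (metDl ip) (metNl ip) !nablaE /kz.
    by rewrite (brN x y) (brN x w) (brN y w) !(metNl ip); field.
  rewrite (metC ip y) !nablaE /kz (brN x y) (brN z x) (brN y z) !(metNl ip).
  by field.
have [] := frame_solution dim7 (standard_G2_multilinear _) frame_gmv onf lc conn
  frame_phi_rep _ dpsi0 inst0.
  by move=> i j k; rewrite hc frame_metE.
move=> cc inst; exists frame_phi, frame_met, frame_vol, f, nabla, nabla1; split=> //.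
  by exists frame_dual; split=> //; apply: frame_dual_basis.
by split=> //; apply: frame_gmv.
Qed.

End Existence.

(** * Structure equations and isomorphisms *)

(* Structure constants of the Lie algebra with de^k = \sum_(i < j) (p i j k)  *)
(* e^{ij}, recalling that d xi (x, y) = - xi [x, y].                          *)
Definition deP (p : nat -> nat -> nat -> poly) : nat -> nat -> nat -> poly :=
  let t := memo [::] 3 (fun l => if l is [:: i; j; k] then
    if (i < j)%N then pscale (-1) (p i j k)
    else if (j < i)%N then p j i k else [::] else [::]) in
  fun i j k => t [:: i; j; k].

Definition terms (s : seq (nat * nat * nat * Z)) (i j k : nat) : poly :=
  psum [seq pC t.2 | t <- s & t.1 == (i, j, k)].

Section StructureConstants.
Variables (R : realType) (env : nat -> R).

Lemma ev_deP p (i j k : 'I_7) :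
  ev env (deP p i j k)
  = if (i < j)%N then - ev env (p i j k)
    else if (j < i)%N then ev env (p j i k) else 0.
Proof.
have -> : deP p i j k = if (i < j)%N then pscale (-1) (p i j k)
    else if (j < i)%N then p j i k else [::].
  exact: (memoE _ _ [tuple i; j; k]).
by case: ifP => _; [rewrite ev_pscale mulN1r|case: ifP].
Qed.

Lemma deP_bracket (p : nat -> nat -> nat -> poly) (B : 'I_7 -> 'I_7 -> 'I_7 -> R) :
  (forall i k, B i i k = 0) -> (forall i j k, B j i k = - B i j k) ->
  (forall i j k : 'I_7, (i < j)%N -> B i j k = - ev env (p i j k)) ->
  forall i j k : 'I_7, ev env (deP p i j k) = B i j k.
Proof.
move=> B0 BN BE i j k; rewrite ev_deP; case: (ltngtP i j) => [ltij|ltji|Eij].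
- by rewrite BE.
- by rewrite BN BE ?opprK.
by rewrite (val_inj Eij) B0.
Qed.

Lemma ev_terms s i j k :
  ev env (terms s i j k) = \sum_(t <- s) (t.1 == (i, j, k))%:R * zr R t.2.
Proof.
rewrite /terms ev_psum big_map big_filter big_mkcond.
by apply: eq_bigr => t _; case: eqP => _; rewrite ?ev_pC ?mul1r ?mul0r.
Qed.

(** Each listed coefficient enters at [(i, j)] and, with the opposite sign, at [(j, i)]; the double
    sum thus collapses to one antisymmetrised product per term. *)
Lemma terms_sum s (a b : nat -> R) (m : 'I_7) :
  all (fun t : nat * nat * nat * Z => (t.1.1.1 < t.1.1.2 < 7)%N) s ->
  \sum_(i < 7) \sum_(j < 7) ev env (deP (terms s) i j m) * (a i * b j)
  = \sum_(t <- s | t.1.2 == m :> nat)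
      zr R t.2 * (a t.1.1.2 * b t.1.1.1 - a t.1.1.1 * b t.1.1.2).
Proof.
move=> s7.
have pick (F : nat -> nat -> R) (t : nat * nat * nat * Z) :
    (t.1.1.1 < t.1.1.2 < 7)%N ->
    \sum_(i < 7) \sum_(j < 7) (if (i < j)%N then
       (t.1 == (val i, val j, val m))%:R * zr R t.2 * F i j else 0)
    = if t.1.2 == m then zr R t.2 * F t.1.1.1 t.1.1.2 else 0.
  case: t => [[[i0 j0] k0] z] /= /andP[ltij ltj].
  rewrite (bigD1 (Ordinal (ltn_trans ltij ltj))) //= [X in _ + X]big1 => [|i nei].
    rewrite addr0 (bigD1 (Ordinal ltj)) //= big1 => [|j nej].
      rewrite addr0 ltij !xpair_eqE !eqxx /=.
      by case: eqP => _; rewrite ?mul1r // !mul0r.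
    rewrite !xpair_eqE eqxx /= (_ : (j0 == j :> nat) = false) /=.
      by rewrite !mul0r; case: ifP.
    by apply: contraNF nej => /eqP E; rewrite -val_eqE /= E.
  rewrite big1 // => j _; rewrite !xpair_eqE (_ : (i0 == i :> nat) = false) /=.
    by rewrite !mul0r; case: ifP.
  by apply: contraNF nei => /eqP E; rewrite -val_eqE /= E.
transitivity (\sum_(i < 7) \sum_(j < 7) \sum_(t <- s)
    (if (i < j)%N then (t.1 == (val i, val j, val m))%:R * zr R t.2 *
       (a j * b i - a i * b j) else 0)).
  have split2 (G : nat -> nat -> R) :
      \sum_(i < 7) \sum_(j < 7) (if (i < j)%N then - G i j * (a i * b j)
         else if (j < i)%N then G j i * (a i * b j) else 0)
      = \sum_(i < 7) \sum_(j < 7)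
         (if (i < j)%N then G i j * (a j * b i - a i * b j) else 0).
    transitivity (\sum_(i < 7) \sum_(j < 7)
        ((if (i < j)%N then - G i j * (a i * b j) else 0) +
         (if (j < i)%N then G j i * (a i * b j) else 0))).
      apply: eq_bigr => i _; apply: eq_bigr => j _.
      by case: (ltngtP i j); rewrite ?addr0 ?add0r.
    under eq_bigr do rewrite big_split /=.
    rewrite big_split /= [X in _ + X]exchange_big -big_split; apply: eq_bigr => i _.
    rewrite -big_split; apply: eq_bigr => j _ /=.
    by case: ifP => _; rewrite ?addr0 //; ring.
  transitivity (\sum_(i < 7) \sum_(j < 7)
     (if (i < j)%N then - ev env (terms s i j m) * (a i * b j)
      else if (j < i)%N then ev env (terms s j i m) * (a i * b j) else 0)).
    apply: eq_bigr => i _; apply: eq_bigr => j _; rewrite ev_deP.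
    by case: ifP => // _; case: ifP => // _; rewrite mul0r.
  rewrite (split2 (fun i j => ev env (terms s i j m))).
  apply: eq_bigr => i _; apply: eq_bigr => j _.
  case: ifP => _; last by rewrite big1.
  by rewrite ev_terms mulr_suml.
under eq_bigr do rewrite exchange_big.
rewrite exchange_big [RHS]big_mkcond [LHS]big_seq [RHS]big_seq.
apply: eq_bigr => t ts.
by rewrite (pick (fun i j => a j * b i - a i * b j)) //; apply: (allP s7).
Qed.

End StructureConstants.

Section Isomorphisms.
Variables (R : realType) (g h : lieAlgebra R).
Variable (C : 'I_7 -> 'I_7 -> 'I_7 -> R) (k : h -> 'rV[R]_7).
Hypotheses (klin : linear k) (kbij : bijective k).
Hypothesis kbr : forall (x y : h) m, k (lie_br x y) 0 m
  = \sum_i \sum_j C i j m * (k x 0 i * k y 0 j).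

Let ksum n (a : 'I_n -> R) (x : 'I_n -> h) :
  k (\sum_i a i *: x i) = \sum_i a i *: k (x i).
Proof.
elim/big_rec2: _ => [|i s y _ <-]; last exact: klin.
by have := klin (-1) 0 0; rewrite scaler0 addr0 scaleN1r addNr.
Qed.

Lemma isomorphic_basis : \dim {:g} = 7%N -> lie_isomorphic g h ->
  exists f : 7.-tuple g, basis_of fullv f /\
    forall i j, lie_br (tnth f i) (tnth f j) = \sum_m C i j m *: tnth f m.
Proof.
move=> dim7 [F [[G FK GK] Fbr]]; case: kbij => kV kK kVK.
pose f := [tuple G (kV (delta_mx 0 i)) | i < 7].
have kF i : k (F (tnth f i)) = delta_mx 0 i by rewrite tnth_mktuple GK kVK.
have kFsum (a : 'I_7 -> R) : k (F (\sum_i a i *: tnth f i)) = \row_i a i.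
  rewrite linear_sum /=; under eq_bigr do rewrite linearZ /=.
  rewrite ksum [RHS]row_sum_delta; apply: eq_bigr => i _.
  by rewrite kF mxE.
exists f; split.
  apply: free_basis => //; apply/freeP => a a0 i.
  have := kFsum a; under [X in F X]eq_bigr do rewrite (tnth_nth 0).
  rewrite a0 linear0 => /rowP/(_ i); rewrite mxE => <-.
  have := klin (-1) 0 0; rewrite scaler0 addr0 scaleN1r addNr => ->.
  by rewrite mxE.
move=> i j; apply: (can_inj FK); apply: (can_inj kK).
rewrite Fbr kFsum; apply/rowP => m; rewrite kbr !kF mxE.
rewrite (bigD1 i) //= [X in _ + X]big1 => [|i' ni]; last first.
  by rewrite big1 // => j' _; rewrite !mxE /= (negbTE ni) mul0r mulr0.
rewrite addr0 (bigD1 j) //= big1 => [|j' nj]; last first.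
  by rewrite !mxE /= (negbTE nj) !mulr0.
by rewrite !mxE !eqxx !mulr1 addr0.
Qed.

Lemma basis_isomorphic (f : 7.-tuple g) : basis_of fullv f ->
  (forall i j, lie_br (tnth f i) (tnth f j) = \sum_m C i j m *: tnth f m) ->
  lie_isomorphic g h.
Proof.
move=> bf fbr; case: kbij => kV kK kVK.
have kVlin : linear kV.
  by move=> t x y; apply: (can_inj kK); rewrite klin !kVK.
pose co x : 'rV[R]_7 := \row_i coord f i x.
have colin : linear co by move=> t x y; apply/rowP=> i; rewrite !mxE linearP.
have Flin : linear (kV \o co) by move=> t x y /=; rewrite colin kVlin.
pose FF := GRing.isLinear.Build _ _ _ _ (kV \o co) Flin.
pose F : {linear g -> h} := HB.pack (kV \o co) FF.
have expand x : x = \sum_i coord f i x *: tnth f i.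
  rewrite {1}(coord_basis bf (memvf x)); apply: eq_bigr => i _.
  by rewrite (tnth_nth 0).
exists F; split.
  exists (fun y => \sum_i k y 0 i *: tnth f i) => [x|y] /=.
    rewrite [RHS]expand; apply: eq_bigr => i _.
    by rewrite kVK mxE.
  apply: (can_inj kK); rewrite kVK; apply/rowP=> i; rewrite mxE.
  under eq_bigr do rewrite (tnth_nth 0).
  by rewrite coord_sum_free // (basis_free bf).
move=> x y; apply: (can_inj kK); apply/rowP=> m.
rewrite kbr /= !kVK mxE {1}(expand x) {1}(expand y).
have brs z n (a : 'I_n -> R) (u : 'I_n -> g) :
    lie_br (\sum_i a i *: u i) z = \sum_i a i *: lie_br (u i) z.
  elim/big_rec2: _ => [|i s w _ <-]; last exact: lie_brDZl.
  by have := lie_brDZl (-1) 0 0 z; rewrite scaler0 addr0 scaleN1r addNr.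
have brr z n (a : 'I_n -> R) (u : 'I_n -> g) :
    lie_br z (\sum_i a i *: u i) = \sum_i a i *: lie_br z (u i).
  elim/big_rec2: _ => [|i s w _ <-]; last exact: lie_brDZr.
  by have := lie_brDZr (-1) 0 0 z; rewrite scaler0 addr0 scaleN1r addNr.
rewrite brs linear_sum; apply: eq_bigr => i _ /=.
rewrite linearZ brr linear_sum /= mulr_sumr; apply: eq_bigr => j _.
rewrite linearZ fbr /= !mxE.
under eq_bigr do rewrite (tnth_nth 0).
by rewrite coord_sum_free ?(basis_free bf) //; ring.
Qed.

End Isomorphisms.

Definition mx_contraction (R : pzRingType) p (w : 'M[R]_p) (G : 'I_p -> 'I_p -> R) :=
  \sum_i \sum_j w i j * G i j.

Lemma mx_contractionD (R : pzRingType) p (w w' : 'M[R]_p) G :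
  mx_contraction (w + w') G = mx_contraction w G + mx_contraction w' G.
Proof.
rewrite -big_split; apply: eq_bigr => i _; rewrite -big_split.
by apply: eq_bigr => j _; rewrite mxE mulrDl.
Qed.

Lemma mx_contractionN (R : pzRingType) p (w : 'M[R]_p) G :
  mx_contraction (- w) G = - mx_contraction w G.
Proof.
rewrite -sumrN; apply: eq_bigr => i _; rewrite -sumrN.
by apply: eq_bigr => j _; rewrite mxE mulNr.
Qed.

Lemma mx_contraction_se (F : fieldType) p a b G :
  mx_contraction (se_e F p a b) G = G (inord a.-1) (inord b.-1).
Proof.
rewrite /mx_contraction (bigD1 (inord a.-1)) //= [X in _ + X]big1 => [|i ni].
  rewrite addr0 (bigD1 (inord b.-1)) //= big1 => [|j nj].
    by rewrite addr0 mxE !eqxx mul1r.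
  by rewrite mxE (negbTE nj) andbF mul0r.
by rewrite big1 // => j _; rewrite mxE (negbTE ni) mul0r.
Qed.

Definition mx_contractionE := (mx_contractionD, mx_contractionN, mx_contraction_se).

(** Here [de^7 = e^{12} - e^{34}], and in [h7_terms] it is [e^{12} + e^{34} - 2 e^{56}]: forms of
    rank 4 and 6 whose coefficients add up to zero, as [line_algebra] demands. *)
Definition r2h5_terms : seq (nat * nat * nat * Z) :=
  [:: (0, 1, 6, 1%BZ); (2, 3, 6, (-1)%BZ)]%N.
Definition h7_terms : seq (nat * nat * nat * Z) :=
  [:: (0, 1, 6, 1%BZ); (2, 3, 6, 1%BZ); (4, 5, 6, (-2)%BZ)]%N.
(** The solution [M = Id], [N = 0] in the notation of [quat_forms]. *)
Definition quat_terms : seq (nat * nat * nat * Z) :=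
  [:: (0, 2, 4, 1%BZ); (1, 3, 4, (-1)%BZ); (0, 3, 5, (-1)%BZ); (1, 2, 5, (-1)%BZ);
      (0, 1, 6, 1%BZ); (2, 3, 6, 1%BZ)]%N.
(** In the notation of [quat_forms], [M = 1/2 Id] and [N = -1/2 Id], which satisfies
    [m N = - cof N]; the common kernel in the first four directions is spanned by [e_1]. *)
Definition rn32_terms : seq (nat * nat * nat * Z) :=
  [:: (1, 3, 4, (-1)%BZ); (1, 2, 5, (-1)%BZ); (2, 3, 6, 1%BZ)]%N.

Section Targets.
Variable R : realType.

Definition terms_constants s (i j m : 'I_7) : R :=
  ev (fun=> 0) (deP (terms s) i j m).

(* [h] has a basis in which the structure equations are given by [s]. *)
Definition has_model (h : lieAlgebra R) s : Prop := exists k : h -> 'rV[R]_7,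
  [/\ linear k, bijective k & forall (x y : h) m, k (lie_br x y) 0 m
  = \sum_i \sum_j terms_constants s i j m * (k x 0 i * k y 0 j)].

Lemma model_by (h : lieAlgebra R) s (K : h -> seq R) (V : 'rV[R]_7 -> h) :
  all (fun t : nat * nat * nat * Z => (t.1.1.1 < t.1.1.2 < 7)%N) s ->
  (forall t x y i, (i < 7)%N ->
     nth 0 (K (t *: x + y)) i = t * nth 0 (K x) i + nth 0 (K y) i) ->
  (forall x, V (\row_i nth 0 (K x) i) = x) ->
  (forall v i, (i < 7)%N -> nth 0 (K (V v)) i = v 0 (inord i)) ->
  (forall (x y : h) m, (m < 7)%N -> nth 0 (K (lie_br x y)) m
    = \sum_(t <- s | t.1.2 == m)
        zr R t.2 * (nth 0 (K x) t.1.1.2 * nth 0 (K y) t.1.1.1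
                    - nth 0 (K x) t.1.1.1 * nth 0 (K y) t.1.1.2)) ->
  has_model h s.
Proof.
move=> s7 Kl KK VK Kbr; exists (fun x => \row_i nth 0 (K x) i); split.
- by move=> t x y; apply/rowP=> i; rewrite !mxE Kl.
- exists V => [x|v]; first exact: KK.
  by apply/rowP=> i; rewrite !mxE VK // inord_val.
move=> x y m; rewrite mxE Kbr //.
rewrite -(terms_sum (fun=> 0) (nth 0 (K x)) (nth 0 (K y))) //.
by apply: eq_bigr => i _; apply: eq_bigr => j _; rewrite !mxE.
Qed.

Let zr2 : (zr R 1 = 1) * (zr R (-1) = -1) * (zr R (-2) = -2%:R).
Proof. by []. Qed.

Lemma quat_model : has_model (quat_heisenberg R) quat_terms.
Proof.
pose X (x : quat_heisenberg R) i := x.1 0 (inord i : 'I_4).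
pose Z (x : quat_heisenberg R) i := x.2 0 (inord i : 'I_3).
apply: (model_by (K := fun x => [:: X x 0; X x 1; X x 2; X x 3; Z x 0; Z x 1; Z x 2]%N)
  (V := fun v => (\row_(i < 4) v 0 (inord i), \row_(i < 3) v 0 (inord (i + 4))))).
- by [].
- by move=> t x y [|[|[|[|[|[|[|//]]]]]]] _; rewrite /= /X /Z /= !mxE.
- move=> [x z]; congr (_, _); apply/rowP; rewrite /X /Z.
    by case=> [[|[|[|[|//]]]]] lti; rewrite !mxE inordK //=; congr (x _ _);
      apply: val_inj; rewrite /= inordK.
  by case=> [[|[|[|//]]]] lti; rewrite !mxE inordK //=; congr (z _ _);
    apply: val_inj; rewrite /= inordK.
- by move=> v [|[|[|[|[|[|[|//]]]]]]] _; rewrite /= /X /Z /= mxE inordK.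
move=> x y m ltm; rewrite !big_cons big_nil.
case: m ltm => [|[|[|[|[|[|[|//]]]]]]] _ /=; rewrite /X /Z /= ?mxE ?addr0 //;
  rewrite (tnth_nth 0) inordK //= -[X in - X]/(mx_contraction _ _);
  by rewrite !mx_contractionE /= !zr2; ring.
Qed.

Lemma rn32_model : has_model (lie_dsum (lie_abelian R 1) (n32 R)) rn32_terms.
Proof.
pose H := lie_dsum (lie_abelian R 1) (n32 R).
pose X (x : H) i := x.2.1 0 (inord i : 'I_3).
pose Z (x : H) i := x.2.2 0 (inord i : 'I_3).
(* The generators of [n32] take the places of [e_2], [e_3], [e_4]; its first two central coordinates
   are exchanged and change sign. *)
pose V (v : 'rV[R]_7) : H :=
  (\row_(i < 1) v 0 (inord 0), (\row_(i < 3) v 0 (inord i.+1),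
   \row_(i < 3) nth 0 [:: - v 0 (inord 5); - v 0 (inord 4); v 0 (inord 6)] i)).
apply: (@model_by H _
  (fun x => [:: x.1 0 0; X x 0; X x 1; X x 2; - Z x 1; - Z x 0; Z x 2]) V).
- by [].
- move=> t x y [|[|[|[|[|[|[|//]]]]]]] _; rewrite /= /X /Z /= !mxE //.
    by rewrite opprD mulrN.
  by rewrite opprD mulrN.
- move=> [a [x z]]; congr (_, (_, _)); apply/rowP; rewrite /X /Z.
  - by move=> i; rewrite !mxE ord1 inordK.
  - by case=> [[|[|[|//]]]] lti; rewrite !mxE inordK //=; congr (x _ _);
      apply: val_inj; rewrite /= inordK.
  by case=> [[|[|[|//]]]] lti; rewrite !mxE /= ?mxE !inordK //= ?opprK;
    congr (z _ _); apply: val_inj; rewrite /= inordK.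
- by move=> v [|[|[|[|[|[|[|//]]]]]]] _; rewrite /= /X /Z /V /= !mxE ?inordK //= ?opprK.
move=> x y m ltm; rewrite !big_cons big_nil.
case: m ltm => [|[|[|[|[|[|[|//]]]]]]] _ /=; rewrite /X /Z /= ?mxE ?addr0 //;
  rewrite (tnth_nth 0) inordK //= -[\sum_i _]/(mx_contraction _ _);
  by rewrite !mx_contractionE /= !zr2; ring.
Qed.

Let heis_sum p (G : 'I_p.+1 -> 'I_p.+1 -> R) (w : 'M[R]_p.+1) s :
  (forall i j : 'I_p.+1, w i j = ((val i, val j) \in s)%:R) -> uniq s ->
  all (fun t => (t.1 <= p) && (t.2 <= p))%N s ->
  \sum_i \sum_j w i j * G i j = \sum_(t <- s) G (inord t.1) (inord t.2).
Proof.
elim: s w => [|[a b] s IHs] w wE; first by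
  rewrite big_nil => _ _; rewrite big1 // => i _; rewrite big1 // => j _;
  rewrite wE mul0r.
rewrite big_cons /= => /andP[nab us] /andP[/andP[lea leb] sp].
rewrite -(IHs (\matrix_(i, j) ((val i, val j) \in s)%:R)) // => [|i j];
  last by rewrite mxE.
rewrite -(mx_contraction_se (F := R) (p := p) a.+1 b.+1 G) /mx_contraction -big_split.
apply: eq_bigr => i _; rewrite -big_split; apply: eq_bigr => j _ /=.
rewrite -mulrDl wE !mxE; congr (_ * _); rewrite inE xpair_eqE.
rewrite -!val_eqE /= !inordK // -natrD.
by case: eqP => [->|_] //=; case: eqP => [->|_] //=; rewrite (negbTE nab).
Qed.

Lemma h7_model : has_model (heisenberg R 3) h7_terms.
Proof.
pose X (x : heisenberg R 3) i := x.1 0 (inord i : 'I_6).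
(* Rescaling the sixth coordinate by [-1/2] turns the term [e^{56}] into [-2 e^{56}]. *)
pose V (v : 'rV[R]_7) : heisenberg R 3 :=
  (\row_(i < 6) (if i == 5%N :> nat then - 2 * v 0 (inord 5) else v 0 (inord i)),
   \row_(i < 1) v 0 (inord 6)).
apply: (@model_by (heisenberg R 3) _
  (fun x => [:: X x 0; X x 1; X x 2; X x 3; X x 4; - 2^-1 * X x 5; x.2 0 0]) V).
- by [].
- move=> t x y [|[|[|[|[|[|[|//]]]]]]] _; rewrite /= /X /= !mxE //.
  by ring.
- move=> [x z]; congr (_, _); apply/rowP; rewrite /X.
    case=> [[|[|[|[|[|[|//]]]]]]] lti; rewrite !mxE /= ?mxE inordK //=;
      rewrite ?mulrA ?mulrNN ?mulfV ?mul1r ?pnatr_eq0 //;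
      congr (x _ _); by apply: val_inj; rewrite /= inordK.
  by move=> i; rewrite !mxE inordK //= ord1.
- move=> v [|[|[|[|[|[|[|//]]]]]]] _; rewrite /= /X /V /= !mxE ?inordK //=.
  by rewrite mulrA mulrNN mulVf ?mul1r // pnatr_eq0.
move=> x y m ltm; rewrite !big_cons big_nil.
case: m ltm => [|[|[|[|[|[|[|//]]]]]]] _ /=; rewrite /X /= ?mxE ?addr0 ?mulr0 //.
rewrite (@heis_sum 5 _ _ [:: (0, 1); (2, 3); (4, 5)]%N) //.
  by rewrite !big_cons big_nil /= !zr2; field.
case=> [[|[|[|[|[|[|//]]]]]]] ?; case=> [[|[|[|[|[|[|//]]]]]]] ?; by rewrite mxE.
Qed.

Lemma r2h5_model :
  has_model (lie_dsum (lie_abelian R 2) (heisenberg R 2)) r2h5_terms.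
Proof.
pose H := lie_dsum (lie_abelian R 2) (heisenberg R 2).
pose X (x : H) i := x.2.1 0 (inord i : 'I_4).
pose A (x : H) i := x.1 0 (inord i : 'I_2).
pose C (x : H) := x.2.2 0 (0 : 'I_1).
(* Exchanging the third and fourth coordinates changes the sign of [e^{34}]. *)
pose V (v : 'rV[R]_7) : H :=
  (\row_(i < 2) v 0 (inord (i + 4)),
   (\row_(i < 4) v 0 (inord (nth 0%N [:: 0; 1; 3; 2]%N i)),
    \row_(i < 1) v 0 (inord 6))).
apply: (@model_by H _
  (fun x => [:: X x 0; X x 1; X x 3; X x 2; A x 0; A x 1; C x]%N) V).
- by [].
- by move=> t x y [|[|[|[|[|[|[|//]]]]]]] _; rewrite /= /X /A /C /= !mxE.
- move=> [a [x z]]; congr (_, (_, _)); apply/rowP; rewrite /X /A /C.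
  - by case=> [[|[|//]]] lti; rewrite !mxE inordK //=; congr (a _ _);
      apply: val_inj; rewrite /= inordK.
  - by case=> [[|[|[|[|//]]]]] lti; rewrite !mxE inordK //=; congr (x _ _);
      apply: val_inj; rewrite /= inordK.
  by move=> i; rewrite !mxE inordK //= ord1.
- by move=> v [|[|[|[|[|[|[|//]]]]]]] _; rewrite /= /X /A /C /V /= !mxE ?inordK.
move=> x y m ltm; rewrite !big_cons big_nil.
case: m ltm => [|[|[|[|[|[|[|//]]]]]]] _ /=; rewrite /X /A /C /= ?mxE ?addr0 //.
rewrite (@heis_sum 3 _ _ [:: (0, 1); (2, 3)]%N) //.
  by rewrite !big_cons big_nil /= !zr2; ring.
case=> [[|[|[|[|//]]]]] ?; case=> [[|[|[|[|//]]]]] ?; by rewrite mxE.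
Qed.

End Targets.

Definition coclosed_check (c : nat -> nat -> nat -> poly) : bool :=
  let br := bracketP c in all (fun l => nilp (ce_dP br 3 psiZ l)) (tuples 7 5).

Definition instanton_check (c : nat -> nat -> nat -> poly) : bool :=
  let A := conn_tableP c in
  all (fun l => if l is [:: m; u; v] then nilp (instP c A m u v) else true)
    (tuples 7 3).

Lemma r2h5_checks :
  coclosed_check (deP (terms r2h5_terms)) && instanton_check (deP (terms r2h5_terms)).
Proof. by vm_compute. Qed.

Lemma h7_checks :
  coclosed_check (deP (terms h7_terms)) && instanton_check (deP (terms h7_terms)).
Proof. by vm_compute. Qed.

Lemma quat_checks :
  coclosed_check (deP (terms quat_terms)) && instanton_check (deP (terms quat_terms)).
Proof. by vm_compute. Qed.

Lemma rn32_checks :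
  coclosed_check (deP (terms rn32_terms)) && instanton_check (deP (terms rn32_terms)).
Proof. by vm_compute. Qed.

Lemma model_instanton (R : realType) (g h : lieAlgebra R) s :
  \dim {:g} = 7%N -> has_model h s ->
  coclosed_check (deP (terms s)) && instanton_check (deP (terms s)) ->
  lie_isomorphic g h -> has_instanton g.
Proof.
move=> dim7 [k [klin kbij kbr]] /andP[cc ic] iso.
have [f [bf fbr]] := isomorphic_basis klin kbij kbr dim7 iso.
(* The structure constants of a model are numbers, so its equations have no variables and must
   reduce to [[::]]. *)
apply: (exists_solution dim7 bf (env := fun=> 0) (c := deP (terms s))).
- move=> i j m; rewrite fbr; under eq_bigr do rewrite (tnth_nth 0).
  by rewrite coord_sum_free // (basis_free bf).
- by move=> J; have /nilP -> := all_tuples cc J.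
by move=> m u v; have /nilP -> := all_tuples ic [tuple m; u; v].
Qed.

(** * Adapted G2-frames *)

Section Cross.
Variables (R : realType) (g : lieAlgebra R) (phi : kform g 3).
Variables (met : g -> g -> R) (f : 7.-tuple g).
Hypotheses (dim7 : \dim {:g} = 7%N) (ip : inner_product met).
Hypotheses (mphi : multilinear phi) (aphi : alternating phi).
Hypotheses (onf : orthonormal_tuple met f) (rphi : repZ f phi phiZ).

Definition cross (x y : g) : g := \sum_k phi [tuple x; y; tnth f k] *: tnth f k.

Lemma phi0r x y : phi [tuple x; y; 0] = 0.
Proof.
by have := torsionDr mphi (-1) 0 0 x y; rewrite scaler0 addr0 mulN1r addNr.
Qed.

Lemma met_cross x y z : met (cross x y) z = phi [tuple x; y; z].
Proof.
rewrite /cross (met_suml ip) [in RHS](orthonormal_expand ip dim7 onf z).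
transitivity (\sum_k met z (tnth f k) * phi [tuple x; y; tnth f k]).
  by apply: eq_bigr => k _; rewrite (metZl ip) (metC ip) mulrC.
elim/big_rec2: _ => [|i a u _ ->]; first by rewrite phi0r.
by rewrite (torsionDr mphi).
Qed.

Lemma phi_swap12 x y z : phi [tuple y; x; z] = - phi [tuple x; y; z].
Proof.
have E a : phi [tuple a; a; z] = 0.
  exact: (aphi (i := ord0) (j := lift ord0 ord0)).
have l a b c d : phi [tuple a + b; c; d] = phi [tuple a; c; d] + phi [tuple b; c; d].
  by have := torsionDl mphi 1 a b c d; rewrite scale1r mul1r.
have m a b c d : phi [tuple c; a + b; d] = phi [tuple c; a; d] + phi [tuple c; b; d].
  by have := torsionDm mphi 1 a b c d; rewrite scale1r mul1r.
have := E (x + y); rewrite l !m !E add0r addr0 => /eqP.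
by rewrite addrC addr_eq0 => /eqP.
Qed.

Lemma phi_swap23 x y z : phi [tuple x; z; y] = - phi [tuple x; y; z].
Proof.
have E a : phi [tuple x; a; a] = 0.
  exact: (aphi (i := lift ord0 ord0) (j := ord_max)).
have l a b c d : phi [tuple c; d; a + b] = phi [tuple c; d; a] + phi [tuple c; d; b].
  by have := torsionDr mphi 1 a b c d; rewrite scale1r mul1r.
have m a b c d : phi [tuple c; a + b; d] = phi [tuple c; a; d] + phi [tuple c; b; d].
  by have := torsionDm mphi 1 a b c d; rewrite scale1r mul1r.
have := E (y + z); rewrite l !m !E add0r addr0 => /eqP.
by rewrite addr_eq0 => /eqP.
Qed.

Lemma crossC x y : cross y x = - cross x y.
Proof.
by apply: (met_inj ip) => z; rewrite (metNl ip) !met_cross phi_swap12.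
Qed.

Lemma crossxx x : cross x x = 0.
Proof.
have /eqP := crossC x x; rewrite -addr_eq0 -mulr2n -scaler_nat scaler_eq0.
by rewrite pnatr_eq0 => /eqP.
Qed.

Lemma crossDZl t x y z : cross (t *: x + y) z = t *: cross x z + cross y z.
Proof.
by apply: (met_inj ip) => w; rewrite (metDZl ip) !met_cross (torsionDl mphi).
Qed.

Lemma crossDZr t x y z : cross z (t *: x + y) = t *: cross z x + cross z y.
Proof.
by apply: (met_inj ip) => w; rewrite (metDZl ip) !met_cross (torsionDm mphi).
Qed.

Lemma crossNl x y : cross (- x) y = - cross x y.
Proof.
have := crossDZl (-1) x 0 y; rewrite !scaleN1r addr0 => ->.
have := crossDZl (-1) 0 0 y; rewrite !scaleN1r addr0 oppr0 addNr => ->.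
by rewrite addr0.
Qed.

Lemma crossNr x y : cross y (- x) = - cross y x.
Proof. by rewrite crossC crossNl -crossC. Qed.

(** The octonionic identity [x (x z) = - |x|^2 z + <x, z> x], polarised. Paired with [w] it is
    linear in four vectors, so [cross_check] settles it on the frame. *)
Lemma cross_cross x y z : cross x (cross y z) + cross y (cross x z)
  = (- 2 * met x y) *: z + met x z *: y + met y z *: x.
Proof.
apply: (met_inj ip) => w; rewrite !(metDl ip) !(metZl ip) !met_cross.
pose a : kform g 4 := fun v => let u (i : nat) := tnth v (inord i) in
  phi [tuple u 0; cross (u 1) (u 2); u 3] + phi [tuple u 1; cross (u 0) (u 2); u 3].
pose b : kform g 4 := fun v => let u (i : nat) := tnth v (inord i) in
  - 2 * met (u 0) (u 1) * met (u 2) (u 3) + met (u 0) (u 2) * met (u 1) (u 3)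
  + met (u 1) (u 2) * met (u 0) (u 3).
have bigI (P : 'I_4 -> Prop) : P (inord 0) -> P (inord 1) -> P (inord 2) ->
    P (inord 3) -> forall i, P i.
  move=> p0 p1 p2 p3 i; rewrite -(inord_val i).
  by case: i => [] [|[|[|[|//]]]].
have ma : multilinear a.
  move=> v i t p q; rewrite /a !tnth_tset.
  by elim/bigI: i; rewrite -!val_eqE /= !inordK //=;
    rewrite ?(crossDZl, crossDZr) ?(torsionDl mphi) ?(torsionDm mphi)
      ?(torsionDr mphi); ring.
have mb : multilinear b.
  move=> v i t p q; rewrite /b !tnth_tset.
  by elim/bigI: i; rewrite -!val_eqE /= !inordK //=;
    rewrite ?(metDZl ip, metDZr ip); ring.
have tn (i : nat) : tnth [tuple x; y; z; w] (inord i)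
      = nth 0 [:: x; y; z; w] (inord i : 'I_4).
  exact: (tnth_nth 0).
suff: a [tuple x; y; z; w] = b [tuple x; y; z; w].
  by rewrite /a /b !tn !inordK.
apply: (multilinear_eq (basis_span (orthonormal_basis ip dim7 onf))) => // I.
rewrite /a /b !tnth_map !onf; case/tupleP: I => i I; case/tupleP: I => j I.
case/tupleP: I => k I; case/tupleP: I => m I; rewrite (tuple0 I) {I}.
rewrite !(tnth_nth ord0) !inordK //=.
have phif p q r : phi [tuple tnth f p; tnth f q; tnth f r]
    = zr R (phiZ [:: val p; val q; val r]).
  by rewrite -[RHS](rphi [tuple p; q; r]); congr phi; apply: val_inj.
have phic p q r s :
    phi [tuple tnth f p; cross (tnth f q) (tnth f r); tnth f s]
    = zr R (zsum [seq Z.mul (phiZ [:: val q; val r; n]) (phiZ [:: val p; n; val s])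
                 | n <- iota 0 7]).
  rewrite zr_sum big_map big_iota_ord /cross.
  elim/big_rec2: _ => [|n c u _ <-].
    by have := torsionDm mphi (-1) 0 0 (tnth f p) (tnth f s);
      rewrite scaler0 addr0 mulN1r addNr.
  by rewrite (torsionDm mphi) !phif zrM.
have /Z.eqb_spec := all_tuples cross_check [tuple i; j; k; m].
move/(congr1 (zr R)); rewrite !phic -zrD => ->; rewrite !zrD.
have zif (bb : bool) (c : Z) : zr R (if bb then c else 0%BZ) = bb%:R * zr R c.
  by case: bb; rewrite ?mul1r ?mul0r.
by rewrite !zif zr1 !val_eqE -!mulnb !natrM (_ : zr R (-2) = -2) //; ring.
Qed.

Lemma cross_sq x z : met x x = 1 -> cross x (cross x z) = - z + met x z *: x.
Proof.
move=> x1; have := cross_cross x x z; rewrite x1 mulr1 -!mulr2n => E.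
apply: (@scalerI R g 2%:R); first by rewrite pnatr_eq0.
by rewrite scalerDr scalerN !scaler_nat E scaleNr scaler_nat -addrA -mulr2n.
Qed.

Lemma cross_swap x y z : met x y = 0 ->
  cross x (cross y z) = - cross y (cross x z) + met x z *: y + met y z *: x.
Proof.
move=> xy; have := cross_cross x y z; rewrite xy mulr0 scale0r add0r => E.
by rewrite -addrA -E addrC addrK.
Qed.

End Cross.

Section AdaptedFrame.
Variables (R : realType) (g : lieAlgebra R) (phi : kform g 3).
Variables (met : g -> g -> R) (f : 7.-tuple g).
Hypotheses (dim7 : \dim {:g} = 7%N) (ip : inner_product met).
Hypotheses (mphi : multilinear phi) (aphi : alternating phi).
Hypotheses (onf : orthonormal_tuple met f) (rphi : repZ f phi phiZ).

Notation cross := (cross phi f).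
Let met_cross := met_cross dim7 ip mphi onf.
Let phi_swap12 := phi_swap12 mphi aphi.
Let phi_swap23 := phi_swap23 mphi aphi.
Let crossC := crossC dim7 ip mphi aphi onf.
Let crossxx := crossxx dim7 ip mphi aphi onf.
Let crossNr := crossNr dim7 ip mphi aphi onf.
Let cross_sq := cross_sq dim7 ip mphi onf rphi.
Let cross_swap := cross_swap dim7 ip mphi onf rphi.

Variables x y w : g.
Hypotheses (x1 : met x x = 1) (y1 : met y y = 1) (w1 : met w w = 1).
Hypotheses (xy : met x y = 0) (wx : met w x = 0) (wy : met w y = 0).
Hypothesis wz : met w (cross x y) = 0.

Definition adapted_frame : 7.-tuple g := let z := cross x y in
  [tuple - cross w y; - cross w x; cross w z; w; x; y; z].

(** Cayley-Dickson doubling: [x], [y] and [z = x * y] multiply like imaginary quaternions, and [w]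
    is a unit vector orthogonal to them. The two rules [cross_sq] and [cross_swap] then give the
    whole multiplication table, and [phi(a, b, c) = <a * b, c>]. *)
Lemma adapted_frame_rep : repZ adapted_frame phi phiZ.
Proof.
pose z := cross x y; pose v3 := cross w z.
pose v2 := - cross w x; pose v1 := - cross w y.
have mC := metC ip; have cC := crossC.
have met3 a b c : met (cross a b) c = met a (cross b c).
  by rewrite (mC a) !met_cross phi_swap12 phi_swap23 phi_swap12 -phi_swap23 opprK.
have met1 a b : met (cross a b) a = 0.
  by rewrite mC -met3 crossxx (met0l ip).
have met2 a b : met (cross a b) b = 0 by rewrite met3 crossxx (met0r ip).
have cxy : cross x y = z by [].
have cxz : cross x z = - y by rewrite cross_sq // xy scale0r addr0.
have cyz : cross y z = x.
  by rewrite /z (cC y x) crossNr cross_sq // (mC y) xy scale0r addr0 opprK.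
have zx : met z x = 0 by exact: met1.
have zy : met z y = 0 by exact: met2.
have yx : met y x = 0 by rewrite mC.
have zw : met z w = 0 by rewrite mC.
have z1 : met z z = 1 by rewrite {1}/z met3 cyz.
have xw : met x w = 0 by rewrite mC.
have yw : met y w = 0 by rewrite mC.
have xz : met x z = 0 by rewrite mC.
have yz : met y z = 0 by rewrite mC.
have cwx : cross w x = - v2 by rewrite opprK.
have cwy : cross w y = - v1 by rewrite opprK.
have cwz : cross w z = v3 by [].
have cww a : met w a = 0 -> cross w (cross w a) = - a.
  by move=> wa; rewrite cross_sq // wa scale0r addr0.
have cw1 : cross w v1 = y by rewrite crossNr cww ?opprK.
have cw2 : cross w v2 = x by rewrite crossNr cww ?opprK.
have cw3 : cross w v3 = - z by rewrite cww.
(* The doubling rule, from which most of the remaining products are read off. *)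
have caw a b : met a w = 0 -> met w b = 0 ->
    cross a (cross w b) = - cross w (cross a b) + met a b *: w.
  by move=> aw wb; rewrite cross_swap // wb scale0r addr0.
have c0 a : cross a 0 = 0 by have := crossNr 0 a; rewrite oppr0 => /eqP;
  rewrite -addr_eq0 -mulr2n -scaler_nat scaler_eq0 pnatr_eq0 => /eqP.
have cx1 : cross x v1 = v3 by rewrite crossNr caw // xy scale0r addr0 opprK.
have cx2 : cross x v2 = - w.
  by rewrite crossNr caw // crossxx c0 x1 scale1r oppr0 add0r.
have cy1 : cross y v1 = - w.
  by rewrite crossNr caw // crossxx c0 y1 scale1r oppr0 add0r.
have cy2 : cross y v2 = - v3.
  by rewrite crossNr caw // yx scale0r addr0 opprK (cC x) crossNr.
have cz3 : cross z v3 = w.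
  by rewrite caw // crossxx c0 z1 scale1r oppr0 add0r.
have czy : cross z y = - x by rewrite cC cyz.
have czx : cross z x = y by rewrite cC cxz opprK.
have cz1 : cross z v1 = v2.
  by rewrite crossNr caw // zy scale0r addr0 opprK czy crossNr.
have cz2 : cross z v2 = - v1.
  by rewrite crossNr caw // zx scale0r addr0 opprK czx cwy.
have cx3 : cross x v3 = - v1.
  by rewrite caw // xz scale0r addr0 cxz crossNr opprK cwy.
have cy3 : cross y v3 = v2.
  by rewrite caw // yz scale0r addr0 cyz.
have mwab a b : met (cross w a) b = met w (cross a b) by [].
have m1w : met v1 w = 0 by rewrite (metNl ip) met1 oppr0.
have m2w : met v2 w = 0 by rewrite (metNl ip) met1 oppr0.
have m3w : met v3 w = 0 by rewrite met1.
have m1x : met v1 x = 0 by rewrite (metNl ip) met3 (cC x) (metNr ip) wz !oppr0.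
have m1y : met v1 y = 0 by rewrite (metNl ip) met2 oppr0.
have m1z : met v1 z = 0 by rewrite (metNl ip) met3 cyz wx oppr0.
have m2x : met v2 x = 0 by rewrite (metNl ip) met2 oppr0.
have m2y : met v2 y = 0 by rewrite (metNl ip) met3 wz oppr0.
have m2z : met v2 z = 0 by rewrite (metNl ip) met3 cxz (metNr ip) wy !oppr0.
have m3x : met v3 x = 0 by rewrite met3 czx.
have m3y : met v3 y = 0 by rewrite met3 czy (metNr ip) wx oppr0.
have m3z : met v3 z = 0 by rewrite met2.
have mww a b : met a w = 0 -> met w b = 0 ->
    met (cross w a) (cross w b) = met a b.
  move=> aw wb; rewrite met3 caw // (metDr ip) (metNr ip) (metZr ip) w1 mulr1.
  by rewrite (mC w (cross w _)) met1 oppr0 add0r.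
have m11 : met v1 v1 = 1 by rewrite (metNl ip) (metNr ip) opprK mww.
have m22 : met v2 v2 = 1 by rewrite (metNl ip) (metNr ip) opprK mww.
have m33 : met v3 v3 = 1 by rewrite mww.
have m12 : met v1 v2 = 0 by rewrite (metNl ip) (metNr ip) opprK mww.
have m13 : met v1 v3 = 0 by rewrite (metNl ip) mww // yz oppr0.
have m23 : met v2 v3 = 0 by rewrite (metNl ip) mww // xz oppr0.
have c12 : cross v1 v2 = z.
  rewrite cC crossNr opprK cross_swap // wy scale0r addr0 m2y scale0r addr0.
  by rewrite (cC y) cy2 opprK cw3 opprK.
have c13 : cross v1 v3 = x.
  rewrite cross_swap // wz scale0r addr0 m1z scale0r addr0.
  by rewrite (cC z) cz1 crossNr opprK cw2.
have c23 : cross v2 v3 = - y.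
  rewrite cross_swap // wz scale0r addr0 m2z scale0r addr0.
  by rewrite (cC z) cz2 opprK cw1.
have cE := (c12, c13, c23, cw1, cw2, cw3, cx1, cx2, cx3, cy1, cy2, cy3, cz1, cz2,
  cz3, cwx, cwy, cwz, cxy, cxz, cyz, czx, czy).
pose v := adapted_frame.
have vE (i : 'I_7) : tnth v i = nth 0 [:: v1; v2; v3; w; x; y; z] i.
  exact: (tnth_nth 0).
have mE := (m11, m12, m13, m1w, m1x, m1y, m1z, (m22, m23, m2w, m2x, m2y, m2z),
  (m33, m3w, m3x, m3y, m3z), (w1, wx, wy, wz), (x1, xy, xz), (y1, yz), z1).
have onv i j : met (tnth v i) (tnth v j) = (i == j)%:R.
  have le (p q : 'I_7) : (p <= q)%N -> met (tnth v p) (tnth v q) = (p == q)%:R.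
    rewrite !vE; case: p => [] [|[|[|[|[|[|[|//]]]]]]] ?;
      case: q => [] [|[|[|[|[|[|[|//]]]]]]] ? //= _;
      by rewrite mE.
  case: (leqP i j) => [|/ltnW] /le // E.
  by rewrite mC E eq_sym.
have crossE i j : cross (tnth v i) (tnth v j)
    = \sum_m zr R (phiZ [:: val i; val j; val m]) *: tnth v m.
  have zrE : (zr R 1 = 1) * (zr R (-1) = -1) * (zr R 0 = 0) by [].
  have lt (p q : 'I_7) : (p <= q)%N -> cross (tnth v p) (tnth v q)
      = \sum_m zr R (phiZ [:: val p; val q; val m]) *: tnth v m.
    under eq_bigr do rewrite vE; rewrite !vE.
    case: p => [] [|[|[|[|[|[|[|//]]]]]]] ?;
      case: q => [] [|[|[|[|[|[|[|//]]]]]]] ? //= _;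
      rewrite !big_ord_recl big_ord0 /= /phiZ /= !zrE
        ?(scale0r, scale1r, scaleN1r, add0r, addr0) ?crossxx //;
      by rewrite cC cE ?opprK.
  case: (leqP i j) => [|/ltnW] /lt // E.
  rewrite cC E -sumrN; apply: eq_bigr => m _; rewrite -scaleNr -zrN.
  by have /Z.eqb_spec <- := all_tuples phi_antisym12_check [tuple i; j; m].
move=> J; case/tupleP: J => i J; case/tupleP: J => j J; case/tupleP: J => k J.
rewrite (tuple0 J) {J}.
transitivity (phi [tuple tnth v i; tnth v j; tnth v k]).
  by congr phi; apply: val_inj.
rewrite -met_cross crossE (met_suml ip) (bigD1 k) //= big1 => [|m nmk].
  by rewrite addr0 (metZl ip) onv eqxx mulr1.
by rewrite (metZl ip) onv (negbTE nmk) mulr0.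
Qed.

End AdaptedFrame.

(** * The derived algebra *)

Section Derived.
Variables (R : realType) (g : lieAlgebra R).
Hypotheses (dim7 : \dim {:g} = 7%N) (hnil : two_step_nilpotent g).

Lemma lie_brC (x y : g) : lie_br y x = - lie_br x y.
Proof.
have := lie_brxx (x + y).
have := lie_brDZl 1 x y (x + y); rewrite !scale1r => ->.
have := lie_brDZr 1 x y x; have := lie_brDZr 1 x y y.
rewrite !scale1r => -> ->; rewrite !lie_brxx add0r addr0.
by move/eqP; rewrite addrC addr_eq0 => /eqP.
Qed.

Lemma lie_br_sumr (z : g) n (a : 'I_n -> R) (u : 'I_n -> g) :
  lie_br z (\sum_i a i *: u i) = \sum_i a i *: lie_br z (u i).
Proof.
elim/big_rec2: _ => [|i s w _ <-]; last exact: lie_brDZr.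
by have := lie_brDZr (-1) 0 0 z; rewrite scaler0 addr0 scaleN1r addNr.
Qed.

Lemma lie_br_suml (z : g) n (a : 'I_n -> R) (u : 'I_n -> g) :
  lie_br (\sum_i a i *: u i) z = \sum_i a i *: lie_br (u i) z.
Proof.
rewrite lie_brC lie_br_sumr -sumrN; apply: eq_bigr => i _.
by rewrite -scalerN -lie_brC.
Qed.

Lemma lie_brZr t (x z : g) : lie_br z (t *: x) = t *: lie_br z x.
Proof. by have := lie_br_sumr z (fun _ : 'I_1 => t) (fun=> x); rewrite !big_ord1. Qed.

Lemma lie_brZl t (x z : g) : lie_br (t *: x) z = t *: lie_br x z.
Proof. by have := lie_br_suml z (fun _ : 'I_1 => t) (fun=> x); rewrite !big_ord1. Qed.

Lemma lie_brDl (x y z : g) : lie_br (x + y) z = lie_br x z + lie_br y z.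
Proof. by have := lie_brDZl 1 x y z; rewrite !scale1r. Qed.

Lemma lie_brDr (x y z : g) : lie_br z (x + y) = lie_br z x + lie_br z y.
Proof. by have := lie_brDZr 1 x y z; rewrite !scale1r. Qed.

Definition derived_gens : seq g :=
  [seq lie_br x y | x <- vbasis {:g}, y <- vbasis {:g}].

Definition derived : {vspace g} := <<derived_gens>>%VS.

Lemma derivedP (P : g -> Prop) : P 0 ->
  (forall t x y, P x -> P y -> P (t *: x + y)) ->
  (forall x y, P (lie_br x y)) -> forall u, u \in derived -> P u.
Proof.
move=> P0 Plin Pbr u Uu.
have -> : u = \sum_i coord (in_tuple derived_gens) i u *: derived_gens`_i.
  exact: coord_span.
elim/big_rec: _ => // i y _; apply: Plin.
have: derived_gens`_i \in derived_gens by apply: mem_nth.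
by case/allpairsP => -[a b] [_ _ ->].
Qed.

Lemma br_derived (x y : g) : lie_br x y \in derived.
Proof.
rewrite (coord_vbasis (memvf x)) (coord_vbasis (memvf y)).
rewrite lie_br_suml memv_suml // => i _; rewrite memvZ //.
rewrite lie_br_sumr memv_suml // => j _; rewrite memvZ //.
by apply/memv_span/allpairs_f; apply: mem_nth; rewrite size_tuple.
Qed.

Lemma derived_central (u x : g) : u \in derived -> lie_br x u = 0.
Proof.
move: u; apply: derivedP => [|t u v u0 v0|a b]; last exact: hnil.2.
  by have := lie_brDZr (-1) 0 0 x; rewrite scaler0 addr0 scaleN1r addNr.
by rewrite lie_brDZr u0 v0 scaler0 addr0.
Qed.

Lemma derived_central' (u x : g) : u \in derived -> lie_br u x = 0.
Proof. by move=> /derived_central E; rewrite lie_brC E oppr0. Qed.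

Lemma derived_sub (W : {vspace g}) :
  (forall x y : g, lie_br x y \in W) -> (derived <= W)%VS.
Proof. by move=> brW; apply/span_subvP => _ /allpairsP[-[a b] [_ _ ->]]. Qed.

Lemma dim_derived_gt0 : (0 < \dim derived)%N.
Proof.
rewrite lt0n dimv_eq0; apply/eqP => d0; have [[x [y nz]] _] := hnil.
by apply: nz; apply/eqP; rewrite -memv0 -d0 br_derived.
Qed.

(* A complement of dimension at most 3 produces at most 3 brackets. *)
Lemma dim_derived_le3 : (\dim derived <= 3)%N.
Proof.
rewrite leqNgt; apply/negP => gt3.
pose c := vbasis derived^C; pose d i := c`_i.
have dimc : (\dim derived^C <= 3)%N.
  by rewrite dimv_compl dim7 leq_subLR; apply: (leq_trans _ (leq_add gt3 (leqnn 3))).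
have d0 (i : nat) : (3 <= i)%N -> d i = 0.
  by move=> le3i; rewrite /d nth_default // size_tuple (leq_trans dimc).
pose W := <<[:: lie_br (d 0%N) (d 1%N); lie_br (d 0%N) (d 2%N); lie_br (d 1%N) (d 2%N)]>>%VS.
have: (derived <= W)%VS.
  apply: derived_sub => x y.
  have red z : exists a : nat -> R, exists2 u, u \in derived &
      z = u + (a 0%N *: d 0%N + a 1%N *: d 1%N + a 2%N *: d 2%N).
    have: z \in (derived + derived^C)%VS by rewrite addv_complf memvf.
    case/memv_addP => u Uu [v Cv ->].
    exists (fun i => if insub i is Some j then coord c j v else 0); exists u => //.
    congr (_ + _); rewrite {1}(coord_vbasis Cv).
    transitivity (\sum_(i < \dim derived^C)
      (fun i : nat => (if insub i is Some j then coord c j v else 0) *: d i) i).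
      by apply: eq_bigr => i _; rewrite valK.
    rewrite (big_ord_widen 3 (fun i : nat =>
      (if insub i is Some j then coord c j v else 0) *: d i)) // big_mkcond.
    rewrite !big_ord_recl big_ord0 /= addr0 addrA.
    have z0 i : (if (i < \dim derived^C)%N then
        (if insub i is Some j then coord c j v else 0) *: d i else 0)
      = (if insub i is Some j then coord c j v else 0) *: d i.
      by case: ifP => // /negbT; rewrite -leqNgt => lei;
        rewrite /d nth_default ?scaler0 // size_tuple.
    by rewrite !z0.
  have [a [u Uu ->]] := red x; have [b [v Uv ->]] := red y.
  rewrite lie_brDl (derived_central' _ Uu) add0r lie_brDr (derived_central _ Uv) add0r.
  have m i j : (i < 3)%N -> (j < 3)%N -> lie_br (d i) (d j) \in W.
    move=> lti ltj; wlog ltij : i j lti ltj / (i < j)%N.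
      move=> H; case: (ltngtP i j) => [/H -> //|/H Hji|->].
        by rewrite lie_brC memvN Hji.
      by rewrite lie_brxx mem0v.
    apply: memv_span; rewrite !inE.
    by case: i j lti ltj ltij => [|[|[|//]]] [|[|[|//]]] // _ _ _; rewrite eqxx ?orbT.
  by rewrite !lie_brDl !lie_brDr !(lie_brZl, lie_brZr) !memvD ?memvZ ?m.
move/dimvS; apply/negP; rewrite -ltnNge (leq_trans _ gt3) //.
exact: (leq_ltn_trans (dim_span _)).
Qed.

Variable met : g -> g -> R.
Hypothesis ip : inner_product met.

(** Such a [u] is orthogonal to the whole derived algebra, in particular to itself. *)
Lemma derived_nondegenerate u : u \in derived ->
  (forall x y, met (lie_br x y) u = 0) -> u = 0.
Proof.
move=> Uu u0; apply: (met_eq0 ip).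
apply: (derivedP (P := fun z => met z u = 0)) Uu => // [|t x y Ex Ey].
  exact: met0l.
by rewrite (metDZl ip) Ex Ey mulr0 addr0.
Qed.

(** Fewer linear conditions than dimensions leave a nonzero solution, which is then normalised. *)
Lemma unit_perp (W : {vspace g}) (s : seq g) : (size s < \dim W)%N ->
  exists w, [/\ w \in W, met w w = 1 & forall u, u \in s -> met w u = 0].
Proof.
move=> szW.
pose L (x : g) : 'rV[R]_(size s) := \row_i met x s`_i.
have Llin : linear L by move=> c x y; apply/rowP=> i; rewrite !mxE (metDZl ip).
pose LL := GRing.isLinear.Build _ _ _ _ L Llin.
pose Lf : {linear g -> 'rV[R]_(size s)} := HB.pack L LL.
have: (0 < \dim (W :&: lker (linfun Lf)))%N.
  rewrite -(ltn_add2r (\dim (linfun Lf @: W))) limg_ker_dim add0n.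
  apply: leq_ltn_trans szW; apply: (leq_trans (dimvS (subvf _))).
  by rewrite dimvf /dim /= mul1n.
rewrite lt0n dimv_eq0 => nz.
pose x := vpick (W :&: lker (linfun Lf)).
have nzx : x != 0 by rewrite vpick0.
have /memv_capP[Wx] : x \in (W :&: lker (linfun Lf))%VS by apply: memv_pick.
rewrite memv_ker lfunE /= => /eqP/rowP Lx.
have x_gt0 := met_gt0 ip nzx; pose r := Num.sqrt (met x x).
have r_gt0 : 0 < r by rewrite sqrtr_gt0.
have r2 : r ^+ 2 = met x x by rewrite sqr_sqrtr // ltW.
exists (r^-1 *: x); split; first exact: memvZ.
  rewrite (metZl ip) (metZr ip) -r2 mulrA -expr2 exprVn mulVf //.
  by rewrite expf_neq0 ?gt_eqF.
move=> u us; rewrite (metZl ip).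
have lti : (index u s < size s)%N by rewrite index_mem.
by have := Lx (Ordinal lti); rewrite !mxE /= nth_index // => ->; rewrite mulr0.
Qed.

End Derived.

Section Cases.
Variables (R : realType) (g : lieAlgebra R) (phi : kform g 3).
Variables (met : g -> g -> R) (vol : kform g 7) (f : 7.-tuple g).
Hypotheses (dim7 : \dim {:g} = 7%N) (hnil : two_step_nilpotent g).
Hypotheses (mphi : multilinear phi) (aphi : alternating phi).
Hypotheses (gmv : G2_metric_volume phi met vol) (rphi : repZ f phi phiZ).

Let ip : inner_product met. Proof. by have [] := gmv. Qed.
Let onf : orthonormal_tuple met f. Proof. by have [] := frame_orthonormal gmv rphi. Qed.

Lemma orthonormal_span n (s : n.-tuple g) (W : {vspace g}) :
  orthonormal_tuple met s -> {subset s <= W} -> \dim W = n -> W = <<s>>%VS.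
Proof.
move=> ons sW dW; apply/eqP; rewrite eq_sym eqEdim.
have -> : (<<s>> <= W)%VS by apply/span_subvP.
have /eqP -> : free s.
  apply: (orthogonal_free ip) => [i j /negbTE nij|i]; rewrite ons ?nij //.
  by rewrite eqxx oner_eq0.
by rewrite size_tuple dW leqnn.
Qed.

Notation cross := (cross phi f).

(** An orthonormal pair in the derived algebra goes to positions 5 and 6, so that its cross product
    takes position 7. The third unit vector of a three-dimensional derived algebra either is a
    multiple of that product or has a component orthogonal to the three, which then gives position
    4. *)
Lemma adapted_cases : exists v : 7.-tuple g, repZ v phi phiZ /\
  [\/ derived g = <<[:: v`_6]>>%VS,
      derived g = <<[:: v`_4; v`_5]>>%VS,
      derived g = <<[:: v`_4; v`_5; v`_6]>>%VS |
      exists c s : R, [/\ s != 0, c ^+ 2 + s ^+ 2 = 1 &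
        derived g = <<[:: v`_4; v`_5; (c *: v`_6 + s *: v`_3)%R]>>%VS]].
Proof.
have mc := met_cross dim7 ip mphi onf.
have phi0 a b : phi [tuple a; b; a] = 0 /\ phi [tuple b; a; a] = 0.
  have E : phi [tuple b; a; a] = 0.
    by apply: (aphi (i := lift ord0 ord0) (j := ord_max)).
  by rewrite (phi_swap12 mphi aphi) E oppr0.
have cxx a b : met (cross a b) a = 0 /\ met (cross a b) b = 0.
  split; rewrite mc; first by have [] := phi0 a b.
  by rewrite (phi_swap12 mphi aphi) (phi0 b a).1 oppr0.
have frame := adapted_frame_rep dim7 ip mphi aphi onf rphi.
have dimT : \dim {:g} = 7%N := dim7.
have third x y : exists w, [/\ met w w = 1, met w x = 0, met w y = 0 &
    met w (cross x y) = 0].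
  have [|w [_ w1 ws]] := unit_perp ip (W := fullv) (s := [:: x; y; cross x y]).
    by rewrite dim7.
  by exists w; split=> //; apply: ws; rewrite !inE eqxx ?orbT.
have [q1|q1] := eqVneq (\dim (derived g)) 1%N.
  have [|z [Uz z1 _]] := unit_perp ip (W := derived g) (s := [::]); first by rewrite q1.
  have [|x [_ x1 /(_ z)]] := unit_perp ip (W := fullv) (s := [:: z]).
    by rewrite dim7.
  rewrite inE eqxx => /(_ isT) xz; have zx : met z x = 0 by rewrite (metC ip).
  (* With this [y], [x * y = z]: the single direction of the derived algebra ends up in position
     7. *)
  pose y := cross z x.
  have xy : met x y = 0 by rewrite (metC ip); have [] := cxx z x.
  have y1 : met y y = 1.
    rewrite {1}/y mc (phi_swap23 mphi aphi) -mc /y.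
    by rewrite (cross_sq dim7 ip mphi onf rphi) // zx scale0r addr0 (metNl ip) opprK.
  have zE : cross x y = z.
    rewrite /y (crossC dim7 ip mphi aphi onf x z).
    rewrite (crossNr dim7 ip mphi aphi onf) (cross_sq dim7 ip mphi onf rphi) //.
    by rewrite xz scale0r addr0 opprK.
  have [w [w1 wx wy wz]] := third x y.
  exists (adapted_frame phi f x y w); split; first exact: frame.
  constructor 1; rewrite /= zE; apply: (orthonormal_span (s := [tuple z])) => //.
    by move=> i j; rewrite !ord1.
  by move=> u; rewrite inE => /eqP ->.
have dim_gt0 := dim_derived_gt0 hnil; have dim_le3 := dim_derived_le3 dim7 hnil.
have [|x [Ux x1 _]] := unit_perp ip (W := derived g) (s := [::]); first exact: dim_gt0.
have [|y [Uy y1 /(_ x)]] := unit_perp ip (W := derived g) (s := [:: x]).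
  by rewrite ltn_neqAle eq_sym q1.
rewrite inE eqxx => /(_ isT) yx; have xy : met x y = 0 by rewrite (metC ip).
have [q2|q2] := eqVneq (\dim (derived g)) 2%N.
  have [w [w1 wx wy wz]] := third x y.
  exists (adapted_frame phi f x y w); split; first exact: frame.
  constructor 2; apply: (orthonormal_span (s := [tuple x; y])) => //.
    by move=> [] [|[|//]] ? [] [|[|//]] ?.
  by move=> u; rewrite !inE => /orP[] /eqP ->.
have q3 : \dim (derived g) = 3%N.
  by move: q1 q2 dim_gt0 dim_le3; case: (\dim _) => [|[|[|[|]]]].
have [|u [Uu u1 us]] := unit_perp ip (W := derived g) (s := [:: x; y]).
  by rewrite q3.
have ux : met u x = 0 by apply: us; rewrite !inE eqxx.
have uy : met u y = 0 by apply: us; rewrite !inE eqxx orbT.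
have xu : met x u = 0 by rewrite (metC ip).
have yu : met y u = 0 by rewrite (metC ip).
have UE : derived g = <<[:: x; y; u]>>%VS.
  apply: (orthonormal_span (s := [tuple x; y; u])) => //.
    by move=> [] [|[|[|//]]] ? [] [|[|[|//]]] ?.
  by move=> t; rewrite !inE => /or3P[] /eqP ->.
(* [p] is the part of [u] orthogonal to [x], [y] and [z]; it vanishes exactly in the untilted
   case. *)
pose z := cross x y; pose c := met u z; pose p := u - c *: z.
have zx : met z x = 0 by have [] := cxx x y.
have zy : met z y = 0 by have [] := cxx x y.
have z1 : met z z = 1.
  rewrite {1}/z mc (phi_swap23 mphi aphi) -mc /z.
  by rewrite (cross_sq dim7 ip mphi onf rphi) // xy scale0r addr0 (metNl ip) opprK.
have px : met p x = 0 by rewrite (metDl ip) (metNl ip) (metZl ip) ux zx mulr0 subr0.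
have py : met p y = 0 by rewrite (metDl ip) (metNl ip) (metZl ip) uy zy mulr0 subr0.
have pz : met p z = 0 by rewrite (metDl ip) (metNl ip) (metZl ip) z1 mulr1 subrr.
have uE : u = c *: z + p by rewrite addrC subrK.
have c2 : c ^+ 2 + met p p = 1.
  have H q : met q z = 0 -> met (c *: z + q) (c *: z + q) = c ^+ 2 + met q q.
    move=> qz; rewrite !(metDl ip, metDr ip, metZl ip, metZr ip) z1.
    by rewrite (metC ip z q) qz; ring.
  by rewrite -H // -uE.
have [p0|nzp] := eqVneq p 0.
  have nzc : c != 0.
    apply: contra_eq_neq c2 => /eqP; rewrite p0 (met0l ip) addr0 => /eqP ->.
    by rewrite expr0n /= eq_sym oner_eq0.
  have [w [w1 wx wy wz]] := third x y.
  exists (adapted_frame phi f x y w); split; first exact: frame.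
  constructor 3; apply: (orthonormal_span (s := [tuple x; y; z])) => //.
    by move=> [] [|[|[|//]]] ? [] [|[|[|//]]] ? //=; rewrite ?(metC ip _ z).
  move=> t; rewrite !inE => /or3P[] /eqP -> //.
  have -> : z = c^-1 *: u by rewrite uE p0 addr0 scalerA mulVf // scale1r.
  exact: memvZ.
have p_gt0 := met_gt0 ip nzp; pose s := Num.sqrt (met p p).
have s_gt0 : 0 < s by rewrite sqrtr_gt0.
have s2 : s ^+ 2 = met p p by rewrite sqr_sqrtr // ltW.
have nzs : s != 0 by rewrite gt_eqF.
pose w := s^-1 *: p.
have w1 : met w w = 1.
  by rewrite (metZl ip) (metZr ip) -s2 mulrA -expr2 exprVn mulVf // expf_neq0.
exists (adapted_frame phi f x y w); split.
  by apply: frame => //; rewrite (metZl ip) ?px ?py ?pz mulr0.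
constructor 4; exists c, s; split=> //; first by rewrite s2.
have -> : c *: (adapted_frame phi f x y w)`_6 + s *: (adapted_frame phi f x y w)`_3
    = u by rewrite /= scalerA mulfV // scale1r -uE.
exact: UE.
Qed.

End Cases.

(** * One-dimensional derived algebra *)

Section PrintedEquations.
Variables (R : realType) (env : nat -> R).

(** Coefficients of the printed polynomials become real expressions that [lra] can read. *)
Fixpoint pos_eval (p : positive) : R :=
  match p with
  | xH => 1
  | xO q => 2 * pos_eval q
  | xI q => 2 * pos_eval q + 1
  end.

Lemma zr_pos p : zr R (Zpos p) = pos_eval p.
Proof.
elim: p => [p IHp|p IHp|] //=; rewrite -IHp.
  by rewrite -[xI p]/(Pos.add (Pos.mul 2 p) 1) (zrD _ (Zpos (xO p)) 1)
    (zrM _ 2 (Zpos p)).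
by rewrite (zrM _ 2 (Zpos p)).
Qed.

Lemma zr_neg p : zr R (Zneg p) = - pos_eval p.
Proof. by rewrite -zr_pos -zrN. Qed.

(* Components [ls] of d psi and, for (m, u, v) in [ms], the equation          *)
(* \sum_(i < j) phi_mij g(R(e_i, e_j) e_u, e_v) = 0.                          *)
Definition equations (p : nat -> nat -> nat -> poly) (ls : seq (seq nat))
    (ms : seq (nat * nat * nat)) : seq poly :=
  let c := deP p in let br := bracketP c in let A := conn_tableP c in
  [seq pprim (ce_dP br 3 psiZ l) | l <- ls] ++
  [seq pprim (instP c A m.1.1 m.1.2 m.2) | m <- ms].

Lemma equationsP p ls ms :
  all (fun l => (size l == 5%N) && all (ltn^~ 7%N) l) ls ->
  all (fun m => [&& m.1.1 < 7, m.1.2 < 7 & m.2 < 7])%N ms ->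
  (forall J : 5.-tuple 'I_7, ev env (ce_dP (bracketP (deP p)) 3 psiZ (map val J)) = 0) ->
  (forall m u v : 'I_7, ev env (instP (deP p) (conn_tableP (deP p)) m u v) = 0) ->
  all (fun q => ev env q == 0) (equations p ls ms).
Proof.
move=> /allP ls5 /allP ms7 dp ins; rewrite all_cat !all_map; apply/andP; split.
  apply/allP=> l /ls5 /andP[/eqP sl /allP l7]; apply/eqP/ev_pprim.
  rewrite -(dp [tuple inord (nth 0%N l i) | i < 5]); congr (ev _ (ce_dP _ _ _ _)).
  apply: (@eq_from_nth _ 0%N); first by rewrite size_map size_tuple.
  move=> i; rewrite sl => lti; rewrite (nth_map ord0) ?size_tuple //.
  rewrite -[i]/(val (Ordinal lti)) -tnth_nth tnth_mktuple /= inordK //.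
  by apply: l7; rewrite mem_nth ?sl.
apply/allP=> m /ms7 /and3P[m1 m2 m3]; apply/eqP/ev_pprim.
exact: (ins (Ordinal m1) (Ordinal m2) (Ordinal m3)).
Qed.

End PrintedEquations.

(** Variable [7 i + j] is the coefficient of [e^{ij}] in [de^7] (0-based [i], [j]); pairs with
    [j = 6] drop out because [e_7] is central. *)
Definition line_forms (i j k : nat) : poly :=
  if (k == 6%N) && (j < 6)%N then pX (7 * i + j) else [::].

Definition line_system : seq poly := equations line_forms
  [:: [:: 0; 1; 2; 3; 4]; [:: 0; 1; 2; 3; 5]; [:: 0; 1; 2; 4; 5];
      [:: 0; 1; 3; 4; 5]; [:: 0; 2; 3; 4; 5]; [:: 1; 2; 3; 4; 5]]%N
  [:: (0, 1, 6); (2, 3, 6); (4, 5, 6)]%N.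

(** The polynomials are stored in normal form, so that evaluating them leaves explicit equations for
    [lra]. *)
Definition line_eqs := Eval vm_compute in line_system.

Lemma line_eqsE : line_system = line_eqs.
Proof. by vm_compute. Qed.

(** For the complex structure pairing [e_1 e_2], [e_3 e_4], [e_5 e_6], the six components of [d psi]
    say that [de^7] has type (1,1); the instanton equations make it primitive. *)
Lemma line_algebra (R : realType) (e : nat -> R) :
  all (fun q => ev e q == 0) line_eqs ->
  [/\ e 9%N = - e 3%N, e 10%N = e 2%N & e 11%N = - e 5%N] /\
  [/\ e 12%N = e 4%N, e 25%N = - e 19%N, e 26%N = e 18%N &
      e 1%N + e 17%N + e 33%N = 0].
Proof.
rewrite /line_eqs /ev /= !zr_neg !zr_pos /=.
case/and5P=> /eqP h1 /eqP h2 /eqP h3 /eqP h4 /and5P[/eqP h5 /eqP h6 /eqP h7 /eqP h8].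
rewrite andbT => /eqP h9.
have e9 : e 9%N = - e 3%N by lra.
have e10 : e 10%N = e 2%N by lra.
have e11 : e 11%N = - e 5%N by lra.
have e12 : e 12%N = e 4%N by lra.
have e25 : e 25%N = - e 19%N by lra.
have e26 : e 26%N = e 18%N by lra.
split=> //; split=> //.
move: h7 h8 h9; rewrite e9 e10 e11 e12 e25 e26 => h7 h8 h9.
(* The square of the trace is a linear combination of the three quadratic equations. *)
apply/eqP; rewrite -sqrf_eq0; apply/eqP.
by lra.
Qed.

(* Darboux's theorem, one symplectic plane at a time. *)
Lemma symplectic_plane (R : realType) (V : vectType R) (B : V -> V -> R)
    (W : {vspace V}) :
  (forall t x y z, B (t *: x + y) z = t * B x z + B y z) ->
  (forall t x y z, B z (t *: x + y) = t * B z x + B z y) ->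
  (forall x, B x x = 0) ->
  (forall x y, x \in W -> y \in W -> B x y = 0) \/
  exists x y (W' : {vspace V}), [/\ x \in W, y \in W, B x y = 1,
    \dim W = (\dim W' + 2)%N &
    forall w, (w \in W' -> [/\ w \in W, B x w = 0 & B y w = 0]) /\
              (w \in W -> w - B w y *: x + B w x *: y \in W')].
Proof.
move=> Bl Br Bxx.
have B0l z : B 0 z = 0 by have := Bl (-1) 0 0 z; rewrite scaler0 addr0 mulN1r addNr.
have B0r z : B z 0 = 0 by have := Br (-1) 0 0 z; rewrite scaler0 addr0 mulN1r addNr.
have Bsl z n (a : 'I_n -> R) (u : 'I_n -> V) :
    B (\sum_i a i *: u i) z = \sum_i a i * B (u i) z.
  by elim/big_rec2: _ => // i s y _ <-; rewrite Bl.
have Bsr z n (a : 'I_n -> R) (u : 'I_n -> V) :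
    B z (\sum_i a i *: u i) = \sum_i a i * B z (u i).
  by elim/big_rec2: _ => // i s y _ <-; rewrite Br.
pose b := vbasis W.
case: (boolP [forall i : 'I_(\dim W), forall j : 'I_(\dim W), B b`_i b`_j == 0]) => [/forallP B0|].
  left=> x y /coord_vbasis -> /coord_vbasis ->.
  rewrite Bsl big1 // => i _; rewrite Bsr big1 ?mulr0 // => j _.
  by have /forallP/(_ j)/eqP -> := B0 i; rewrite mulr0.
case/forallPn => i /forallPn[j nz]; right.
have bW (k : 'I_(\dim W)) : b`_k \in W.
  by apply: vbasis_mem; apply: mem_nth; rewrite size_tuple.
pose x := b`_i; pose y := (B x b`_j)^-1 *: b`_j.
have xy : B x y = 1.
  have := Br (B x b`_j)^-1 b`_j 0 x; rewrite !addr0 B0r addr0 => ->.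
  by rewrite mulVf.
have Al p q r : B (p + q) r = B p r + B q r.
  by have := Bl 1 p q r; rewrite scale1r mul1r.
have Ar p q r : B r (p + q) = B r p + B r q.
  by have := Br 1 p q r; rewrite scale1r mul1r.
have yx : B y x = -1.
  have /eqP := Bxx (x + y).
  by rewrite Al !Ar !Bxx xy add0r addr0 addrC addr_eq0 => /eqP.
(* [W'] will be the kernel of [L] on [W], the complement of the plane with respect to [B]. *)
pose L (z : V) : 'rV[R]_2 := \row_k (if k == 0 then B x z else B y z).
have Llin : linear L.
  by move=> t p q; apply/rowP=> k; rewrite !mxE; case: eqP; rewrite Br.
pose LL := GRing.isLinear.Build _ _ _ _ L Llin.
pose Lf : {linear V -> 'rV[R]_2} := HB.pack L LL.
have xW : x \in W by apply: bW.
have yW : y \in W by apply/memvZ/bW.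
exists x, y, (W :&: lker (linfun Lf))%VS; split=> //; last first.
  have Bxy p q : B q p = - B p q.
    by apply/eqP; rewrite -addr_eq0; have := Bxx (q + p); rewrite Al !Ar !Bxx;
      rewrite add0r addr0 => ->.
  move=> w; rewrite memv_cap memv_ker lfunE; split.
    by case/andP=> Ww /eqP/rowP E; have := E 0; have := E 1; rewrite !mxE.
  move=> Ww; rewrite memv_cap memvD ?memvB ?memvZ // andTb.
  rewrite memv_ker lfunE; apply/eqP/rowP=> k; rewrite !mxE -scaleNr.
  have Zr t p q : B q (t *: p) = t * B q p.
    by have := Br t p 0 q; rewrite !addr0 B0r addr0.
  case: eqP => _; rewrite !Ar (Zr _ x) (Zr _ y) !Bxx ?xy ?yx (Bxy x w) (Bxy y w);
    by ring.
rewrite -[LHS](limg_ker_dim (linfun Lf)); congr (_ + _)%N.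
have -> : (linfun Lf @: W)%VS = fullv.
  apply/eqP; rewrite eqEsubv subvf; apply/subvP => r _.
  (* [B x y = 1] and [B y x = -1] give a preimage of any pair, so the kernel has codimension exactly
     2. *)
  have -> : r = linfun Lf (r 0 0 *: y - r 0 1 *: x).
    rewrite lfunE; apply/rowP=> k; rewrite !mxE -scaleNr.
    have Zr t p q s z : B z (t *: p + s *: q) = t * B z p + s * B z q.
      by rewrite Br; have := Br s q 0 z; rewrite !addr0 B0r addr0 => ->.
    case: (unliftP 0 k) => [k' ->|->] /=; rewrite Zr !Bxx ?xy ?yx.
      by rewrite (ord1 k') mulr0 add0r mulrNN mulr1; congr (r _ _); apply: val_inj.
    by rewrite mulr1 mulr0 addr0.
  by apply: memv_img; rewrite memvB ?memvZ.
by rewrite dimvf.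
Qed.

Section TermsBracket.
Variables (R : realType) (g : lieAlgebra R) (f : 7.-tuple g).

Lemma terms_bracket s :
  all (fun t : nat * nat * nat * Z => t.1.2 < 7)%N s ->
  (forall i j : nat, (i < j < 7)%N -> lie_br f`_i f`_j
    = \sum_(t <- s | (t.1.1.1 == i) && (t.1.1.2 == j)) (- zr R t.2) *: f`_(t.1.2)) ->
  forall i j, lie_br (tnth f i) (tnth f j)
    = \sum_m terms_constants R s i j m *: tnth f m.
Proof.
move=> s7 fbr.
have lt (i j : 'I_7) : (i < j)%N -> lie_br (tnth f i) (tnth f j)
    = \sum_m terms_constants R s i j m *: tnth f m.
  move=> ltij; rewrite !(tnth_nth 0) fbr ?ltij ?ltn_ord //.
  transitivity (\sum_m \sum_(t <- s)
    (- ((t.1 == (val i, val j, val m))%:R * zr R t.2)) *: tnth f m); last first.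
    apply: eq_bigr => m _; rewrite -scaler_suml; congr (_ *: _).
    by rewrite /terms_constants ev_deP ltij ev_terms sumrN.
  rewrite exchange_big big_mkcond [LHS]big_seq [RHS]big_seq; apply: eq_bigr => t ts.
  case: t ts => [[[a b] k] z] /= ts; have ltk : (k < 7)%N := allP s7 _ ts.
  rewrite (bigD1 (Ordinal ltk)) //= big1 => [|m nm].
    rewrite addr0 !xpair_eqE eqxx andbT (tnth_nth 0) /=.
    by case: ifP => _; rewrite ?mul1r // mul0r oppr0 scale0r.
  rewrite !xpair_eqE (_ : (k == m :> nat) = false).
    by rewrite andbF mul0r oppr0 scale0r.
  by apply: contraNF nm => /eqP E; rewrite -val_eqE /= E.
move=> i j; case: (ltngtP i j) => [/lt //|ltji|Eij].
  rewrite lie_brC lt // -sumrN; apply: eq_bigr => m _; rewrite -scaleNr.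
  congr (_ *: _); rewrite /terms_constants !ev_deP ltji ltnNge (ltnW ltji) /=.
  by rewrite opprK.
rewrite (val_inj Eij) lie_brxx big1 // => m _.
by rewrite /terms_constants ev_deP ltnn scale0r.
Qed.

Lemma model_isomorphic (h : lieAlgebra R) s :
  has_model h s -> all (fun t : nat * nat * nat * Z => t.1.2 < 7)%N s ->
  basis_of fullv f ->
  (forall i j : nat, (i < j < 7)%N -> lie_br f`_i f`_j
    = \sum_(t <- s | (t.1.1.1 == i) && (t.1.1.2 == j)) (- zr R t.2) *: f`_(t.1.2)) ->
  lie_isomorphic g h.
Proof.
move=> [k [klin kbij kbr]] s7 bf fbr.
exact: (basis_isomorphic klin kbij kbr bf (terms_bracket s7 fbr)).
Qed.

End TermsBracket.

(** A decomposable form satisfies the Pluecker relations; with type (1,1) these read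
    [F01 F23 = F02^2 + F03^2] and similarly for the other two pairs. Squaring the vanishing trace
    then gives a vanishing sum of squares. *)
Lemma rank_two_algebra (R : realType) (F : nat -> nat -> R) (a b : nat -> R) :
  (forall i j, (i < 6)%N -> (j < 6)%N -> F i j = a i * b j - b i * a j) ->
  F 1%N 2%N = - F 0%N 3%N -> F 1%N 3%N = F 0%N 2%N -> F 1%N 4%N = - F 0%N 5%N ->
  F 1%N 5%N = F 0%N 4%N -> F 3%N 4%N = - F 2%N 5%N -> F 3%N 5%N = F 2%N 4%N ->
  F 0%N 1%N + F 2%N 3%N + F 4%N 5%N = 0 ->
  forall i j, (i < 6)%N -> (j < 6)%N -> F i j = 0.
Proof.
move=> Fab h1 h2 h3 h4 h5 h6 tr.
have FC i j : (i < 6)%N -> (j < 6)%N -> F j i = - F i j.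
  by move=> lti ltj; rewrite !Fab //; ring.
have plucker i j k l : (i < 6)%N -> (j < 6)%N -> (k < 6)%N -> (l < 6)%N ->
    F i j * F k l = F i k * F j l - F i l * F j k.
  by move=> *; rewrite !Fab //; ring.
have p1 : F 0%N 1%N * F 2%N 3%N = F 0%N 2%N ^+ 2 + F 0%N 3%N ^+ 2.
  by rewrite plucker // h1 h2; ring.
have p2 : F 0%N 1%N * F 4%N 5%N = F 0%N 4%N ^+ 2 + F 0%N 5%N ^+ 2.
  by rewrite plucker // h3 h4; ring.
have p3 : F 2%N 3%N * F 4%N 5%N = F 2%N 4%N ^+ 2 + F 2%N 5%N ^+ 2.
  by rewrite plucker // h5 h6; ring.
have sq : F 0%N 1%N ^+ 2 + F 2%N 3%N ^+ 2 + F 4%N 5%N ^+ 2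
    + 2 * (F 0%N 2%N ^+ 2 + F 0%N 3%N ^+ 2 + F 0%N 4%N ^+ 2 + F 0%N 5%N ^+ 2
           + F 2%N 4%N ^+ 2 + F 2%N 5%N ^+ 2) = 0.
  have /(congr1 (fun t => t ^+ 2)) := tr; rewrite expr0n /=; nra.
have z i j : F i j ^+ 2 <= 0 -> F i j = 0.
  by move=> le0; apply/eqP; rewrite -sqrf_eq0 eq_le le0 sqr_ge0.
have := (sqr_ge0 (F 0%N 1%N), sqr_ge0 (F 2%N 3%N), sqr_ge0 (F 4%N 5%N)).
have := (sqr_ge0 (F 0%N 2%N), sqr_ge0 (F 0%N 3%N), sqr_ge0 (F 0%N 4%N)).
have := (sqr_ge0 (F 0%N 5%N), sqr_ge0 (F 2%N 4%N), sqr_ge0 (F 2%N 5%N)).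
move=> [[s1 s2] s3] [[s4 s5] s6] [[s7 s8] s9].
have z01 : F 0%N 1%N = 0 by apply: z; lra.
have z23 : F 2%N 3%N = 0 by apply: z; lra.
have z45 : F 4%N 5%N = 0 by apply: z; lra.
have z02 : F 0%N 2%N = 0 by apply: z; lra.
have z03 : F 0%N 3%N = 0 by apply: z; lra.
have z04 : F 0%N 4%N = 0 by apply: z; lra.
have z05 : F 0%N 5%N = 0 by apply: z; lra.
have z24 : F 2%N 4%N = 0 by apply: z; lra.
have z25 : F 2%N 5%N = 0 by apply: z; lra.
rewrite z03 oppr0 in h1; rewrite z02 in h2; rewrite z05 oppr0 in h3.
rewrite z04 in h4; rewrite z25 oppr0 in h5; rewrite z24 in h6.
move=> i j lti ltj; wlog ltij : i j lti ltj / (i < j)%N => [H|].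
  case: (ltngtP i j) => [|ltji|->]; first exact: H.
    by rewrite FC // H // oppr0.
  by rewrite Fab // mulrC subrr.
by case: i j lti ltj ltij => [|[|[|[|[|[|//]]]]]] [|[|[|[|[|[|//]]]]]] //.
Qed.

(** * Derived algebra orthogonal to four frame vectors *)

(** Index 6 lies outside the derived algebra in this case, so brackets with [e_7] are kept as
    unknowns. The offset 28 separates [de^6] from [de^5]. *)
Definition plane_forms (i j k : nat) : poly :=
  if [&& i < 4, (j < 4) || (j == 6) & k \in [:: 4; 5]]%N
  then pX (if k == 4 then 7 * i + j else 28 + 7 * i + j)%N else [::].

Definition plane_system : seq poly := equations plane_forms
  [:: [:: 0; 1; 2; 4; 6]; [:: 0; 1; 2; 5; 6]; [:: 0; 1; 3; 4; 6]; [:: 0; 1; 3; 5; 6];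
      [:: 0; 2; 3; 4; 6]; [:: 0; 2; 3; 5; 6]; [:: 1; 2; 3; 4; 6]; [:: 1; 2; 3; 5; 6]]%N
  [::].

Definition plane_eqs := Eval vm_compute in plane_system.

Lemma plane_eqsE : plane_system = plane_eqs.
Proof. by vm_compute. Qed.

(* The structure equations de^{5+a} = \sum_b M a b w+_b + N a b w-_b, where   *)
(* w+_b is the self-dual form that multiplies e^{5+b} in phi and the          *)
(* anti-self-dual forms w-_b are e^{13}+e^{24}, -e^{14}+e^{23}, e^{12}-e^{34}.*)
Definition quat_forms (M N : nat -> nat -> poly) (i j k : nat) : poly :=
  let a := (k - 4)%N in
  if (4 <= k)%N then
  match i, j with
  | 0, 2 => padd (M a 0) (N a 0)
  | 1, 3 => padd (pscale (-1) (M a 0)) (N a 0)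
  | 0, 3 => pscale (-1) (padd (M a 1) (N a 1))
  | 1, 2 => padd (pscale (-1) (M a 1)) (N a 1)
  | 0, 1 => padd (M a 2) (N a 2)
  | 2, 3 => padd (M a 2) (pscale (-1) (N a 2))
  | _, _ => [::] end%N
  else [::].

(** Three successive shapes for [M]: general, then symmetric by coclosedness, then scalar by the
    instanton equations. Printing the system anew for each shape keeps it small. *)
Definition matP (n a b : nat) : poly := pX (n + 3 * a + b).
Definition symP (n a b : nat) : poly := pX (n + 3 * minn a b + maxn a b).
Definition scalarP (n a b : nat) : poly := if a == b then pX n else [::].

Definition quat_system1 : seq poly := equations (quat_forms (matP 0) (matP 9))
  [:: [:: 0; 1; 2; 3; 4]; [:: 0; 1; 2; 3; 5]; [:: 0; 1; 2; 3; 6]]%N [::].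
Definition quat_system2 : seq poly := equations (quat_forms (symP 0) (matP 9)) [::]
  [:: (4, 5, 6); (5, 4, 6); (6, 4, 5)]%N.
Definition quat_system3 : seq poly := equations (quat_forms (scalarP 0) (matP 9)) [::]
  [:: (4, 0, 2); (4, 0, 3); (4, 0, 1); (5, 0, 2); (5, 0, 3); (5, 0, 1);
      (6, 0, 2); (6, 0, 3); (6, 0, 1)]%N.

Definition quat_eqs1 := Eval vm_compute in quat_system1.
Definition quat_eqs2 := Eval vm_compute in quat_system2.
Definition quat_eqs3 := Eval vm_compute in quat_system3.

Lemma quat_eqsE :
  [/\ quat_system1 = quat_eqs1, quat_system2 = quat_eqs2 & quat_system3 = quat_eqs3].
Proof. by split; vm_compute. Qed.

Section QuaternionicAlgebra.
Variable R : realType.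

(** The values of [quat_forms] for [M = m Id], extended antisymmetrically. *)
Definition quat_value (m : R) (N : nat -> nat -> R) (a i j : nat) : R :=
  let w i j := match i, j with
    | 0%N, 2%N => (a == 0)%:R * m + N a 0%N
    | 1%N, 3%N => - ((a == 0)%:R * m) + N a 0%N
    | 0%N, 3%N => - ((a == 1)%:R * m + N a 1%N)
    | 1%N, 2%N => - ((a == 1)%:R * m) + N a 1%N
    | 0%N, 1%N => (a == 2)%:R * m + N a 2%N
    | 2%N, 3%N => (a == 2)%:R * m - N a 2%N
    | _, _ => 0
    end in
  if (i < j)%N then w i j else - w j i.

(** Cyclic indices modulo 3 give the signs of the cofactors. *)
Definition minus_cofactor (N : nat -> nat -> R) (a b : nat) : R :=
  N (a.+1 %% 3)%N (b.+2 %% 3)%N * N (a.+2 %% 3)%N (b.+1 %% 3)%N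
  - N (a.+1 %% 3)%N (b.+1 %% 3)%N * N (a.+2 %% 3)%N (b.+2 %% 3)%N.

(** The three components of [d psi] are the antisymmetric part of [M]. *)
Lemma quat_symmetric (e : nat -> R) : all (fun q => ev e q == 0) quat_eqs1 ->
  forall a b, (a < 3)%N -> (b < 3)%N -> ev e (matP 0 a b) = ev e (symP 0 a b).
Proof.
rewrite /quat_eqs1 /ev /= !zr_neg !zr_pos /=.
case/and4P=> /eqP h1 /eqP h2 /eqP h3 _.
have z1 : e 3%N = e 1%N by lra.
have z2 : e 6%N = e 2%N by lra.
have z3 : e 7%N = e 5%N by lra.
by case=> [|[|[|//]]] [|[|[|//]]] _ _ /=; rewrite ?z1 ?z2 ?z3.
Qed.

(* The sum of the three equations is the sum of the squares of the entries of *)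
(* the trace-free part of M.                                                  *)
Lemma quat_scalar (e : nat -> R) : all (fun q => ev e q == 0) quat_eqs2 ->
  forall a b, (a < 3)%N -> (b < 3)%N -> ev e (symP 0 a b) = ev e (scalarP 0 a b).
Proof.
rewrite /quat_eqs2 /ev /= !zr_neg !zr_pos /=.
case/and4P=> /eqP h1 /eqP h2 /eqP h3 _.
have sq : (e 0%N - e 4%N) ^+ 2 + (e 4%N - e 8%N) ^+ 2 + (e 8%N - e 0%N) ^+ 2
    + 6 * (e 1%N ^+ 2 + e 2%N ^+ 2 + e 5%N ^+ 2) = 0 by lra.
have := (sqr_ge0 (e 0%N - e 4%N), sqr_ge0 (e 4%N - e 8%N), sqr_ge0 (e 8%N - e 0%N)).
have := (sqr_ge0 (e 1%N), sqr_ge0 (e 2%N), sqr_ge0 (e 5%N)).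
move=> [[s1 s2] s3] [[s4 s5] s6].
have z t : t ^+ 2 <= 0 -> t = 0 :> R.
  by move=> le0; apply/eqP; rewrite -sqrf_eq0 eq_le le0 sqr_ge0.
have z1 : e 1%N = 0 by apply: z; lra.
have z2 : e 2%N = 0 by apply: z; lra.
have z5 : e 5%N = 0 by apply: z; lra.
have z04 : e 0%N - e 4%N = 0 by apply: z; lra.
have z48 : e 4%N - e 8%N = 0 by apply: z; lra.
have z4 : e 4%N = e 0%N by lra.
have z8 : e 8%N = e 0%N by lra.
by case=> [|[|[|//]]] [|[|[|//]]] _ _ /=; rewrite ?z1 ?z2 ?z5 ?z4 ?z8 ?mul0r ?mulr0 ?addr0.
Qed.

Lemma quat_cofactor (e : nat -> R) : all (fun q => ev e q == 0) quat_eqs3 ->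
  forall a b, (a < 3)%N -> (b < 3)%N ->
  e 0%N * e (9 + 3 * a + b)%N = minus_cofactor (fun a b => e (9 + 3 * a + b)%N) a b.
Proof.
rewrite /quat_eqs3 /ev /= !zr_neg !zr_pos /= !andbA -!andbA.
case/and5P=> /eqP h1 /eqP h2 /eqP h3 /eqP h4 /and5P[/eqP h5 /eqP h6 /eqP h7 /eqP h8].
rewrite andbT => /eqP h9.
by case=> [|[|[|//]]] [|[|[|//]]] _ _; rewrite /minus_cofactor /=; lra.
Qed.

End QuaternionicAlgebra.

Section QuaternionicKernel.
Variables (R : realType) (m : R) (N : nat -> nat -> R).
Hypothesis cof : forall a b, (a < 3)%N -> (b < 3)%N -> m * N a b = minus_cofactor N a b.

Let dot a b := N a 0%N * N b 0%N + N a 1%N * N b 1%N + N a 2%N * N b 2%N.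

(* m N is minus the cofactor matrix of N, so that N is zero or m times an     *)
(* orthogonal matrix.                                                         *)
Lemma quat_orthogonal : m != 0 ->
  (forall a b, (a < 3)%N -> (b < 3)%N -> N a b = 0) \/
  (forall a b, (a < 3)%N -> (b < 3)%N -> dot a b = (a == b)%:R * m ^+ 2).
Proof.
move=> nzm.
have dotC a b : dot a b = dot b a by rewrite /dot; ring.
(* Replacing [m N] by cofactors makes this an expansion of the determinant along a wrong row; for
   [a = b] it gives [- det N] whatever the row. *)
have ort a b : (a < b)%N -> (b < 3)%N -> dot a b = 0.
  move=> ltab ltb; apply: (mulfI nzm); rewrite mulr0.
  transitivity (m * N a 0%N * N b 0%N + m * N a 1%N * N b 1%N + m * N a 2%N * N b 2%N).
    by rewrite /dot; ring.
  by case: a b ltab ltb => [|[|a]] [|[|[|b]]] // _ _; rewrite !cof // /minus_cofactor /=; ring.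
have nrm a : (a < 3)%N -> dot a a = dot 0%N 0%N.
  move=> lta; apply: (mulfI nzm).
  transitivity (m * N a 0%N * N a 0%N + m * N a 1%N * N a 1%N + m * N a 2%N * N a 2%N).
    by rewrite /dot; ring.
  transitivity (m * N 0%N 0%N * N 0%N 0%N + m * N 0%N 1%N * N 0%N 1%N
    + m * N 0%N 2%N * N 0%N 2%N); last by rewrite /dot; ring.
  by case: a lta => [|[|[|]]] // _; rewrite !cof // /minus_cofactor /=; ring.
have sq : m ^+ 2 * dot 0%N 0%N = dot 0%N 0%N * dot 0%N 0%N.
  transitivity (dot 1%N 1%N * dot 2%N 2%N - dot 1%N 2%N ^+ 2); last first.
    by rewrite (ort 1%N 2%N) // !nrm // expr0n subr0.
  transitivity ((m * N 0%N 0%N) ^+ 2 + (m * N 0%N 1%N) ^+ 2 + (m * N 0%N 2%N) ^+ 2).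
    by rewrite /dot; ring.
  by rewrite !cof // /minus_cofactor /dot /=; ring.
have [d0|nzd] := eqVneq (dot 0%N 0%N) 0; [left=> a b lta|right=> a b].
  have := nrm _ lta; rewrite d0 /dot => d0a.
  have sq0 := (sqr_ge0 (N a 0%N), sqr_ge0 (N a 1%N), sqr_ge0 (N a 2%N)).
  move: sq0 => [[s0 s1] s2].
  by case: b => [|[|[|//]]] _; apply/eqP; rewrite -sqrf_eq0 eq_le sqr_ge0 andbT; lra.
have dm : dot 0%N 0%N = m ^+ 2 by apply: (mulfI nzd); rewrite -sq mulrC.
case: (ltngtP a b) => [ltab _ ltb|ltba lta _|<- lta _]; rewrite ?mul0r ?mul1r.
- exact: ort.
- by rewrite dotC ort.
by rewrite nrm.
Qed.

(** When [N = - m Q] with [Q] a rotation, this matrix is [4 m q q^T], where [q] is a unit quaternion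
    of [Q] with coordinates reordered and some signs changed. Its columns are multiples of the
    kernel vector [q], written as polynomials, and its trace is [4 m]. *)
Definition quat_kernel (i j : nat) : R :=
  match i, j with
  | 0%N, 0%N => m - N 0%N 0%N - N 1%N 1%N - N 2%N 2%N
  | 1%N, 1%N => m + N 0%N 0%N + N 1%N 1%N - N 2%N 2%N
  | 2%N, 2%N => m - N 0%N 0%N + N 1%N 1%N + N 2%N 2%N
  | 3%N, 3%N => m + N 0%N 0%N - N 1%N 1%N + N 2%N 2%N
  | 0%N, 1%N | 1%N, 0%N => N 1%N 0%N - N 0%N 1%N
  | 0%N, 2%N | 2%N, 0%N => N 2%N 1%N - N 1%N 2%N
  | 0%N, 3%N | 3%N, 0%N => N 2%N 0%N - N 0%N 2%N
  | 1%N, 2%N | 2%N, 1%N => - N 0%N 2%N - N 2%N 0%N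
  | 1%N, 3%N | 3%N, 1%N => N 1%N 2%N + N 2%N 1%N
  | 2%N, 3%N | 3%N, 2%N => N 0%N 1%N + N 1%N 0%N
  | _, _ => 0
  end.

(** Each of the 48 scalar identities is a linear consequence of the cofactor and orthogonality
    relations. *)
Lemma quat_kernelP :
  (forall a b, (a < 3)%N -> (b < 3)%N -> dot a b = (a == b)%:R * m ^+ 2) ->
  forall a j k, (a < 3)%N -> (j < 4)%N -> (k < 4)%N ->
  quat_kernel 0 j * quat_value m N a 0 k + quat_kernel 1 j * quat_value m N a 1 k +
  quat_kernel 2 j * quat_value m N a 2 k + quat_kernel 3 j * quat_value m N a 3 k = 0.
Proof.
move=> dotE.
have := (cof (a := 0) (b := 0) isT isT, cof (a := 0) (b := 1) isT isT,
  cof (a := 0) (b := 2) isT isT).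
have := (cof (a := 1) (b := 0) isT isT, cof (a := 1) (b := 1) isT isT,
  cof (a := 1) (b := 2) isT isT).
have := (cof (a := 2) (b := 0) isT isT, cof (a := 2) (b := 1) isT isT,
  cof (a := 2) (b := 2) isT isT).
have := (dotE 0%N 0%N isT isT, dotE 1%N 1%N isT isT, dotE 2%N 2%N isT isT).
have := (dotE 0%N 1%N isT isT, dotE 0%N 2%N isT isT, dotE 1%N 2%N isT isT).
rewrite /dot /minus_cofactor /= !mul1r !mul0r.
move=> [[d1 d2] d3] [[d4 d5] d6] [[c1 c2] c3] [[c4 c5] c6] [[c7 c8] c9].
case=> [|[|[|//]]] [|[|[|[|//]]]] [|[|[|[|//]]]] _ _ _; rewrite /quat_value /=.
all: rewrite ?mul1r ?mul0r; lra.
Qed.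

End QuaternionicKernel.

Lemma lie_br_span (R : realType) (g : lieAlgebra R) (X : seq g) (S : {vspace g}) :
  (forall x y, x \in X -> y \in X -> lie_br x y \in S) ->
  forall x y, x \in <<X>>%VS -> y \in <<X>>%VS -> lie_br x y \in S.
Proof.
move=> XS x y Xx Xy; rewrite (coord_span (X := in_tuple X) Xx) lie_br_suml.
apply: memv_suml => i _; apply: memvZ.
rewrite (coord_span (X := in_tuple X) Xy) lie_br_sumr.
by apply: memv_suml => j _; apply/memvZ/XS; apply: mem_nth.
Qed.

(** * Derived algebra meeting the four frame vectors *)

(* The structure equations when the derived algebra is spanned by v_5, v_6    *)
(* and u_7 = c v_7 + s v_4.  The variables 0 and 1 stand for c and s, and     *)
(* [W a p] is the p-th coefficient of the a-th closed form in the basis       *)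
(* e^{12}, e^{13}, e^{23}, e^1 n, e^2 n, e^3 n with n = c e^4 - s e^7.        *)
Definition tilt_component (W : nat -> nat -> poly) (k p : nat) : poly :=
  match k with
  | 3 => pmul (pX 1) (W 2 p)
  | 4 => W 0 p
  | 5 => W 1 p
  | 6 => pmul (pX 0) (W 2 p)
  | _ => [::]
  end%N.

Definition tilt_forms (W : nat -> nat -> poly) (i j k : nat) : poly :=
  let w := tilt_component W k in
  match i, j with
  | 0, 1 => w 0 | 0, 2 => w 1 | 1, 2 => w 2
  | (0 | 1 | 2), 3 => pmul (pX 0) (w (3 + i))
  | (0 | 1 | 2), 6 => pscale (-1) (pmul (pX 1) (w (3 + i)))
  | _, _ => [::] end%N.

Definition tilt_generic (a p : nat) : poly := pX (2 + 6 * a + p).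

(** The shape forced by coclosedness: only [e^{13}], [e^{23}] and [e^3 n] occur, and their
    coefficients form a [3 x 3] matrix that becomes symmetric when the second row changes sign. *)
Definition tilt_symmetric (a p : nat) : poly :=
  match a, p with
  | 0, 1 => pX 3 | 0, 2 => pX 4 | 0, 5 => pX 7
  | 1, 1 => pscale (-1) (pX 4) | 1, 2 => pX 10 | 1, 5 => pX 13
  | 2, 1 => pX 7 | 2, 2 => pscale (-1) (pX 13) | 2, 5 => pX 19
  | _, _ => [::] end%N.

Definition tilt_system1 : seq poly := equations (tilt_forms tilt_generic)
  [:: [:: 0; 1; 2; 4; 5]; [:: 0; 2; 4; 5; 6]; [:: 1; 2; 4; 5; 6]; [:: 0; 2; 3; 4; 6];
      [:: 0; 2; 3; 5; 6]; [:: 1; 2; 3; 4; 6]; [:: 1; 2; 3; 5; 6]; [:: 0; 1; 2; 4; 6];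
      [:: 0; 1; 2; 5; 6]; [:: 0; 1; 2; 3; 4]; [:: 0; 1; 2; 3; 5]; [:: 0; 1; 2; 3; 6]]%N
  [::].
Definition tilt_system2 : seq poly := equations (tilt_forms tilt_symmetric) [::]
  [:: (4, 0, 2); (0, 2, 4); (1, 2, 5); (5, 1, 2); (6, 0, 1); (3, 2, 6); (6, 4, 5)]%N.

Definition tilt_eqs1 := Eval vm_compute in tilt_system1.
Definition tilt_eqs2 := Eval vm_compute in tilt_system2.

Lemma tilt_eqsE : tilt_system1 = tilt_eqs1 /\ tilt_system2 = tilt_eqs2.
Proof. by split; vm_compute. Qed.

Section TiltAlgebra.
Variables (R : realType) (e : nat -> R).

Lemma tilt_symmetricP : all (fun q => ev e q == 0) tilt_eqs1 -> e 1%N != 0 ->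
  forall a p, (a < 3)%N -> (p < 6)%N ->
  ev e (tilt_generic a p) = ev e (tilt_symmetric a p).
Proof.
rewrite /tilt_eqs1 /ev /= !zr_neg !zr_pos /= => H nz1.
(* Variable 1 is [s], the nonzero component of the tilt. *)
have cancel t : e 1%N * t = 0 -> t = 0.
  by move=> /eqP; rewrite mulf_eq0 (negbTE nz1) => /eqP.
case/and5P: H => /eqP h1 /eqP h2 /eqP h3 /eqP h4.
case/and5P=> /eqP h5 /eqP h6 /eqP h7 /eqP h8 /and5P[/eqP h9 /eqP h10 /eqP h11 /eqP h12 _].
have z14 : e 14%N = 0 by apply: cancel; lra.
have z17 : e 17%N = 0 by do 2!apply/cancel; lra.
have z18 : e 18%N = 0 by do 2!apply/cancel; lra.
have z11 : e 11%N = 0 by apply: cancel; lra.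
have z5 : e 5%N = 0 by apply: cancel; lra.
have z12 : e 12%N = 0 by apply: cancel; lra.
have z6 : e 6%N = 0 by apply: cancel; lra.
rewrite z17 in h8 h10; rewrite z18 in h9 h11; rewrite z5 z12 in h12.
have z16 : e 16%N = - e 13%N.
  have : e 13%N + e 16%N = 0 by apply: cancel; lra.
  by lra.
have z15 : e 15%N = e 7%N.
  have : e 7%N - e 15%N = 0 by apply: cancel; lra.
  by lra.
rewrite z16 in h10; rewrite z15 in h11.
have z8 : e 8%N = 0 by lra.
have z2 : e 2%N = 0 by lra.
have z9 : e 9%N = - e 4%N by lra.
clear nz1 cancel h1 h2 h3 h4 h5 h6 h7 h8 h9 h10 h11 h12.
by case=> [|[|[|//]]] [|[|[|[|[|[|//]]]]]] _ _; rewrite /= ?zr_neg ?zr_pos /=; lra.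
Qed.

Lemma tilt_zero : all (fun q => ev e q == 0) tilt_eqs2 ->
  e 0%N ^+ 2 + e 1%N ^+ 2 = 1 -> [/\ e 3%N = 0, e 4%N = 0 & e 7%N = 0].
Proof.
rewrite /tilt_eqs2 /ev /= !zr_neg !zr_pos /= => H cs.
have hs : e 1%N * e 1%N = 1 - e 0%N * e 0%N by lra.
case/and5P: H => /eqP h1 /eqP h2 /eqP h3 /eqP h4 /and4P[/eqP h5 /eqP h6 /eqP h7 _].
set c := e 0%N in hs h1 h2 h3 h4 h5 h6 h7; set s := e 1%N in hs h1 h2 h3 h4 h5 h6 h7.
set a := e 3%N in h1 h2 h3 h4 h5 h6 h7 *; set B := e 4%N in h1 h2 h3 h4 h5 h6 h7 *.
set C := e 7%N in h1 h2 h3 h4 h5 h6 h7 *; set D := e 10%N in h1 h2 h3 h4 h5 h6 h7.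
set E := e 13%N in h1 h2 h3 h4 h5 h6 h7; set F := e 19%N in h1 h2 h3 h4 h5 h6 h7.
clearbody c s a B C D E F.
have X1 : - 2 * F ^+ 2 + 2 * a * F - 2 * D * F - 6 * E ^+ 2 + 4 * a ^+ 2 - 2 * D ^+ 2
    - 2 * a * D = 0
  by have := congr2 +%R h1 h2; rewrite [X in _ = X -> _]addr0 => <-; ring: hs.
have X2 : 2 * F ^+ 2 - 2 * a * F + 2 * D * F + 6 * C ^+ 2 + 2 * a ^+ 2 - 4 * D ^+ 2
    + 2 * a * D = 0
  by have := congr2 +%R h3 h4; rewrite [X in _ = X -> _]addr0 => <-; ring: hs.
have Y : C ^+ 2 + E ^+ 2 = (- 2 * F ^+ 2 + 2 * (a - D) * F + (a - D) ^+ 2) / 3 by lra.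
have Z5 : - 2 * F ^+ 2 * c ^+ 2 - 3 * c ^+ 2 * (C ^+ 2 + E ^+ 2)
    - (1 - c ^+ 2) * (a - D) * F - (a - D) ^+ 2 = 0 by rewrite -h5; ring: hs.
have Z6 : - 4 * F ^+ 2 * (1 - c ^+ 2) - 2 * c ^+ 2 * (a - D) * F
    + 3 * (2 * c ^+ 2 - 1) * (C ^+ 2 + E ^+ 2) + (a - D) ^+ 2 = 0.
  by rewrite -h6; ring: hs.
(* After substituting [Y], [Z5] reads [- (1 + c^2) r t = 0], and given [r t = 0], [Z6] reads
   [- 2 F t = 0]; hence [t^2 = 0]. *)
rewrite Y in Z5 Z6; pose r := a - D; pose t := r + F.
have rt : r * t = 0.
  have nz : 1 + c ^+ 2 != 0 by rewrite gt_eqF // ltr_pwDl ?ltr01 ?sqr_ge0.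
  by apply: (mulfI nz); rewrite mulr0 /t /r; lra.
have Ft : F * t = 0.
  have cut : c ^+ 2 * (r * t) = 0 by rewrite rt mulr0.
  by move: cut; rewrite /t /r; lra.
have t0 : t = 0.
  by apply/eqP; rewrite -sqrf_eq0 expr2 {1}/t mulrDl rt Ft addr0.
have FE : F = D - a by move: t0; rewrite /t /r; lra.
have := (sqr_ge0 C, sqr_ge0 E, sqr_ge0 (a - D)) => -[[C0 E0] r0].
have z u : u ^+ 2 <= 0 -> u = 0 :> R.
  by move=> le0; apply/eqP; rewrite -sqrf_eq0 eq_le le0 sqr_ge0.
(* Now [Y] says [C^2 + E^2 = - (a - D)^2]. *)
move: Y; rewrite FE => Y.
have Cz : C = 0 by apply: z; lra.
have Ez : E = 0 by apply: z; lra.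
have rz : a - D = 0 by apply: z; lra.
have Fz : F = 0 by lra.
have Da : D = a by lra.
move: h7; rewrite Fz Cz Ez Da => h7.
have := (sqr_ge0 a, sqr_ge0 B) => -[a0 B0].
by split=> //; apply: z; lra.
Qed.

End TiltAlgebra.

(** * Recognition of the Lie algebra *)

Section InstantonFrame.
Variables (R : realType) (g : lieAlgebra R) (phi : kform g 3).
Variables (met : g -> g -> R) (vol : kform g 7) (b : 7.-tuple g).
Variables (nabla nabla1 : g -> g -> g) (v : 7.-tuple g).
Hypotheses (dim7 : \dim {:g} = 7%N) (hnil : two_step_nilpotent g).
Hypotheses (mphi : multilinear phi) (gmv : G2_metric_volume phi met vol).
Hypothesis onb : orthonormal_tuple met b.
Hypothesis lc : levi_civita met nabla.
Hypothesis conn : connection_with_torsion met nabla (torsion b vol phi) nabla1.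
Hypothesis cc : coclosed b vol phi.
Hypothesis inst : G2_instanton met (psi_of b vol phi) nabla1.
Hypothesis rphi : repZ v phi phiZ.

Lemma metric_inner_product : inner_product met. Proof. by have [] := gmv. Qed.
Let ip := metric_inner_product.

Lemma met_frame i j : (i < 7)%N -> (j < 7)%N -> met v`_i v`_j = (i == j)%:R.
Proof.
move=> lti ltj; have [onv _] := frame_orthonormal gmv rphi.
by have := onv (Ordinal lti) (Ordinal ltj); rewrite !(tnth_nth 0).
Qed.

Lemma frame_decomposition x : x = \sum_(i <- iota 0 7) met x v`_i *: v`_i.
Proof.
have [onv _] := frame_orthonormal gmv rphi.
rewrite {1}(orthonormal_expand ip dim7 onv x) big_iota_ord.
by apply: eq_bigr => i _; rewrite (tnth_nth 0).
Qed.

(** The bridge from geometry to algebra: once the brackets of the frame have the shape [p], the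
    printed equations hold at the actual coefficients. *)
Lemma structure_equations p ls ms (env : nat -> R) :
  all (fun l => (size l == 5%N) && all (ltn^~ 7%N) l) ls ->
  all (fun m => [&& m.1.1 < 7, m.1.2 < 7 & m.2 < 7])%N ms ->
  (forall i j k : nat, (i < j < 7)%N -> (k < 7)%N ->
     met (lie_br v`_i v`_j) v`_k = - ev env (p i j k)) ->
  all (fun q => ev env q == 0) (equations p ls ms).
Proof.
move=> ls5 ms7 hp.
have hc : forall i j k : 'I_7,
    ev env (deP p i j k) = met (lie_br (tnth v i) (tnth v j)) (tnth v k).
  apply: deP_bracket => [i k|i j k|i j k ltij].
  - by rewrite lie_brxx (met0l ip).
  - by rewrite lie_brC (metNl ip).
  by rewrite !(tnth_nth 0) hp ?ltij ?ltn_ord.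
have [dp ins] := frame_equations dim7 mphi gmv onb lc conn rphi hc cc inst.
exact: equationsP.
Qed.

Lemma frame_span_basis (s : 7.-tuple g) :
  (forall i, (i < 7)%N -> v`_i \in <<s>>%VS) -> basis_of fullv s.
Proof.
move=> vs; rewrite basisEdim size_tuple dim7 leqnn andbT.
apply/subvP => x _; rewrite (frame_decomposition x) big_seq.
by apply: memv_suml => i; rewrite mem_iota => /andP[_ /vs]; apply: memvZ.
Qed.

Lemma met_span (s : seq g) w u : u \in <<s>>%VS ->
  (forall t, t \in s -> met t w = 0) -> met u w = 0.
Proof.
move=> su s0; rewrite (coord_span (X := in_tuple s) su) (met_suml ip) big1 // => i _.
by rewrite (metZl ip) s0 ?mulr0 ?mem_nth.
Qed.

Lemma br_frame0 y : (forall i, (i < 7)%N -> lie_br v`_i y = 0) -> forall x, lie_br x y = 0.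
Proof.
move=> y0 x; rewrite (frame_decomposition x) big_iota_ord lie_br_suml big1 // => i _.
by rewrite y0 ?scaler0.
Qed.

Lemma met_br_frame0 u :
  (forall i j, (i < 7)%N -> (j < 7)%N -> met (lie_br v`_i v`_j) u = 0) ->
  forall x y, met (lie_br x y) u = 0.
Proof.
move=> u0 x y;
rewrite (frame_decomposition x) (frame_decomposition y) !big_iota_ord.
rewrite lie_br_suml (met_suml ip) big1 // => i _.
rewrite (metZl ip) lie_br_sumr (met_suml ip) big1 ?mulr0 // => j _.
by rewrite (metZl ip) u0 ?mulr0.
Qed.

(** The eight components of [d psi] in [plane_eqs] are linear and force all brackets with [e_7] to
    vanish, which brings this case under [quat_forms]. *)
Lemma plane_central : derived g = <<[:: v`_4; v`_5]>>%VS ->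
  forall x, lie_br x v`_6 = 0.
Proof.
move=> UE.
have met_br x y k : (k < 7)%N -> k \notin [:: 4; 5]%N -> met (lie_br x y) v`_k = 0.
  move=> ltk; rewrite !inE negb_or => /andP[n4 n5].
  have := br_derived x y; rewrite UE => /met_span; apply=> t.
  by rewrite !inE => /orP[] /eqP ->; rewrite met_frame // eq_sym ?(negbTE n4) ?(negbTE n5).
have U4 : v`_4 \in derived g by rewrite UE; apply: memv_span; rewrite inE eqxx.
have U5 : v`_5 \in derived g by rewrite UE; apply: memv_span; rewrite !inE eqxx orbT.
pose e n := if (n < 28)%N then - met (lie_br v`_(n %/ 7) v`_(n %% 7)) v`_4
  else - met (lie_br v`_((n - 28) %/ 7) v`_((n - 28) %% 7)) v`_5.
have: all (fun q => ev e q == 0) plane_eqs.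
  rewrite -plane_eqsE; apply: structure_equations => // i j k /andP[ltij ltj] ltk.
  rewrite /plane_forms; case: (boolP (k \in [:: 4; 5]%N)) => [k45|nk]; last first.
    by rewrite !andbF oppr0 met_br.
  have C t : (t \in [:: 4; 5])%N -> v`_t \in derived g.
    by rewrite !inE => /orP[] /eqP ->.
  case: ltnP => [lti|lei]; last first.
    rewrite (derived_central' hnil) ?(met0l ip) ?oppr0 // C //.
    have lti6 : (i < 6)%N := leq_trans ltij ltj.
    by case: i lei lti6 {ltij} => [|[|[|[|[|[|i]]]]]].
  case: (boolP ((j < 4) || (j == 6))%N) => [_|]; last first.
    rewrite negb_or -leqNgt => /andP[lej nj].
    rewrite (derived_central hnil) ?(met0l ip) ?oppr0 // C //.
    by case: j ltj {ltij} lej nj => [|[|[|[|[|[|[|j]]]]]]].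
  have lt28 : (7 * i + j < 28)%N.
    by rewrite -[28%N]/(7 * 3 + 7)%N -addnS leq_add // leq_mul2l /= -ltnS.
  have [divij modij] : ((7 * i + j) %/ 7 = i)%N /\ ((7 * i + j) %% 7 = j)%N.
    by rewrite mulnC divnMDl // modnMDl divn_small // modn_small // addn0.
  have ge28 : (28 + (7 * i + j) < 28)%N = false by rewrite ltnNge leq_addr.
  rewrite ev_pX /e -[(28 + 7 * i + j)%N]addnA.
  move: k45; rewrite !inE => /orP[] /eqP ->; rewrite ?eqxx.
    by rewrite lt28 divij modij opprK.
  by rewrite ge28 addKn divij modij opprK.
rewrite /plane_eqs /ev /= !zr_neg !zr_pos /= /e /= => H.
apply: br_frame0 => i lti; apply: (met_eq0 ip).
have := br_derived v`_i v`_6; rewrite {1}UE => /met_span; apply=> t tU.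
have [lti4|le4i] := ltnP i 4; last first.
  have [->|n6] := eqVneq i 6%N; first by rewrite lie_brxx (met0r ip).
  rewrite (derived_central' hnil) ?(met0r ip) //.
  by case: i lti le4i n6 => [|[|[|[|[|[|[|i]]]]]]].
rewrite (metC ip); case/and5P: H => /eqP h1 /eqP h2 /eqP h3 /eqP h4.
case/and5P=> /eqP h5 /eqP h6 /eqP h7 /eqP h8 _.
move: tU; rewrite !inE => /orP[] /eqP ->.
all: by case: i lti4 {lti} => [|[|[|[|//]]]] _; lra.
Qed.

Lemma quaternionic_constants :
  (forall x y k, (k < 4)%N -> met (lie_br x y) v`_k = 0) ->
  (forall x k, (4 <= k < 7)%N -> lie_br x v`_k = 0) ->
  exists m N,
    (forall i j a, (i < 4)%N -> (j < 4)%N -> (a < 3)%N ->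
       met (lie_br v`_i v`_j) v`_(4 + a) = - quat_value m N a i j) /\
    (forall a b, (a < 3)%N -> (b < 3)%N -> m * N a b = minus_cofactor N a b).
Proof.
move=> hU hc; pose D a i j := - met (lie_br v`_i v`_j) v`_(4 + a).
pose M a := [:: (D a 0%N 2%N - D a 1%N 3%N) / 2; - (D a 0%N 3%N + D a 1%N 2%N) / 2;
                (D a 0%N 1%N + D a 2%N 3%N) / 2].
pose N a := [:: (D a 0%N 2%N + D a 1%N 3%N) / 2; (D a 1%N 2%N - D a 0%N 3%N) / 2;
                (D a 0%N 1%N - D a 2%N 3%N) / 2].
pose e := nth 0 (M 0%N ++ M 1%N ++ M 2%N ++ N 0%N ++ N 1%N ++ N 2%N).
(* Any shape [P] that takes the same values as the generic one describes the same brackets, so each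
   simplification of [M] can be fed back into the equations. *)
have hp (P : nat -> nat -> poly) :
    (forall a b, (a < 3)%N -> (b < 3)%N -> ev e (matP 0 a b) = ev e (P a b)) ->
    forall i j k : nat, (i < j < 7)%N -> (k < 7)%N ->
     met (lie_br v`_i v`_j) v`_k = - ev e (quat_forms P (matP 9) i j k).
  move=> MP i j k /andP[ltij ltj] ltk; rewrite /quat_forms.
  case: (leqP 4 k) => [le4k|lt]; last by rewrite hU // /ev /= oppr0.
  have [lej|ltj4] := leqP 4 j.
    rewrite hc ?lej // (met0l ip); move: ltij lej ltj.
    by case: i j => [|[|[|[|i]]]] [|[|[|[|j]]]] // _ _ _; rewrite /ev /= oppr0.
  have lta : (k - 4 < 3)%N by rewrite ltn_subLR.
  rewrite -{1}(subnKC le4k); move: lta; set a := (k - 4)%N => lta.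
  have E x y : met (lie_br v`_x v`_y) v`_(4 + a) = - D a x y by rewrite opprK.
  have eM t : (t < 3)%N -> e (0 + 3 * a + t)%N = (M a)`_t.
    by case: a lta t {E} => [|[|[|//]]] _ [|[|[|//]]].
  have eN t : (t < 3)%N -> e (9 + 3 * a + t)%N = (N a)`_t.
    by case: a lta t {E eM} => [|[|[|//]]] _ [|[|[|//]]].
  clearbody D; case: i j ltij ltj ltj4 => [|[|[|i]]] [|[|[|[|j]]]] // _ _ _;
    rewrite ?ev_pscale ?ev_padd ?ev_pscale -?MP // ?ev_pX ?zr_neg ?zr_pos /=;
    by rewrite ?eM ?eN //= E; field.
clearbody e; have [E1 E2 E3] := quat_eqsE.
have sym : forall a b, (a < 3)%N -> (b < 3)%N -> ev e (matP 0 a b) = ev e (symP 0 a b).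
  apply: quat_symmetric; rewrite -E1; apply: structure_equations; [by []|by []|].
  exact: (hp (matP 0) (fun _ _ _ _ => erefl)).
have sc a b' : (a < 3)%N -> (b' < 3)%N -> ev e (matP 0 a b') = ev e (scalarP 0 a b').
  move=> lta ltb; rewrite (sym _ _ lta ltb); apply: (quat_scalar _ lta ltb).
  rewrite -E2; apply: structure_equations; [by []|by []|exact: (hp _ sym)].
exists (e 0%N), (fun a t => e (9 + 3 * a + t)%N); split=> [i j a lti ltj lta|]; last first.
  apply: quat_cofactor; rewrite -E3; apply: structure_equations; [by []|by []|exact: (hp _ sc)].
wlog ltij : i j lti ltj / (i < j)%N => [H|].
  case: (ltngtP i j) => [ltij|ltji|<-]; first exact: H.
    rewrite lie_brC (metNl ip) (H _ _ ltj lti ltji) /quat_value ltji.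
    by rewrite ltnNge (ltnW ltji).
  rewrite lie_brxx (met0l ip) /quat_value ltnn opprK.
  by case: i lti {ltj} => [|[|[|[|]]]].
have lt47 : (4 + a < 7)%N by rewrite -[7%N]/(4 + 3)%N ltn_add2l.
have ltij7 : (i < j < 7)%N by rewrite ltij (ltn_trans ltj).
rewrite (hp _ sc _ _ _ ltij7 lt47) /quat_forms leq_addr addKn.
rewrite /quat_value ltij.
congr (- _); case: i j ltij ltj {lti ltij7} => [|[|[|i]]] [|[|[|[|j]]]] ltij ltj.
all: try discriminate ltij; try discriminate ltj; clear ltij ltj.
all: rewrite ?ev_pscale ?ev_padd ?ev_pscale ?ev_pX ?zr_neg ?zr_pos /=.
all: rewrite /scalarP; case: a lta lt47 => [|[|[|//]]] _ _; rewrite /= ?ev_pX /ev /=.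
all: by ring.
Qed.

(** The bracket is a two-form [B] on the first six frame vectors times [e_7]. Splitting off
    symplectic planes, rank 2 is impossible, rank 4 gives [R^2 + h_5] and rank 6 gives [h_7]. *)
Lemma line_case : derived g = <<[:: v`_6]>>%VS ->
  lie_isomorphic g (lie_dsum (lie_abelian R 2) (heisenberg R 2)) \/
  lie_isomorphic g (heisenberg R 3).
Proof.
move=> UE; pose B x y := met (lie_br x y) v`_6.
have U6 : v`_6 \in derived g by rewrite UE; apply: memv_span; rewrite inE eqxx.
have brE x y : lie_br x y = B x y *: v`_6.
  have := br_derived x y; rewrite UE span_seq1 => /vlineP[t Et].
  by rewrite /B Et (metZl ip) met_frame // mulr1.
have Bl t x y z : B (t *: x + y) z = t * B x z + B y z.
  by rewrite /B lie_brDZl (metDZl ip).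
have Br t x y z : B z (t *: x + y) = t * B z x + B z y.
  by rewrite /B lie_brDZr (metDZl ip).
have Bxx x : B x x = 0 by rewrite /B lie_brxx (met0l ip).
have BC x y : B y x = - B x y by rewrite /B lie_brC (metNl ip).
have B6 x : B x v`_6 = 0 by rewrite /B (derived_central hnil) // (met0l ip).
have B6' x : B v`_6 x = 0 by rewrite BC B6 oppr0.
pose e n := - B v`_(n %/ 7) v`_(n %% 7).
have eE i j : (j < 7)%N -> e (7 * i + j)%N = - B v`_i v`_j.
  by move=> ltj; rewrite /e mulnC divnMDl // divn_small // addn0 modnMDl modn_small.
have [] := @line_algebra R e.
  rewrite -line_eqsE; apply: structure_equations => // i j k /andP[ltij ltj] ltk.
  rewrite brE (metZl ip) met_frame // /line_forms eq_sym.
  case: eqP => _; last by rewrite mulr0 oppr0.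
  rewrite mulr1 andTb; case: ltnP => [_|le6]; first by rewrite ev_pX eE // opprK.
  have -> : j = 6%N by apply/eqP; rewrite eqn_leq le6 -ltnS ltj.
  by rewrite B6 oppr0.
move=> [h1 h2 h3] [h4 h5 h6 h7].
pose W := <<[:: v`_0; v`_1; v`_2; v`_3; v`_4; v`_5]>>%VS.
have vW i : (i < 6)%N -> v`_i \in W.
  by case: i => [|[|[|[|[|[|//]]]]]] _; apply: memv_span; rewrite !inE eqxx ?orbT.
have Brsum z r (F : nat -> R) (x : nat -> g) :
    B z (\sum_(i <- r) F i *: x i) = \sum_(i <- r) F i * B z (x i).
  elim/big_rec2: _ => [|i s y _ <-]; last by rewrite Br.
  by have := Br (-1) 0 0 z; rewrite scaler0 addr0 mulN1r addNr.
have dimW : \dim W = 6%N.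
  apply/eqP; rewrite -[_ == _]/(free [:: v`_0; v`_1; v`_2; v`_3; v`_4; v`_5]).
  apply: (@orthogonal_free _ _ _ ip 6 [tuple v`_0; v`_1; v`_2; v`_3; v`_4; v`_5]).
    by case=> [[|[|[|[|[|[|//]]]]]] ?]; case=> [[|[|[|[|[|[|//]]]]]] ?] //= _;
      rewrite met_frame.
  by case=> [[|[|[|[|[|[|//]]]]]] ?] //=; rewrite met_frame // oner_eq0.
have nz6 : v`_6 != 0.
  apply/eqP => v0; have := @met_frame 6 6 isT isT.
  by rewrite v0 (met0l ip) => /esym/eqP; rewrite oner_eq0.
have nondeg : ~ forall i j : nat, (i < 6)%N -> (j < 6)%N -> B v`_i v`_j = 0.
  move=> B0; case/eqP: nz6; apply: (derived_nondegenerate ip) => // x y.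
  have B0' z i : (i < 7)%N -> B z v`_i = 0.
    rewrite ltnS leq_eqVlt => /orP[/eqP -> //|lti].
    rewrite BC (frame_decomposition z) Brsum big_seq big1 ?oppr0 // => j.
    rewrite mem_iota => /andP[_]; rewrite add0n ltnS leq_eqVlt => /orP[/eqP ->|ltj].
      by rewrite B6 mulr0.
    by rewrite B0 // mulr0.
  rewrite -/(B x y) (frame_decomposition y) Brsum big_seq big1 // => j.
  by rewrite mem_iota => /andP[_ ltj]; rewrite B0' // mulr0.
have [B0|] := symplectic_plane W Bl Br Bxx.
  by case: nondeg => i j lti ltj; apply: B0; apply: vW.
case=> x1 [y1 [W1 [Wx1 Wy1 B11 dimW1 W1P]]].
have W1B w : w \in W1 -> [/\ B x1 w = 0, B y1 w = 0, B w x1 = 0 & B w y1 = 0].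
  by move=> /(proj1 (W1P w)) [_ xw yw]; rewrite !(BC _ w) xw yw oppr0.
have Zr t z p : B z (t *: p) = t * B z p.
  by have := Br t p 0 z; rewrite addr0 => ->; rewrite {2}/B lie_brC
    -(scale0r (0 : g)) lie_brZl scale0r oppr0 (met0l ip) addr0.
have Ar z p q : B z (p + q) = B z p + B z q.
  by have := Br 1 p q z; rewrite scale1r mul1r.
have dec (x y w : g) (W' : {vspace g}) : w - B w y *: x + B w x *: y \in W' ->
    exists2 w', w' \in W' & w = B w y *: x + (- B w x) *: y + w'.
  move=> Ww; exists (w - B w y *: x + B w x *: y) => //.
  by rewrite scaleNr [RHS]addrC -addrA [X in _ + X]addrCA subrr addr0 subrK.
have W1dec w : w \in W -> exists2 w', w' \in W1 & w = B w y1 *: x1 + (- B w x1) *: y1 + w'.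
  by move=> /(proj2 (W1P w))/dec.
have [B0|] := symplectic_plane W1 Bl Br Bxx.
  pose al i := B v`_i x1; pose be i := B v`_i y1.
  have Fij i j : (i < 6)%N -> (j < 6)%N ->
      B v`_i v`_j = al i * be j - be i * al j.
    move=> /vW/W1dec[wi Wi Ei] /vW/W1dec[wj Wj Ej]; rewrite {1}Ei {1}Ej.
    have [i1 i2 i3 i4] := W1B _ Wi; have [j1 j2 j3 j4] := W1B _ Wj.
    have Al z p q : B (p + q) z = B p z + B q z by rewrite !(BC z) Ar opprD.
    have Zl t z p : B (t *: p) z = t * B p z by rewrite !(BC z) Zr mulrN.
    rewrite !(Al, Ar, Zl, Zr) !Bxx B11 (BC x1 y1) B11 (B0 wi wj) // i3 i4 j1 j2.
    by rewrite /al /be; ring.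
  have eij i j : (j < 7)%N -> B v`_i v`_j = - e (7 * i + j)%N.
    by move=> ltj; rewrite eE // opprK.
  case: nondeg => i j lti ltj; apply: (@rank_two_algebra R (fun i j => B v`_i v`_j)) => //.
  - exact: Fij.
  - by rewrite !eij // h1.
  - by rewrite !eij // h2.
  - by rewrite !eij // h3 opprK.
  - by rewrite !eij // h4.
  - by rewrite !eij // h5 opprK.
  - by rewrite !eij // h6.
  - have h7' : e (7 * 0 + 1)%N + e (7 * 2 + 3)%N + e (7 * 4 + 5)%N = 0 := h7.
    by rewrite !eij //; lra.
case=> x2 [y2 [W2 [Wx2 Wy2 B22 dimW2 W2P]]].
have W2W1 w : w \in W2 -> w \in W1 by move=> /(proj1 (W2P w))[].
have W2B w : w \in W2 -> [/\ B x2 w = 0, B y2 w = 0, B w x2 = 0 & B w y2 = 0].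
  by move=> /(proj1 (W2P w)) [_ xw yw]; rewrite !(BC _ w) xw yw oppr0.
have W2dec w : w \in W1 -> exists2 w', w' \in W2 & w = B w y2 *: x2 + (- B w x2) *: y2 + w'.
  by move=> /(proj2 (W2P w))/dec.
have [x1x2 y1x2 x2x1 x2y1] := W1B _ Wx2; have [x1y2 y1y2 y2x1 y2y1] := W1B _ Wy2.
have B11' : B y1 x1 = -1 by rewrite BC B11.
have B22' : B y2 x2 = -1 by rewrite BC B22.
have sp (s : 7.-tuple g) : x1 \in s -> y1 \in s -> x2 \in s -> y2 \in s ->
    v`_6 \in s -> (forall w, w \in W2 -> w \in <<s>>%VS) -> basis_of fullv s.
  move=> sx1 sy1 sx2 sy2 s6 sW2; apply: frame_span_basis => i.
  rewrite ltnS leq_eqVlt => /orP[/eqP -> |/vW/W1dec[w1 Ww1 ->]]; first exact: memv_span.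
  have [w2 Ww2 ->] := W2dec _ Ww1.
  by rewrite !memvD ?memvZ ?(sW2 _ Ww2) //; apply: memv_span.
have dim2 : \dim W2 = 2%N.
  by apply: (@addIn 4); rewrite -[RHS]/6%N -dimW dimW1 dimW2 -addnA.
have [B0|] := symplectic_plane W2 Bl Br Bxx.
  left; pose p := (vbasis W2)`_0; pose q := (vbasis W2)`_1.
  have Wp : p \in W2 by apply: vbasis_mem; rewrite mem_nth // size_tuple dim2.
  have Wq : q \in W2 by apply: vbasis_mem; rewrite mem_nth // size_tuple dim2.
  have [x1p y1p px1 py1] := W1B _ (W2W1 _ Wp); have [x1q y1q qx1 qy1] := W1B _ (W2W1 _ Wq).
  have [x2p y2p px2 py2] := W2B _ Wp; have [x2q y2q qx2 qy2] := W2B _ Wq.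
  (* The orders [y1, x1] and [x2, y2] produce the signs of [e^{12} - e^{34}], since [de^7 = - B]. *)
  apply: (model_isomorphic (f := [tuple y1; x1; x2; y2; p; q; v`_6]) (r2h5_model R)) => //.
    apply: sp; rewrite ?inE ?eqxx ?orbT // => w /coord_vbasis ->.
    apply: memv_suml => i _; apply/memvZ/memv_span.
    case: i => i; rewrite /= [X in (_ < X)%N]dim2.
    by case: i => [|[|//]] _; rewrite !inE eqxx ?orbT.
  move=> i j /andP[ltij ltj]; rewrite /r2h5_terms !big_cons big_nil /= brE.
  case: j i ltj ltij => [|[|[|[|[|[|[|//]]]]]]] [|[|[|[|[|[|//]]]]]] //= _ _.
  all: rewrite ?(B6, B11', B22, x1x2, y1x2, x1y2, y1y2, x1p, y1p, x2p, y2p, x1q, y1q).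
  all: rewrite ?(x2q, y2q, B0) ?addr0 ?scale0r ?opprK //.
case=> x3 [y3 [W3 [Wx3 Wy3 B33 dimW3 W3P]]]; right.
have [x1p y1p px1 py1] := W1B _ (W2W1 _ Wx3); have [x1q y1q qx1 qy1] := W1B _ (W2W1 _ Wy3).
have [x2p y2p px2 py2] := W2B _ Wx3; have [x2q y2q qx2 qy2] := W2B _ Wy3.
have W30 : W3 = 0%VS.
  by apply/eqP; rewrite -dimv_eq0 -(eqn_add2r 2) -dimW3 dim2.
(* Doubling [y3] produces the coefficient of [- 2 e^{56}]. *)
apply: (model_isomorphic (f := [tuple y1; x1; y2; x2; x3; 2 *: y3; v`_6]) (h7_model R)) => //.
  apply: sp; rewrite ?inE ?eqxx ?orbT // => w /(proj2 (W3P w)).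
  move=> /dec[w3]; rewrite W30 memv0 => /eqP -> ->; rewrite addr0.
  have -> (t : R) : t *: y3 = (t / 2) *: (2 *: y3).
    by rewrite scalerA divfK // pnatr_eq0.
  by apply: memvD; apply: memvZ; apply: memv_span; rewrite !inE eqxx ?orbT.
move=> i j /andP[ltij ltj]; rewrite /h7_terms !big_cons big_nil /= brE.
case: j i ltj ltij => [|[|[|[|[|[|[|//]]]]]]] [|[|[|[|[|[|//]]]]]] //= _ _.
all: rewrite ?Zr ?(B6, B11', B22', B33, x1x2, y1x2, x1y2, y1y2, x1p, y1p, x2p, y2p, x1q, y1q).
all: by rewrite ?(x2q, y2q, mulr0, mulr1) ?addr0 ?scale0r ?opprK.
Qed.

Section Constants.
Variables (m : R) (N : nat -> nat -> R).
Hypothesis hU : forall x y k, (k < 4)%N -> met (lie_br x y) v`_k = 0.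
Hypothesis hc : forall x k, (4 <= k < 7)%N -> lie_br x v`_k = 0.
Hypothesis br_met : forall i j a, (i < 4)%N -> (j < 4)%N -> (a < 3)%N ->
  met (lie_br v`_i v`_j) v`_(4 + a) = - quat_value m N a i j.
Hypothesis cof : forall a b, (a < 3)%N -> (b < 3)%N -> m * N a b = minus_cofactor N a b.

Lemma quat_degenerate u : u \in derived g ->
  (forall i j, (i < 4)%N -> (j < 4)%N -> met (lie_br v`_i v`_j) u = 0) -> u = 0.
Proof.
move=> Uu u0; apply: (derived_nondegenerate ip Uu) => x y.
have Uv i j : (i < 7)%N -> (j < 7)%N -> met (lie_br v`_i v`_j) u = 0.
  move=> lti ltj; have [le4j|ltj4] := leqP 4 j; first by rewrite hc ?le4j // (met0l ip).
  have [le4i|lti4] := leqP 4 i; last exact: u0.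
  by rewrite lie_brC hc ?le4i // oppr0 (met0l ip).
exact: (met_br_frame0 Uv).
Qed.

(** If [m = 0], the cofactors of the last row vanish, so the first two rows of [N] are proportional.
    This makes combinations of [e_5] and [e_6] orthogonal to all brackets, hence zero; row 0 must
    vanish, and then so does [e_5]. *)
Lemma quat_neq0 : v`_4 \in derived g -> v`_5 \in derived g -> m != 0.
Proof.
move=> U4 U5; apply/eqP => m0.
have br45 i j a : (i < 4)%N -> (j < 4)%N -> (a < 3)%N ->
    met (lie_br v`_i v`_j) v`_(4 + a) = - quat_value 0 N a i j by rewrite -m0; exact: br_met.
have minor s t : (s < 3)%N -> (t < 3)%N -> N 1%N s * N 0%N t = N 0%N s * N 1%N t.
  have := (cof (a := 2) (b := 0) isT isT, cof (a := 2) (b := 1) isT isT,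
    cof (a := 2) (b := 2) isT isT).
  rewrite m0 !mul0r /minus_cofactor /= => -[[c1 c2] c3].
  by case: s t => [|[|[|//]]] [|[|[|//]]] _ _; lra.
have row t : (t < 3)%N -> N 1%N t *: v`_4 - N 0%N t *: v`_5 = 0.
  move=> ltt; apply: quat_degenerate => [|i j lti ltj]; first by rewrite memvB ?memvZ.
  rewrite -scaleNr !(metDr ip, metZr ip) (br45 i j 0%N) ?(br45 i j 1%N) //.
  have := (minor 0%N t isT ltt, minor 1%N t isT ltt, minor 2%N t isT ltt).
  move=> [[m1 m2] m3].
  by case: i j lti ltj => [|[|[|[|//]]]] [|[|[|[|//]]]] _ _; rewrite /quat_value /=; lra.
have N0 t : (t < 3)%N -> N 0%N t = 0.
  move=> ltt; have /(congr1 (met v`_5)) := row _ ltt.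
  rewrite -scaleNr !(metDr ip, metZr ip) !met_frame // (met0r ip) /=; lra.
have v40 : v`_4 = 0.
  apply: quat_degenerate => // i j lti ltj; rewrite (br45 i j 0%N) //.
  by case: i j lti ltj => [|[|[|[|//]]]] [|[|[|[|//]]]] _ _;
    rewrite /quat_value /= ?N0 //; lra.
have := met_frame (i := 4) (j := 4) isT isT.
by rewrite v40 (met0l ip) => /esym/eqP; rewrite oner_eq0.
Qed.

Lemma quat_bracket i j : (i < 4)%N -> (j < 4)%N -> lie_br v`_i v`_j =
  - quat_value m N 0 i j *: v`_4 - quat_value m N 1 i j *: v`_5
  - quat_value m N 2 i j *: v`_6.
Proof.
move=> lti ltj; rewrite [LHS]frame_decomposition !big_cons big_nil addr0.
rewrite (hU _ _ (isT : 0 < 4)%N) (hU _ _ (isT : 1 < 4)%N).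
rewrite (hU _ _ (isT : 2 < 4)%N) (hU _ _ (isT : 3 < 4)%N).
rewrite !scale0r !add0r (br_met lti ltj (isT : 0 < 3)%N) // (br_met lti ltj (isT : 1 < 3)%N) //.
by rewrite (br_met lti ltj (isT : 2 < 3)%N) // addrA !scaleNr.
Qed.

Lemma quat_iso : m != 0 -> (forall a b, (a < 3)%N -> (b < 3)%N -> N a b = 0) ->
  lie_isomorphic g (quat_heisenberg R).
Proof.
move=> nzm N0; pose f := [tuple v`_0; v`_1; v`_2; v`_3; m *: v`_4; m *: v`_5; m *: v`_6].
apply: (model_isomorphic (f := f) (quat_model R)) => //.
  apply: (frame_span_basis) => i lti.
  have fm t : t \in f -> t \in <<f>>%VS by apply: memv_span.
  have mfm t : m *: t \in f -> t \in <<f>>%VS.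
    by move=> /fm/(memvZ m^-1); rewrite scalerA mulVf // scale1r.
  by case: i lti => [|[|[|[|[|[|[|//]]]]]]] _; do 1?[by apply: fm; rewrite !inE eqxx ?orbT];
    apply: mfm; rewrite !inE eqxx ?orbT.
move=> i j /andP[ltij ltj]; have [le4j|ltj4] := leqP 4 j.
  have -> : lie_br f`_i f`_j = 0.
    by case: j le4j ltj {ltij} => [|[|[|[|[|[|[|//]]]]]]] //= _ _;
      rewrite lie_brZr hc ?scaler0.
  rewrite /quat_terms !big_cons big_nil /=.
  by case: i j ltij le4j ltj => [|[|[|[|i]]]] [|[|[|[|[|[|[|//]]]]]]].
have fv k : (k < 4)%N -> f`_k = v`_k by case: k => [|[|[|[|]]]].
rewrite !fv ?quat_bracket ?(ltn_trans ltij) // /quat_terms !big_cons big_nil.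
by case: j i ltj4 ltij {ltj} => [|[|[|[|//]]]] [|[|[|//]]] // _ _;
  rewrite /quat_value /= !N0 // ?mul0r ?mul1r ?addr0 ?add0r ?subr0 ?oppr0 ?scale0r
    ?subr0 ?add0r ?addr0 ?opprK ?scalerN ?scaleNr ?scale1r ?opprK ?oppr0 ?addr0.
Qed.

End Constants.

(** The central vector [x] replaces [v_j]. Only the other three vectors generate, so their three
    brackets span the three-dimensional derived algebra: it is free on three generators. *)
Lemma rn32_iso (a : nat -> R) j : derived g = <<[:: v`_4; v`_5; v`_6]>>%VS ->
  (j < 4)%N -> a j != 0 ->
  (forall y, lie_br (\sum_(i < 4) a i *: v`_i) y = 0) ->
  lie_isomorphic g (lie_dsum (lie_abelian R 1) (n32 R)).
Proof.
move=> UE ltj nzj; set x := \sum_(i < 4) _ => cx.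
have UvE i : (4 <= i < 7)%N -> v`_i \in derived g.
  rewrite UE => /andP[lei lti]; apply: memv_span.
  by case: i lei lti => [|[|[|[|[|[|[|//]]]]]]] // _ _; rewrite !inE eqxx ?orbT.
have [p [q [r others]]] : exists p q r : g, forall i, (i < 4)%N -> i != j -> v`_i \in [:: p; q; r].
  pose s := rem j (iota 0 4); exists v`_(nth 0%N s 0), v`_(nth 0%N s 1), v`_(nth 0%N s 2).
  by rewrite /s; case: j ltj {nzj s} => [|[|[|[|//]]]] _ [|[|[|[|//]]]] //= _ _;
    rewrite !inE eqxx ?orbT.
have gen (T : {vspace g}) : x \in T -> p \in T -> q \in T -> r \in T ->
    forall i, (i < 4)%N -> v`_i \in T.
  move=> xT pT qT rT.
  have oT i : (i < 4)%N -> i != j -> v`_i \in T.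
    by move=> lti /(others _ lti); rewrite !inE => /or3P[] /eqP ->.
  move=> i lti; have [->|] := eqVneq i j; last exact: oT.
  have -> : v`_j = (a j)^-1 *: (x - \sum_(i < 4 | i != Ordinal ltj) a i *: v`_i).
    by rewrite /x (bigD1 (Ordinal ltj)) //= addrK scalerA mulVf // scale1r.
  rewrite memvZ // memvB // memv_suml // => k nk; rewrite memvZ // oT //.
pose X := [:: x; p; q; r; v`_4; v`_5; v`_6].
have Xfull y : y \in <<X>>%VS.
  rewrite (frame_decomposition y) big_seq memv_suml // => i; rewrite mem_iota => /andP[_ lti].
  apply: memvZ; have [lti4|le4i] := ltnP i 4.
    by apply: gen lti4; apply: memv_span; rewrite !inE eqxx ?orbT.
  by apply: memv_span; case: i lti le4i => [|[|[|[|[|[|[|//]]]]]]] // _ _;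
    rewrite !inE eqxx ?orbT.
(* Order and signs are those of [rn32_terms], where [de^k] is minus the bracket. *)
pose f := [tuple x; p; q; r; lie_br p r; lie_br p q; - lie_br q r].
have fm t : t \in f -> t \in <<f>>%VS by apply: memv_span.
have fpq : lie_br p q \in <<f>>%VS by apply: fm; rewrite !inE eqxx ?orbT.
have fpr : lie_br p r \in <<f>>%VS by apply: fm; rewrite !inE eqxx ?orbT.
have fqr : lie_br q r \in <<f>>%VS by rewrite -memvN; apply: fm; rewrite !inE eqxx ?orbT.
have cX s : s \in X -> (forall y, lie_br s y = 0) \/ s \in [:: p; q; r].
  rewrite !inE => /orP[/eqP ->|]; first by left.
  have C i : (4 <= i < 7)%N -> s = v`_i -> forall y, lie_br s y = 0.
    by move=> /UvE Ui -> y; apply: derived_central'.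
  case/or4P=> [->|->|->|]; [by right|by right; rewrite orbT|by right; rewrite !orbT|].
  by case/or3P=> /eqP /C H; left; apply: H.
have US : (derived g <= <<f>>)%VS.
  apply: derived_sub => y z; apply: (@lie_br_span _ _ X) (Xfull y) (Xfull z).
  move=> s t /cX[s0|Hs] /cX[t0|Ht].
  - by rewrite s0 mem0v.
  - by rewrite s0 mem0v.
  - by rewrite lie_brC t0 oppr0 mem0v.
  move: Hs Ht; rewrite !inE => /or3P[] /eqP -> /or3P[] /eqP ->;
    by rewrite ?lie_brxx ?mem0v // lie_brC memvN.
apply: (model_isomorphic (f := f) (rn32_model R)) => //.
  apply: (frame_span_basis) => i lti; have [lti4|le4i] := ltnP i 4.
    by apply: gen lti4; apply: fm; rewrite !inE eqxx ?orbT.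
  by apply/(subvP US)/UvE; rewrite le4i.
move=> i k /andP[ltik ltk]; rewrite /rn32_terms !big_cons big_nil /=.
have cN (y s t : g) : lie_br y (- lie_br s t) = 0.
  by rewrite -scaleN1r lie_brZr hnil.2 scaler0.
have c (y s t : g) : lie_br y (lie_br s t) = 0 := hnil.2 y s t.
case: k i ltk ltik => [|[|[|[|[|[|[|//]]]]]]] [|[|[|[|[|[|//]]]]]] //= _ _.
all: by rewrite ?cx ?cN ?c ?addr0 ?opprK ?scale1r // ?scaleN1r ?opprK.
Qed.

Lemma quat_reduction : derived g = <<[:: v`_4; v`_5]>>%VS \/
    derived g = <<[:: v`_4; v`_5; v`_6]>>%VS ->
  exists m N,
    [/\ (forall x y k, (k < 4)%N -> met (lie_br x y) v`_k = 0),
        (forall x k, (4 <= k < 7)%N -> lie_br x v`_k = 0),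
        (forall i j a, (i < 4)%N -> (j < 4)%N -> (a < 3)%N ->
           met (lie_br v`_i v`_j) v`_(4 + a) = - quat_value m N a i j) &
        (forall a b, (a < 3)%N -> (b < 3)%N -> m * N a b = minus_cofactor N a b)].
Proof.
move=> UE.
have sub u : u \in derived g -> u \in <<[:: v`_4; v`_5; v`_6]>>%VS.
  case: UE => -> //; apply: subvP; apply: sub_span => t.
  by rewrite !inE => /orP[] ->; rewrite ?orbT.
have U4 : v`_4 \in derived g by case: UE => ->; apply: memv_span; rewrite inE eqxx.
have U5 : v`_5 \in derived g by case: UE => ->; apply: memv_span; rewrite !inE eqxx orbT.
have hU x y k : (k < 4)%N -> met (lie_br x y) v`_k = 0.
  move=> ltk; apply: (met_span (sub _ (br_derived x y))) => t.
  by rewrite !inE => /or3P[] /eqP ->; rewrite met_frame ?(ltn_trans ltk) //;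
    case: k ltk => [|[|[|[|]]]].
have c6 x : lie_br x v`_6 = 0.
  case: UE => UE.
    exact: (plane_central UE).
  by rewrite (derived_central hnil) // UE; apply: memv_span; rewrite !inE eqxx !orbT.
have hc x k : (4 <= k < 7)%N -> lie_br x v`_k = 0.
  by case: k => [|[|[|[|[|[|[|k]]]]]]] // _; rewrite ?(derived_central hnil) ?c6.
have [m [N [hbr cof]]] :=
  quaternionic_constants hU hc.
by exists m, N.
Qed.

(** No bracket has an [e_7] component, so [m + N 2 2] and [m - N 2 2] both vanish, against
    [quat_neq0]. *)
Lemma plane_case : derived g <> <<[:: v`_4; v`_5]>>%VS.
Proof.
move=> UE; have [m [N [hU hc hbr cof]]] := quat_reduction (or_introl UE).
have U4 : v`_4 \in derived g by rewrite UE; apply: memv_span; rewrite inE eqxx.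
have U5 : v`_5 \in derived g by rewrite UE; apply: memv_span; rewrite !inE eqxx orbT.
have := quat_neq0 hc hbr cof U4 U5; case/negP; apply/eqP.
have b6 i j : (i < 4)%N -> (j < 4)%N -> quat_value m N 2 i j = 0.
  move=> lti ltj; apply: oppr_inj; rewrite oppr0 -(hbr _ _ 2%N) //.
  apply: (met_span (u := lie_br v`_i v`_j) (s := [:: v`_4; v`_5])).
    by rewrite -UE br_derived.
  by move=> t; rewrite !inE => /orP[] /eqP ->; rewrite met_frame.
by have := (b6 0%N 1%N isT isT, b6 2%N 3%N isT isT); rewrite /quat_value /= => -[]; lra.
Qed.

Lemma quat_case : derived g = <<[:: v`_4; v`_5; v`_6]>>%VS ->
  lie_isomorphic g (quat_heisenberg R) \/
  lie_isomorphic g (lie_dsum (lie_abelian R 1) (n32 R)).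
Proof.
move=> UE; have [m [N [hU hc hbr cof]]] := quat_reduction (or_intror UE).
have U4 : v`_4 \in derived g by rewrite UE; apply: memv_span; rewrite inE eqxx.
have U5 : v`_5 \in derived g by rewrite UE; apply: memv_span; rewrite !inE eqxx orbT.
have nzm := quat_neq0 hc hbr cof U4 U5.
have [N0|ort] := quat_orthogonal cof nzm; [left|right].
  exact: (quat_iso hU hc hbr nzm N0).
(* The trace [4 m] is nonzero, so some column is a genuine kernel vector, with nonzero entry at
   [j]. *)
have [j ltj nzj] : exists2 j, (j < 4)%N & quat_kernel m N j j != 0.
  have tr : quat_kernel m N 0 0 + quat_kernel m N 1 1 + quat_kernel m N 2 2
      + quat_kernel m N 3 3 = 4 * m by rewrite /=; ring.
  have [q0|nz] := eqVneq (quat_kernel m N 0 0) 0; last by exists 0%N.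
  have [q1|nz] := eqVneq (quat_kernel m N 1 1) 0; last by exists 1%N.
  have [q2|nz] := eqVneq (quat_kernel m N 2 2) 0; last by exists 2%N.
  have [q3|nz] := eqVneq (quat_kernel m N 3 3) 0; last by exists 3%N.
  by case/eqP: nzm; move: tr; rewrite q0 q1 q2 q3; lra.
apply: (rn32_iso (a := fun i => quat_kernel m N i j) (j := j)) => // y.
have ker := quat_kernelP cof ort.
rewrite (frame_decomposition y) big_iota_ord lie_br_sumr big1 // => k _.
suff -> : lie_br (\sum_(i < 4) quat_kernel m N i j *: v`_i) v`_k = 0 by rewrite scaler0.
have [le4k|ltk4] := leqP 4 k; first by rewrite hc // le4k ltn_ord.
have br i (lti : (i < 4)%N) := quat_bracket hU hbr lti ltk4.
have c0 a : (a < 3)%N -> \sum_(i < 4) quat_kernel m N i j * quat_value m N a i k = 0.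
  by move=> lta; rewrite !big_ord_recl big_ord0 addr0 !addrA; apply: ker.
rewrite lie_br_suml; under eq_bigr => i _ do
  rewrite br // !scalerBr !scalerA mulrN.
by rewrite !big_split /= !sumrN -!scaler_suml sumrN !c0 // !(oppr0, scale0r, addr0).
Qed.

(** The equations annihilate [de^5]; then [e_5] is orthogonal to all brackets although it lies in
    the derived algebra. *)
Lemma tilt_case (c s : R) : s != 0 -> c ^+ 2 + s ^+ 2 = 1 ->
  derived g <> <<[:: v`_4; v`_5; (c *: v`_6 + s *: v`_3)%R]>>%VS.
Proof.
move=> nzs cs UE; pose w := c *: v`_6 + s *: v`_3; pose n := c *: v`_3 - s *: v`_6.
have Umem t : t \in [:: v`_4; v`_5; w] -> t \in derived g.
  by rewrite UE; apply: memv_span.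
have U4 : v`_4 \in derived g by apply: Umem; rewrite inE eqxx.
have U5 : v`_5 \in derived g by apply: Umem; rewrite !inE eqxx orbT.
have Uw : w \in derived g by apply: Umem; rewrite !inE eqxx !orbT.
(* In the plane of [v_3] and [v_6], [w] lies in the derived algebra and [n] is orthogonal to it; as
   [w] is central, brackets with both vectors reduce to brackets with [n]. *)
have v3E : v`_3 = c *: n + s *: w.
  rewrite /n /w scalerBr scalerDr !scalerA [s * c]mulrC addrA subrK -scalerDl.
  by rewrite -!expr2 cs scale1r.
have v6E : v`_6 = c *: w - s *: n.
  rewrite /n /w scalerBr scalerDr !scalerA opprB addrACA [s * c]mulrC subrr addr0.
  by rewrite -scalerDl -!expr2 cs scale1r.
pose D a x y := - met (lie_br x y) (nth 0 [:: v`_4; v`_5; w] a).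
have met_br x y k : (k < 7)%N -> met (lie_br x y) v`_k =
    - match k with
      | 3%N => s * D 2 x y | 4%N => D 0%N x y | 5%N => D 1%N x y | 6%N => c * D 2 x y
      | _ => 0 end.
  have met0 t : (forall u, u \in [:: v`_4; v`_5; w] -> met u t = 0) -> met (lie_br x y) t = 0.
    by apply: (met_span); rewrite -UE br_derived.
  have n0 : met (lie_br x y) n = 0.
    apply: met0 => u; rewrite !inE /n /w -scaleNr => /or3P[] /eqP ->;
      rewrite ?(metDl ip, metDr ip, metZl ip, metZr ip) !met_frame //=; ring.
  case: k => [|[|[|[|[|[|[|//]]]]]]] _; rewrite /D /= ?oppr0 ?mulrN ?opprK //.
  1-3: apply: met0 => u; rewrite !inE /w => /or3P[] /eqP ->;
    by rewrite ?(metDl ip, metZl ip) !met_frame //= ?mulr0 ?addr0.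
    by rewrite {1}v3E (metDr ip) !(metZr ip) n0 mulr0 add0r.
  by rewrite {1}v6E (metDr ip) (metNr ip) !(metZr ip) n0 mulr0 subr0.
have br3 x : lie_br x v`_3 = c *: lie_br x n.
  by rewrite v3E lie_brDr !lie_brZr [lie_br x w](derived_central hnil) // scaler0 addr0.
have br6 x : lie_br x v`_6 = - s *: lie_br x n.
  rewrite v6E lie_brDr -scaleNr !lie_brZr.
  by rewrite [lie_br x w](derived_central hnil) // scaler0 add0r.
have br36 : lie_br v`_3 v`_6 = 0.
  by rewrite br6 lie_brC br3 lie_brxx scaler0 oppr0 scaler0.
pose W a := [:: D a v`_0 v`_1; D a v`_0 v`_2; D a v`_1 v`_2; D a v`_0 n; D a v`_1 n;
                D a v`_2 n].
pose e := nth 0 ([:: c; s] ++ W 0%N ++ W 1%N ++ W 2%N).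
have e0 : e 0%N = c by [].
have e1 : e 1%N = s by [].
have hp (P : nat -> nat -> poly) :
    (forall a p, (a < 3)%N -> (p < 6)%N -> ev e (tilt_generic a p) = ev e (P a p)) ->
    forall i j k : nat, (i < j < 7)%N -> (k < 7)%N ->
     met (lie_br v`_i v`_j) v`_k = - ev e (tilt_forms P i j k).
  move=> PW i j k /andP[ltij ltj] ltk.
  have eW a p : (a < 3)%N -> (p < 6)%N -> ev e (P a p) = (W a)`_p.
    move=> lta ltp; rewrite -PW // ev_pX /e.
    by case: a p lta ltp => [|[|[|//]]] [|[|[|[|[|[|//]]]]]].
  clearbody e.
  have E p : (p < 6)%N -> ev e (tilt_component P k p) = 
      match k with
      | 3%N => s * (W 2%N)`_p | 4%N => (W 0%N)`_p | 5%N => (W 1%N)`_p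
      | 6%N => c * (W 2%N)`_p | _ => 0 end.
    move=> ltp; case: k ltk => [|[|[|[|[|[|[|//]]]]]]] _;
      by rewrite /tilt_component ?ev_pmul ?ev_pX ?e0 ?e1 ?eW.
  have br0 x y : lie_br x y = 0 -> met (lie_br x y) v`_k = - ev e [::].
    by move=> ->; rewrite (met0l ip) /ev /= oppr0.
  have b3 i' : (i' < 3)%N -> met (lie_br v`_i' v`_3) v`_k
      = - ev e (pmul (pX 0) (tilt_component P k (3 + i'))).
    move=> lti; rewrite br3 (metZl ip) met_br // ev_pmul ev_pX e0 E ?ltn_add2l // mulrN.
    by case: i' lti => [|[|[|]]].
  have b6 i' : (i' < 3)%N -> met (lie_br v`_i' v`_6) v`_k
      = - ev e (pscale (-1) (pmul (pX 1) (tilt_component P k (3 + i')))).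
    move=> lti; rewrite br6 (metZl ip) met_br // ev_pscale ev_pmul ev_pX e1 E ?ltn_add2l //.
    by rewrite zr_neg mulN1r opprK mulNr mulrN opprK; case: i' lti => [|[|[|]]].
  have [j4|n4] := eqVneq j 4%N.
    rewrite j4; case: i ltij => [|[|[|i]]] _; apply: br0; exact: (derived_central hnil).
  have [j5|n5] := eqVneq j 5%N.
    rewrite j5; case: i ltij => [|[|[|i]]] _; apply: br0; exact: (derived_central hnil).
  have bW i' j' p : (p < 6)%N -> (W 2%N)`_p = D 2 v`_i' v`_j' ->
      (W 1%N)`_p = D 1%N v`_i' v`_j' -> (W 0%N)`_p = D 0%N v`_i' v`_j' ->
      met (lie_br v`_i' v`_j') v`_k = - ev e (tilt_component P k p).
    by move=> ltp w2 w1 w0; rewrite (E _ ltp) w0 w1 w2 met_br.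
  clear E eW; case: j ltij ltj n4 n5 => [|[|[|[|[|[|[|j]]]]]]] ltij ltj n4 n5.
  all: try discriminate.
  - by case: i ltij => [_|//]; apply: bW.
  - by case: i ltij => [_|[_|//]]; apply: bW.
  - by case: i ltij => [_|[_|[_|//]]]; apply: b3.
  case: i ltij => [_|[_|[_|[_|i]]]]; [exact: b6|exact: b6|exact: b6|exact: br0|move: i].
  by case=> [|[|//]] _; apply: br0; exact: (derived_central' hnil).
clearbody e; have [E1 E2] := tilt_eqsE.
have sym : forall a p, (a < 3)%N -> (p < 6)%N ->
    ev e (tilt_generic a p) = ev e (tilt_symmetric a p).
  apply: tilt_symmetricP; last by rewrite e1.
  rewrite -E1; apply: structure_equations; [by []|by []|].
  exact: (hp tilt_generic (fun _ _ _ _ => erefl)).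
have [a0 B0 C0] : [/\ e 3%N = 0, e 4%N = 0 & e 7%N = 0].
  apply: tilt_zero; last by rewrite e0 e1.
  by rewrite -E2; apply: structure_equations; [by []|by []|exact: (hp _ sym)].
have v40 : v`_4 = 0.
  apply: (derived_nondegenerate ip U4) => x y.
  have z i j : (i < j < 7)%N -> met (lie_br v`_i v`_j) v`_4 = 0.
    move=> ltij; rewrite (hp _ sym i j 4%N ltij isT).
    have ev0 : ev e [::] = 0 by [].
    have S0 p : ev e (tilt_component tilt_symmetric 4 p) = 0.
      case: p => [|[|[|[|[|[|p]]]]]]; [exact: ev0| | |exact: ev0|exact: ev0| |exact: ev0].
      - exact: etrans (ev_pX e 3) a0.
      - exact: etrans (ev_pX e 4) B0.
      exact: etrans (ev_pX e 7) C0.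
    rewrite /tilt_forms; case: i {ltij} => [|[|[|i]]]; case: j => [|[|[|[|[|[|[|j]]]]]]];
      by rewrite ?ev_pscale ?ev_pmul ?S0 ?ev0 ?mulr0 oppr0.
  have z' i j : (i < 7)%N -> (j < 7)%N -> met (lie_br v`_i v`_j) v`_4 = 0.
    move=> lti ltj; case: (ltngtP i j) => [ltij|ltji|->].
    - by apply: z; rewrite ltij.
    - by rewrite lie_brC (metNl ip) (z j i) ?oppr0 ?ltji.
    by rewrite lie_brxx (met0l ip).
  exact: (met_br_frame0 z').
have := met_frame (i := 4) (j := 4) isT isT.
by rewrite v40 (met0l ip) => /esym/eqP; rewrite oner_eq0.
Qed.

End InstantonFrame.

Theorem corollary5p6 (R : realType) (g : lieAlgebra R)
    (hdim : \dim {:g} = 7%N) (hnil : two_step_nilpotent g) :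
  (exists (phi : kform g 3) (met : g -> g -> R) (vol : kform g 7)
          (b : 7.-tuple g) (nabla nabla1 : g -> g -> g),
     [/\ G2_structure phi,
         G2_metric_volume phi met vol /\ orthonormal_tuple met b,
         coclosed b vol phi,
         levi_civita met nabla /\
           connection_with_torsion met nabla (torsion b vol phi) nabla1 &
         G2_instanton met (psi_of b vol phi) nabla1])
  <->
  [\/ lie_isomorphic g (lie_dsum (lie_abelian R 2) (heisenberg R 2)),
      lie_isomorphic g (heisenberg R 3),
      lie_isomorphic g (quat_heisenberg R) |
      lie_isomorphic g (lie_dsum (lie_abelian R 1) (n32 R))].
Proof.
split=> [|[iso|iso|iso|iso]]; first last.
- exact: model_instanton hdim (rn32_model R) rn32_checks iso.
- exact: model_instanton hdim (quat_model R) quat_checks iso.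
- exact: model_instanton hdim (h7_model R) h7_checks iso.
- exact: model_instanton hdim (r2h5_model R) r2h5_checks iso.
case=> phi [met [vol [b [nabla [nabla1 [[e [be phiE]] [gmv onb] cc [lc conn] inst]]]]]].
have mphi : multilinear phi.
  by move=> v i c x y; rewrite !phiE standard_G2_multilinear.
have aphi : alternating phi.
  by move=> v i j nij vij; rewrite phiE (standard_G2_alternating e nij vij).
have [f ef] := dual_frame hdim be.
have rphi : repZ f phi phiZ by move=> J; rewrite phiE (standard_G2_rep ef).
have [v [rv cases]] := adapted_cases hdim hnil mphi aphi gmv rphi.
case: cases => [U|U|U|[c [s [nzs cs U]]]].
- have [iso|iso] := line_case hdim hnil mphi gmv onb lc conn cc inst rv U.
    by constructor 1.
  by constructor 2.
- by case: (plane_case hdim hnil mphi gmv onb lc conn cc inst rv U).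
- have [iso|iso] := quat_case hdim hnil mphi gmv onb lc conn cc inst rv U.
    by constructor 3.
  by constructor 4.
by case: (tilt_case hdim hnil mphi gmv onb lc conn cc inst rv nzs cs U).
Qed.
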